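(* Let $\ell\ge 1$, let $(\xi_t)_{t\in\mathbb Z}$ be i.i.d. symmetric centered real random variables with continuous distribution such that $\mathbb E|\xi_0|=1$ and $\mathbb E[\xi_0^2]<\infty$, and let $a_j:\mathbb R^\ell\to\mathbb R$ ($j\in\mathbb N=\{0,1,2,\dots\}$) be known continuous functions with $a_0(\theta)>0$ for all $\theta$. Let $\Theta$ be a compact subset of $$\Theta(2)=\Big\{\theta\in\mathbb R^\ell:\ \mathbb E[\xi_0^2]\sum_{j=1}^\infty a_j^2(\theta)<1\Big\},$$ let $\theta^*\in\Theta$, and let $(X_t)_{t\in\mathbb Z}$ be the stationary LARCH$(\infty)$ process with parameter $\theta^*$, i.e. the stationary solution of $$X_t=\xi_t\Big(a_0(\theta^* )+\sum_{j=1}^\infty a_j(\theta^* )X_{t-j}\Big),\qquad t\in\mathbb Z.$$ Assume moreover: (i) (Assumption $C_\ell(\Theta)$) $a_k\in\mathcal C^\ell(\Theta)$ for every $k\in\mathbb N$, and there exist $C_a>0$ and $\overline d<1/2$ such that $\sup_{\theta\in\Theta}\sum_{j=0}^{\ell}\|\partial^j_{\theta^j}a_k(\theta)\|\le C_a\,k^{\overline d-1}$ for every $k\ge 1$; (ii) (Assumption (S)) for every $t\in\mathbb Z$, $(M_\theta(t))_{\theta\in\Theta}$ is a separable stochastic process on $\Theta$, where $M_\theta(t)=a_0(\theta)+\sum_{k=1}^\infty a_k(\theta)X_{t-k}$; (iii) (Assumption Id$(\Theta)$) if $\theta,\widetilde\theta\in\Theta$ satisfy $a_i(\theta)=a_i(\widetilde\theta)$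 for all $i\in\mathbb N$, then $\theta=\widetilde\theta$. Let $\widehat\theta_n$ be the estimator $$\widehat\theta_n=\operatorname*{Arg\,min}_{\theta\in\Theta}\ \frac1n\sum_{t=1}^n\Big(|X_t|-\Big|a_0(\theta)+\sum_{j=1}^{t-1}a_j(\theta)X_{t-j}\Big|\Big)^2 .$$ Then $\widehat\theta_n\to\theta^*$ almost surely as $n\to\infty$.
   Context: The process $(X_t)$ is observed at times $1,\dots,n$. Under $\theta^*\in\Theta(2)$ the LARCH$(\infty)$ equation has a strictly stationary ergodic causal solution ($X_t$ is a measurable function of $(\xi_{t-j})_{j\ge0}$) with $\mathbb E[X_0^2]<\infty$; this is the solution considered. The infinite sums $\sum_k a_k(\theta)X_{t-k}$ converge in $\mathbb L^2(\Omega)$. $\mathcal C^i(\Theta)$ is the space of $i$-times continuously differentiable functions on $\Theta$; $\partial^k_{\theta^k}\psi(\theta)$ is the array of all partial derivatives of order $k$ of $\psi$, with $\partial^0_{\theta^0}\psi=\psi$; $\|\cdot\|$ is the Euclidean norm (square root of the sum of the squared entries of the array). Empty sums are $0$. $\widehat\theta_n$ denotes a minimizer. *)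

(* Defs.v *)
From HB Require Import structures.
From mathcomp Require Import all_boot all_order all_algebra.
From mathcomp Require Import all_classical all_reals all_analysis.

Set Implicit Arguments.
Unset Strict Implicit.
Unset Printing Implicit Defensive.

Import Order.TTheory GRing.Theory Num.Theory.
Import numFieldNormedType.Exports.

Local Open Scope classical_set_scope.
Local Open Scope ring_scope.

Section processes.
Context d (T : measurableType d) (R : realType) (P : probability T R).

(* The product sigma-algebra on R^I, generated by the coordinate maps. *)
Definition product_measurable (I : Type) : set (set (I -> R)) :=
  <<s [set A | exists i : I, exists2 B : set R,
         measurable B & A = [set x | B (x i)]] >>.

Definition sample_path (I : Type) (Y : I -> T -> R) (w : T) : I -> R :=
  fun i => Y i w.

Definition shift_by (h : int) (x : int -> R) : int -> R := fun t => x (t + h).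

Definition mutually_independent (I : eqType) (Y : I -> T -> R) : Prop :=
  forall (s : seq I) (B : I -> set R),
    uniq s -> (forall i, measurable (B i)) ->
    P [set w | forall i, i \in s -> B i (Y i w)] =
    (\prod_(i <- s) P (Y i @^-1` B i))%E.

Definition identically_distributed (I : Type) (Y : I -> T -> R) : Prop :=
  forall (i j : I) (B : set R),
    measurable B -> P (Y i @^-1` B) = P (Y j @^-1` B).

Definition symmetric_distribution (Y : T -> R) : Prop :=
  forall B : set R, measurable B ->
    P (Y @^-1` B) = P ((fun w => - Y w) @^-1` B).

Definition strictly_stationary (X : int -> T -> R) : Prop :=
  forall (h : int) (A : set (int -> R)), product_measurable A ->
    P ((shift_by h \o sample_path X) @^-1` A) = P (sample_path X @^-1` A).

Definition ergodic (X : int -> T -> R) : Prop :=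
  forall A : set (int -> R), product_measurable A ->
    shift_by 1 @^-1` A = A ->
    P (sample_path X @^-1` A) = 0%E \/ P (sample_path X @^-1` A) = 1%E.

Definition causal (xi X : int -> T -> R) : Prop :=
  forall t : int, exists2 F : (nat -> R) -> R,
    (forall B : set R, measurable B -> product_measurable (F @^-1` B)) &
    {ae P, forall w, X t w = F (fun j : nat => xi (t - j%:Z) w)}.

Definition cvg_L2 (S : nat -> T -> R) (Y : T -> R) : Prop :=
  (Lnorm P 2%:E (fun w => (S n w - Y w)%:E)) @[n --> \oo] --> 0%E.

(* Doob separability of (Y_th)_{th in Theta}, with separating set D and
   exceptional null set N; the relatively open subsets of Theta are the traces
   of the open sets G. *)
Definition separable_process (U : topologicalType) (Theta : set U)
    (Y : U -> T -> R) : Prop :=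
  exists D N, [/\ countable D, D `<=` Theta, Theta `<=` closure D,
    P.-negligible N &
    forall (G : set U) (F : set R), open G -> closed F ->
      [set w | forall th, (G `&` D) th -> F (Y th w)] `\`
      [set w | forall th, (G `&` Theta) th -> F (Y th w)] `<=` N].

End processes.

Section derivatives.
Context (R : realType) (l : nat).
Implicit Types (f : 'rV[R]_l -> R) (Theta : set 'rV[R]_l).

Definition partial (i : 'I_l) f : 'rV[R]_l -> R :=
  fun th => 'D_(delta_mx 0 i) f th.

Definition iter_partial (s : seq 'I_l) f : 'rV[R]_l -> R :=
  foldr partial f s.

(* The array of partial derivatives of order k is indexed by the k-tuples of
   coordinates. *)
Definition norm_partials (k : nat) f (th : 'rV[R]_l) : R :=
  Num.sqrt (\sum_(s : k.-tuple 'I_l) iter_partial s f th ^+ 2).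

Definition C_near (i : nat) Theta f : Prop :=
  exists U : set 'rV[R]_l, [/\ open U, Theta `<=` U &
    forall th, U th -> forall s : seq 'I_l,
      ((size s <= i)%N -> {for th, continuous (iter_partial s f)}) /\
      ((size s < i)%N ->
         forall j, derivable (iter_partial s f) th (delta_mx 0 j))].

(* C^i(Theta) is a space of functions on Theta: such a function is the
   restriction to Theta of a function b that is C^i on an open set containing
   Theta, and its derivatives on Theta are those of b.  When a k itself is C^i
   near Theta, take b k = a k. *)
Definition assumption_C (i : nat) Theta (a : nat -> 'rV[R]_l -> R) : Prop :=
  exists b : nat -> 'rV[R]_l -> R,
    [/\ forall k th, Theta th -> b k th = a k th,
        forall k, C_near i Theta (b k) &
        exists Ca dbar : R, [/\ 0 < Ca, dbar < 1 / 2 &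
          forall k, (1 <= k)%N ->
            (ereal_sup [set (\sum_(j < i.+1) norm_partials j (b k) th)%:E
                       | th in Theta] <=
             (Ca * (k%:R `^ (dbar - 1)))%:E)%E]].

Definition assumption_Id Theta (a : nat -> 'rV[R]_l -> R) : Prop :=
  forall th th', Theta th -> Theta th' ->
    (forall i, a i th = a i th') -> th = th'.

Definition minimizer_on Theta f (th : 'rV[R]_l) : Prop :=
  Theta th /\ forall th', Theta th' -> f th <= f th'.

End derivatives.

Section larch.
Context d (T : measurableType d) (R : realType) (P : probability T R).
Context (l : nat) (a : nat -> 'rV[R]_l -> R).

Definition Theta2 (xi0 : T -> R) : set 'rV[R]_l :=
  [set th | ('E_P[fun w => (xi0 w ^+ 2)%R] *
             \sum_(1 <= j <oo) ((a j th) ^+ 2)%:E < 1)%E].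

(* Y is a version of a_0(th) + sum_(k >= 1) a_k(th) X_(t-k), the sum being an
   L^2 limit. *)
Definition is_M (X : int -> T -> R) (th : 'rV[R]_l) (t : int)
    (Y : T -> R) : Prop :=
  cvg_L2 P (fun n w => a 0%N th + \sum_(1 <= k < n.+1) a k th * X (t - k%:Z) w)
         Y.

Definition larch_solution (xi X : int -> T -> R) (th : 'rV[R]_l) : Prop :=
  forall t : int, exists2 Y : {RV P >-> R},
    is_M X th t Y & {ae P, forall w, X t w = xi t w * Y w}.

Definition contrast (X : int -> T -> R) (n : nat) (w : T)
    (th : 'rV[R]_l) : R :=
  n%:R^-1 * \sum_(1 <= t < n.+1)
    (`|X t%:Z w| -
     `|a 0%N th + \sum_(1 <= j < t) a j th * X (t%:Z - j%:Z) w|) ^+ 2.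

End larch.

(* Main.v *)
Require Import Defs.
From HB Require Import structures.
From mathcomp Require Import all_boot all_order all_algebra.
From mathcomp Require Import all_classical all_reals all_analysis.
From mathcomp Require Import measurable_realfun.
From mathcomp Require Import ring lra zify.

Set Implicit Arguments.
Unset Strict Implicit.
Unset Printing Implicit Defensive.

Import Order.TTheory GRing.Theory Num.Theory.
Import numFieldNormedType.Exports.

Local Open Scope classical_set_scope.
Local Open Scope ring_scope.

(**
The square root of the contrast is an empirical L^2 distance between |X_t| and
|a_0 + sum a_j X_(t-j)|, so it is Lipschitz in the coefficient sequence for the
empirical L^2 norm.  On finite rational coefficient lists Birkhoff's theorem
gives convergence to the L^2 distance on one almost sure event.  What remains is
to bound, uniformly over all coefficient sequences with dyadic l^2 blocks of
square norm at most B^2 q^j, q < 1, the empirical norm of the tail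
sum_(k >= 2^J) a_k X_(t-k).  Since the X_t are symmetric martingale differences, the
l^p norm (p = 2^r) of the Fourier coefficients of a block of length L of X has
mean square of order L^(1+2/p) by 2-smoothness; p is chosen so large that the
factor L^(2/p) is absorbed by q^j, and a maximal ergodic inequality with the
Borel-Cantelli lemma makes the bound almost sure for all blocks at once.

The limit is minimal only at theta*: as E|xi| = 1, the squared distance is
Var|xi| E[M*^2] + E(|M*| - |M_theta|)^2, and |M*| = |M_theta| almost surely forces
equal coefficients because the noise has no atoms and is independent of the past.
Compactness of Theta finishes the argument.
*)

(** The decay [k ^ (dbar - 1)] with [dbar < 1/2] makes the coefficients square summable, possibly
    not absolutely summable, and [X] is only known to have two moments. So a supremum over the
    parameter cannot be passed under the sum over lags. It is replaced by an operator norm: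
    convolution with a block of [X] acts on l^2 with norm at most a constant times the largest
    Fourier coefficient of the block, a random quantity free of the parameter. An l^p norm bounds
    this maximum and satisfies a type 2 inequality with constant p - 1. Taking p a power of 2 turns
    every norm inequality into an induction on squaring. The block sums must be controlled for every
    number of blocks, and the shift by a block length need not be ergodic even if the shift by one
    is; the maximal inequality asks for stationarity alone. With [rho = 2 ^ (1 / 2 ^ r)], the
    squared norm of a block of length 2^j has mean of order 2^j rho^j and is compared with 2^j
    rho^(2j): the ratio rho^(-j) is summable, and [q * rho ^ 2 < 1] sums the tail. *)

Section pnorm.

(** * Norms l^p with dyadic exponents and their smoothness *)

Context {R : realType} {I : finType}.
Implicit Types x y : I -> R.

(* [pnorm r] is the l^p norm with p = 2 ^ r. *)
Fixpoint pnorm (r : nat) (x : I -> R) : R :=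
  if r is r'.+1 then Num.sqrt (pnorm r' (fun i => x i ^+ 2))
  else \sum_i `|x i|.

Lemma pnorm_ge0 r x : 0 <= pnorm r x.
Proof. by case: r => [|r] /=; [apply: sumr_ge0 | apply: sqrtr_ge0]. Qed.

Lemma eq_pnorm r x y : x =1 y -> pnorm r x = pnorm r y.
Proof. by move=> xy; congr pnorm; apply/funext. Qed.

Lemma pnorm_sqr r x : pnorm r.+1 x ^+ 2 = pnorm r (fun i => x i ^+ 2).
Proof. by rewrite /= sqr_sqrtr// pnorm_ge0. Qed.

Lemma ler_pnorm r x y : (forall i, `|x i| <= `|y i|) -> pnorm r x <= pnorm r y.
Proof.
elim: r x y => [|r IH] x y xy /=; first by apply: ler_sum => i _.
apply: ler_wsqrtr; apply: IH => i.
by rewrite !normrX ler_pXn2r// ?nnegrE.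
Qed.

Lemma pnormZ r (c : R) x : pnorm r (fun i => c * x i) = `|c| * pnorm r x.
Proof.
elim: r c x => [|r IH] c x /=.
  by rewrite mulr_sumr; apply: eq_bigr => i _; rewrite normrM.
rewrite (_ : (fun i => _) = (fun i => c ^+ 2 * x i ^+ 2)); last first.
  by apply/funext => i; rewrite exprMn.
by rewrite IH sqrtrM ?normr_ge0// ger0_norm ?sqr_ge0// sqrtr_sqr.
Qed.

Lemma le_pnorm r x i : `|x i| <= pnorm r x.
Proof.
elim: r x => [|r IH] x /=; first by rewrite (bigD1 i)//= lerDl sumr_ge0.
rewrite -sqrtr_sqr; apply: ler_wsqrtr.
by apply: le_trans (IH _); rewrite ler_norm.
Qed.

(** This is where the loss L^(2/p) originates: with p = 2 ^ r, a vector bounded by 1 costs only the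
    p-th root of its number of coordinates, a power that large r makes small. *)
Lemma pnorm_le_card r x : (forall i, `|x i| <= 1) ->
  pnorm r x ^+ (2 ^ r) <= #|I|%:R.
Proof.
elim: r x => [|r IH] x x1.
  rewrite expr1 /= (le_trans (ler_sum _ (fun i _ => x1 i)))//.
  by rewrite sumr_const.
rewrite expnS exprM pnorm_sqr; apply: IH => i.
by rewrite normrX expr_le1.
Qed.

Lemma sum_cauchy_schwarz x y :
  (\sum_i x i * y i) ^+ 2 <= (\sum_i x i ^+ 2) * (\sum_i y i ^+ 2).
Proof.
set A := \sum_i x i ^+ 2; set B := \sum_i y i ^+ 2; set C := \sum_i _.
have B0 : 0 <= B by apply: sumr_ge0 => i _; exact: sqr_ge0.
have : 0 <= \sum_i (B * x i - C * y i) ^+ 2.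
  by apply: sumr_ge0 => i _; exact: sqr_ge0.
have -> : \sum_i (B * x i - C * y i) ^+ 2 = B * (A * B - C ^+ 2).
  transitivity (\sum_i (B ^+ 2 * x i ^+ 2 - 2 * B * C * (x i * y i)
                        + C ^+ 2 * y i ^+ 2)).
    by apply: eq_bigr => i _; ring.
  rewrite big_split/= sumrB -!mulr_sumr -/A -/B -/C; ring.
have [B00|Bn0] := eqVneq B 0.
  move=> _; suff -> : C = 0 by rewrite B00 mulr0 expr0n.
  apply: big1 => i _; suff /eqP : y i ^+ 2 = 0.
    by rewrite expf_eq0 /= => /eqP ->; rewrite mulr0.
  by move/eqP: B00; rewrite psumr_eq0 => [/allP/(_ i (mem_index_enum _))/eqP//|*]; exact: sqr_ge0.
by rewrite pmulr_rge0 ?lt_neqAle ?B0 ?andbT 1?eq_sym// subr_ge0.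
Qed.

(** Hölder's inequality with exponents 2p, 2p and p, by induction: squaring the entries lowers the
    order by one and ends at the Cauchy-Schwarz inequality. *)
Lemma pnormM r x y :
  pnorm r (fun i => x i * y i) <= pnorm r.+1 x * pnorm r.+1 y.
Proof.
elim: r x y => [|r IH] x y.
  rewrite /= -sqrtrM ?sumr_ge0//.
  rewrite -(ger0_norm (sumr_ge0 _ (fun i _ => normr_ge0 _))) -sqrtr_sqr.
  apply: ler_wsqrtr.
  under [X in X ^+ 2 <= _]eq_bigr do rewrite normrM.
  apply: le_trans (sum_cauchy_schwarz _ _) _.
  rewrite le_eqVlt; apply/orP; left; apply/eqP.
  by congr (_ * _); apply: eq_bigr => i _; rewrite normrX.
rewrite [pnorm _.+2 x]/= -/(pnorm r.+1 (fun i => x i ^+ 2)).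
rewrite [pnorm _.+2 y]/= -/(pnorm r.+1 (fun i => y i ^+ 2)).
rewrite -sqrtrM ?pnorm_ge0//; apply: ler_wsqrtr.
apply: le_trans (IH _ _).
by apply: ler_pnorm => i; rewrite exprMn.
Qed.

(** Minkowski's inequality by squaring: (x + y)^2 = x^2 + (2xy + y^2), where the order below applies
    to the sums and [pnormM] to the cross term. *)
Lemma ler_pnormD r x y :
  pnorm r (fun i => x i + y i) <= pnorm r x + pnorm r y.
Proof.
elim: r x y => [|r IH] x y.
  by rewrite /= -big_split/=; apply: ler_sum => i _; exact: ler_normD.
rewrite -[leRHS]ger0_norm ?addr_ge0 ?pnorm_ge0// -sqrtr_sqr /=.
apply: ler_wsqrtr; rewrite -/(pnorm r.+1 x) -/(pnorm r.+1 y).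
rewrite (_ : (fun i => _) = (fun i => x i ^+ 2 + (2 * (x i * y i) + y i ^+ 2))); last first.
  by apply/funext => i; ring.
apply: le_trans (IH _ _) _; apply: le_trans (lerD (lexx _) (IH _ _)) _.
rewrite -!pnorm_sqr pnormZ (ger0_norm (ler0n _ _)).
have := pnormM r x y; nra.
Qed.

(** The 2-smoothness of l^p for p = 2 ^ (r + 1), with constant p - 1. For r = 0 it is the
    parallelogram law. For the step, (x + y)^2 = u + v and (x - y)^2 = u - v with u = x^2 + y^2 and
    v = 2xy, so the induction hypothesis for [u] and [v] controls the squares of the two quantities
    to be added; the constant passes from K to 1 + 2K. *)
Lemma pnorm_smooth r x y :
  pnorm r.+1 (fun i => x i + y i) ^+ 2 + pnorm r.+1 (fun i => x i - y i) ^+ 2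
  <= 2 * pnorm r.+1 x ^+ 2 + 2 * (2 ^+ r.+1 - 1) * pnorm r.+1 y ^+ 2.
Proof.
elim: r x y => [|r IH] x y.
  rewrite !pnorm_sqr /= expr1 -big_split !mulr_sumr -big_split/=.
  apply: ler_sum => i _; rewrite !ger0_norm ?sqr_ge0//; nra.
set K := (2 ^+ r.+1 - 1 : R) in IH.
have K0 : 0 <= K by rewrite subr_ge0 exprn_ege1// ler1n.
have -> : 2 ^+ r.+2 - 1 = 1 + 2 * K :> R by rewrite /K [in LHS]exprS; ring.
pose u i := x i ^+ 2 + y i ^+ 2; pose v i := 2 * (x i * y i).
rewrite !(pnorm_sqr r.+1).
rewrite (_ : (fun i => (x i + y i) ^+ 2) = (fun i => u i + v i)); last first.
  by apply/funext => i; rewrite /u /v; ring.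
rewrite (_ : (fun i => (x i - y i) ^+ 2) = (fun i => u i - v i)); last first.
  by apply/funext => i; rewrite /u /v; ring.
rewrite -!(pnorm_sqr r.+1).
have := IH u v; set p := pnorm _ _; set q := pnorm _ _ => pq.
have Nu : pnorm r.+1 u <= pnorm r.+2 x ^+ 2 + pnorm r.+2 y ^+ 2.
  by rewrite !(pnorm_sqr r.+1); exact: ler_pnormD.
have Nv : pnorm r.+1 v <= 2 * (pnorm r.+2 x * pnorm r.+2 y).
  rewrite pnormZ (ger0_norm (ler0n _ _)) ler_wpM2l//; exact: pnormM.
move: Nu Nv pq (pnorm_ge0 r.+1 u) (pnorm_ge0 r.+1 v).
move: (pnorm_ge0 r.+2 x) (pnorm_ge0 r.+2 y).
move: (pnorm r.+1 u) (pnorm r.+1 v) (pnorm r.+2 x) (pnorm r.+2 y) => U V X Y.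
move=> X0 Y0 Nu Nv pq U0 V0.
have U2 : U ^+ 2 <= (X ^+ 2 + Y ^+ 2) ^+ 2.
  by rewrite ler_pXn2r// nnegrE// addr_ge0 ?sqr_ge0.
have V2 : V ^+ 2 <= (2 * (X * Y)) ^+ 2.
  by rewrite ler_pXn2r// nnegrE// !mulr_ge0.
have KV : K * V ^+ 2 <= K * (2 * (X * Y)) ^+ 2 by rewrite ler_wpM2l.
set Z := X ^+ 2 + (1 + 2 * K) * Y ^+ 2.
have Z0 : 0 <= Z by rewrite addr_ge0 ?mulr_ge0 ?sqr_ge0// addr_ge0// mulr_ge0.
(* As (p + q)^2 <= 2 (p^2 + q^2), it is enough to compare squares; the slack is 16 (K + K^2) Y^4. *)
have pq2 : (p + q) ^+ 2 <= (2 * Z) ^+ 2.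
  apply: (@le_trans _ _ (2 * (p ^+ 2 + q ^+ 2))).
    have := sqr_ge0 (p - q); nra.
  apply: (@le_trans _ _ (4 * ((X ^+ 2 + Y ^+ 2) ^+ 2 + K * (2 * (X * Y)) ^+ 2))).
    by nra.
  have -> : (2 * Z) ^+ 2 = 4 * ((X ^+ 2 + Y ^+ 2) ^+ 2 + K * (2 * (X * Y)) ^+ 2)
     + 16 * (K + K ^+ 2) * (Y ^+ 2) ^+ 2 by rewrite /Z; ring.
  by rewrite lerDl !mulr_ge0// ?sqr_ge0// addr_ge0 ?sqr_ge0.
have -> : 2 * X ^+ 2 + 2 * (1 + 2 * K) * Y ^+ 2 = 2 * Z by rewrite /Z; ring.
rewrite leNgt; apply/negP => lt2.
have : (2 * Z) ^+ 2 < (p + q) ^+ 2 by rewrite ltr_pXn2r// nnegrE ?mulr_ge0// (le_trans _ (ltW lt2))// mulr_ge0.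
by rewrite ltNge pq2.
Qed.

End pnorm.

(** * Discrete Fourier transform and convolution by blocks *)

Section fourier.
Context {R : realType}.

Lemma sum_shift_period (f : nat -> R) N : f N = f 0 ->
  \sum_(j < N) f j.+1 = \sum_(j < N) f j.
Proof.
case: N => [|N] fN; first by rewrite !big_ord0.
by rewrite big_ord_recr/= fN [RHS]big_ord_recl addrC.
Qed.

Definition root_angle (N m : nat) : R := (m%:R / N%:R) * (pi *+ 2).

Lemma cos_periodn (x : R) n : cos (x + pi *+ 2 *+ n) = cos x.
Proof. by elim: n => [|n IH]; rewrite ?mulr0n ?addr0// mulrSr addrA cosD2pi. Qed.

Lemma sin_periodn (x : R) n : sin (x + pi *+ 2 *+ n) = sin x.
Proof. by elim: n => [|n IH]; rewrite ?mulr0n ?addr0// mulrSr addrA sinD2pi. Qed.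

Lemma cos_root_neq1 N m : (0 < m < N)%N -> cos (root_angle N m) != 1.
Proof.
case/andP=> m0 mN; have N0 : (0 < N)%N by exact: leq_trans mN.
have -> : root_angle N m = (m%:R / N%:R * pi) *+ 2.
  by rewrite /root_angle mulrnAr.
rewrite cos_mulr2n cos2sin2 lt_eqF//.
have : 0 < sin (m%:R / N%:R * pi :> R).
  apply: sin_gt0_pi; rewrite mulr_gt0 ?divr_gt0 ?ltr0n ?pi_gt0//=.
  by rewrite gtr_pMl ?pi_gt0// ltr_pdivrMr ?ltr0n// mul1r ltr_nat.
rewrite mulr2n => s0; have : 0 < sin (m%:R / N%:R * pi :> R) ^+ 2 by rewrite exprn_gt0.
lra.
Qed.

(* Multiplying all the roots by one of them permutes them, so the sum is fixed
   by a nontrivial rotation. *)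
Lemma sum_cos_root N m : (0 < m < N)%N ->
  \sum_(j < N) cos (root_angle N m * j%:R) = 0.
Proof.
move=> mN; have N0 : (0 < N)%N by case/andP: mN => _; apply: leq_trans.
have tN : root_angle N m * N%:R = 0 + pi *+ 2 *+ m.
  by rewrite /root_angle mulrAC divfK ?pnatr_eq0 -?lt0n// mulr_natl add0r.
set t := root_angle N m in tN *.
have E1 := @sum_shift_period (fun j => cos (t * j%:R)) N.
have E2 := @sum_shift_period (fun j => sin (t * j%:R)) N.
have {}E1 := E1 (_ : _ = _); have {}E2 := E2 (_ : _ = _).
rewrite tN cos_periodn mulr0 in E1; have {}E1 := E1 erefl.
rewrite tN sin_periodn mulr0 in E2; have {}E2 := E2 erefl.
set C := (X in _ = X) in E1 *; set S := (X in _ = X) in E2.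
have F1 : cos t * C - sin t * S = C.
  rewrite -[RHS]E1 /C /S !mulr_sumr -sumrB; apply: eq_bigr => j _.
  by rewrite mulrS mulrDr mulr1 cosD.
have F2 : sin t * C + cos t * S = S.
  rewrite -[RHS]E2 /C /S !mulr_sumr -big_split; apply: eq_bigr => j _.
  by rewrite mulrS mulrDr mulr1 sinD.
have : ((1 - cos t) ^+ 2 + sin t ^+ 2) * C = 0.
  transitivity ((1 - cos t) * (C - (cos t * C - sin t * S)) -
     sin t * (S - (sin t * C + cos t * S))); first by ring.
  by rewrite F1 F2; ring.
move/eqP; rewrite mulf_eq0 => /orP[|/eqP//].
rewrite paddr_eq0 ?sqr_ge0// => /andP[+ _].
rewrite expf_eq0/= subr_eq0 eq_sym => /eqP ct.
by have := cos_root_neq1 mN; rewrite -/t ct eqxx.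
Qed.

(** Expanding both squares leaves the cosine of a difference of angles. After exchanging the sums,
    the diagonal counts the N frequencies and every other term is a vanishing sum over roots of
    unity. *)
Lemma parseval N (y : nat -> R) :
  \sum_(j < N) ((\sum_(t < N) y t * cos (root_angle N t * j%:R)) ^+ 2 +
                (\sum_(t < N) y t * sin (root_angle N t * j%:R)) ^+ 2) =
  N%:R * \sum_(t < N) y t ^+ 2.
Proof.
transitivity (\sum_(j < N) \sum_(t < N) \sum_(t' < N)
    y t * y t' * cos ((root_angle N t - root_angle N t') * j%:R)).
  apply: eq_bigr => j _; rewrite !expr2 !mulr_suml -big_split/=.
  apply: eq_bigr => t _; rewrite !mulr_sumr -big_split/=.
  apply: eq_bigr => t' _; rewrite mulrBl cosB; ring.
rewrite exchange_big/= mulr_sumr; apply: eq_bigr => t _.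
rewrite exchange_big/= (bigD1 t)//= [X in _ + X]big1 ?addr0.
  under eq_bigr do rewrite subrr mul0r cos0 mulr1.
  by rewrite sumr_const card_ord mulr_natl expr2.
(* Angles are indexed by natural numbers, so only [t' < t] is direct; the other case follows because
   cosine is even. *)
have tl : forall t t' : 'I_N, (t' < t)%N ->
    \sum_(j < N) cos ((root_angle N t - root_angle N t') * j%:R) = 0.
  move=> u u' uu; have -> : root_angle N u - root_angle N u' = root_angle N (u - u').
    by rewrite /root_angle natrB 1?ltnW// !mulrBl.
  apply: sum_cos_root; rewrite subn_gt0 uu/=.
  by rewrite (leq_ltn_trans (leq_subr _ _)).
move=> t' tt'; rewrite -mulr_sumr.
have [lt|gt|/val_inj eq] := ltngtP t' t; last by rewrite eq eqxx in tt'.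
  by rewrite tl ?mulr0.
rewrite (eq_bigr (fun j : 'I_N => cos ((root_angle N t' - root_angle N t) * j%:R))).
  by rewrite tl ?mulr0.
by move=> j _; rewrite -opprB mulNr cosN.
Qed.

Definition fourier_vector (N s : nat) (i : 'I_N * bool) : R :=
  if i.2 then cos (root_angle N s * i.1%:R) else sin (root_angle N s * i.1%:R).

Lemma fourier_vector_le1 N s (i : 'I_N * bool) : `|fourier_vector s i| <= 1.
Proof.
rewrite /fourier_vector ler_norml; case: i.2.
  by rewrite cos_geN1 cos_le1.
by rewrite sin_geN1 sin_le1.
Qed.

(** There are twice as many frequencies as entries because the convolution of two sequences of
    length L lives on the indices below 2L: at this length it does not wrap around. *)
Definition block_norm (r L : nat) (x : nat -> R) : R :=
  pnorm r (fun i : 'I_(L.*2) * bool => \sum_(s < L) x s * fourier_vector s i).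

Definition convolution (L : nat) (b x : nat -> R) (t : nat) : R :=
  \sum_(k < L) \sum_(s < L | (k + s == t)%N) b k * x s.

Lemma sum_convolution L (b x f : nat -> R) :
  \sum_(t < L.*2) convolution L b x t * f t =
  \sum_(k < L) \sum_(s < L) b k * x s * f (k + s)%N.
Proof.
under eq_bigr do rewrite /convolution mulr_suml.
rewrite exchange_big/=; apply: eq_bigr => k _.
under eq_bigr do rewrite mulr_suml.
rewrite (exchange_big_dep predT)//=; apply: eq_bigr => s _.
have ks : (k + s < L.*2)%N by rewrite -addnn -addnS leq_add// ltnW.
rewrite (bigD1 (Ordinal ks))//= big1 ?addr0// => t /andP[/eqP kst].
by move=> /eqP[]; apply: val_inj.
Qed.

(** Parseval moves the left side to frequencies, where convolution is a product of transforms. The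
    real and the imaginary part of the transform of [x] are each at most the l^p norm, whence the
    factor 2; Parseval for [b] brings back its square norm. *)
Lemma convolution_le r L (b x : nat -> R) :
  \sum_(t < L.*2) convolution L b x t ^+ 2 <=
  2 * block_norm r L x ^+ 2 * \sum_(k < L) b k ^+ 2.
Proof.
have [->|L0] := posnP L.
  by rewrite !big_ord0 mulr0.
set N := L.*2; set V := block_norm r L x.
have N0 : (0 < N)%N by rewrite double_gt0.
have NR : 0 < N%:R :> R by rewrite ltr0n.
rewrite -(ler_pM2l NR) -parseval.
pose A (j : 'I_N) (z : nat -> R) := \sum_(t < L) z t * cos (root_angle N t * j%:R).
pose B (j : 'I_N) (z : nat -> R) := \sum_(t < L) z t * sin (root_angle N t * j%:R).
have ra s t : root_angle N (s + t) = root_angle N s + root_angle N t.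
  by rewrite /root_angle natrD !mulrDl.
have E1 (j : 'I_N) : \sum_(t < N) convolution L b x t * cos (root_angle N t * j%:R) =
   A j b * A j x - B j b * B j x.
  rewrite (sum_convolution _ _ _ (fun t => cos (root_angle N t * j%:R))).
  rewrite /A /B !mulr_suml -sumrB; apply: eq_bigr => k _.
  rewrite !mulr_sumr -sumrB; apply: eq_bigr => s _.
  rewrite ra mulrDl cosD; ring.
have E2 (j : 'I_N) : \sum_(t < N) convolution L b x t * sin (root_angle N t * j%:R) =
   B j b * A j x + A j b * B j x.
  rewrite (sum_convolution _ _ _ (fun t => sin (root_angle N t * j%:R))).
  rewrite /A /B !mulr_suml -big_split; apply: eq_bigr => k _ /=.
  rewrite !mulr_sumr -big_split; apply: eq_bigr => s _ /=.
  rewrite ra mulrDl sinD; ring.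
apply: (@le_trans _ _ (\sum_(j < N) (2 * V ^+ 2) * (A j b ^+ 2 + B j b ^+ 2))).
  apply: ler_sum => j _; rewrite E1 E2.
  have -> : (A j b * A j x - B j b * B j x) ^+ 2 + (B j b * A j x + A j b * B j x) ^+ 2
     = (A j x ^+ 2 + B j x ^+ 2) * (A j b ^+ 2 + B j b ^+ 2) by ring.
  rewrite ler_wpM2r ?addr_ge0 ?sqr_ge0//.
  have V0 : 0 <= V := pnorm_ge0 _ _.
  have := le_pnorm r (fun i : 'I_N * bool => \sum_(s < L) x s * fourier_vector s i) (j, true).
  have := le_pnorm r (fun i : 'I_N * bool => \sum_(s < L) x s * fourier_vector s i) (j, false).
  rewrite -/(block_norm _ _ _) -/V -/(A j x) -/(B j x) => a1 a2.
  have sq z : `|z| <= V -> z ^+ 2 <= V ^+ 2.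
    by move=> zV; rewrite -(real_normK (num_real z)) ler_pXn2r// nnegrE.
  by have := sq _ a1; have := sq _ a2; lra.
rewrite -mulr_sumr [leRHS]mulrCA; apply: ler_wpM2l; first by rewrite mulr_ge0 ?sqr_ge0.
(* [b] is extended by zero from L to 2L entries, to be read at the same frequencies. *)
have := parseval N (fun t => if (t < L)%N then b t else 0).
have cut (g : nat -> R) : \sum_(t < N) (if (t < L)%N then b t else 0) * g t = \sum_(t < L) b t * g t.
  rewrite (big_ord_widen N (fun t => b t * g t)) ?leq_double_self//; last first.
    by rewrite /N -addnn leq_addr.
  rewrite [RHS]big_mkcond/=; apply: eq_bigr => t _; case: ifP => //; rewrite ?mul0r//.
under eq_bigr do rewrite (cut (fun t => cos (root_angle N t * _))) (cut (fun t => sin (root_angle N t * _))).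
rewrite /A /B => ->; apply: ler_wpM2l; first exact: ltW.
under eq_bigr do rewrite expr2 -mulrC.
rewrite (cut (fun t => if (t < L)%N then b t else 0)).
by apply: ler_sum => i _; rewrite ltn_ord expr2.
Qed.

Lemma sum_ord_mul m L (F : nat -> R) :
  \sum_(t < m * L) F t = \sum_(e < m) \sum_(p < L) F (e * L + p)%N.
Proof.
elim: m => [|m IH]; first by rewrite !big_ord0.
rewrite big_ord_recr/= -IH mulSn addnC big_split_ord/=.
by congr (_ + _).
Qed.

(** A lag [k <= p] reads the input in the block of the output. A lag [k > p] reads it in the block
    before, whose convolution reaches this output in its second half, at [L + p]. *)
Lemma convolution_blocks L (b x : nat -> R) e (p : 'I_L) :
  \sum_(k < L | (k <= e.+1 * L + p)%N) b k * x (e.+1 * L + p - k)%N =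
  convolution L b (fun s => x (e.+1 * L + s)%N) p +
  convolution L b (fun s => x (e * L + s)%N) (L + p).
Proof.
rewrite /convolution -big_split/= big_mkcond/=; apply: eq_bigr => k _.
have kL := ltn_ord k; have pL := ltn_ord p.
rewrite ifT; last by rewrite mulSn -addnA (leq_trans (ltnW kL))// leq_addr.
have [kp|pk] := leqP k p.
  have h : (p - k < L)%N by rewrite (leq_ltn_trans (leq_subr _ _)).
  rewrite (bigD1 (Ordinal h)) /=; last by rewrite subnKC.
  rewrite -addnBA// big1 ?addr0; last first.
    move=> s /andP[/eqP s1 /eqP[]]; apply: val_inj => /=; lia.
  rewrite big_pred0 ?addr0// => s; apply/negP => /eqP; have := ltn_ord s; lia.
have h : (L + p - k < L)%N by lia.
rewrite big_pred0 ?add0r; last by move=> s; apply/negP => /eqP; lia.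
rewrite (bigD1 (Ordinal h)) /=; last by apply/eqP; lia.
rewrite big1 ?addr0; last first.
  by move=> s /andP[/eqP s1 /eqP[]]; apply: val_inj => /=; lia.
by congr (_ * x _); rewrite mulSn; lia.
Qed.

Lemma convolution_block0 L (b x : nat -> R) (p : 'I_L) :
  \sum_(k < L | (k <= p)%N) b k * x (p - k)%N = convolution L b x p.
Proof.
rewrite /convolution big_mkcond/=; apply: eq_bigr => k _.
have pL := ltn_ord p; case: leqP => kp; last first.
  by rewrite big_pred0// => s; apply/negP => /eqP; lia.
have h : (p - k < L)%N by rewrite (leq_ltn_trans (leq_subr _ _)).
rewrite (bigD1 (Ordinal h)) /=; last by rewrite subnKC.
rewrite big1 ?addr0// => s /andP[/eqP s1 /eqP[]]; apply: val_inj => /=; lia.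
Qed.

(* Each output index is reached from at most two consecutive input blocks. *)
Lemma convolution_blocks_le r L m n (b x : nat -> R) : (n <= m * L)%N ->
  \sum_(t < n) (\sum_(k < L | (k <= t)%N) b k * x (t - k)%N) ^+ 2 <=
  4 * (\sum_(k < L) b k ^+ 2) *
    \sum_(e < m) block_norm r L (fun s => x (e * L + s)%N) ^+ 2.
Proof.
move=> nm.
pose W t := (\sum_(k < L | (k <= t)%N) b k * x (t - k)%N) ^+ 2.
apply: (@le_trans _ _ (\sum_(t < m * L) W t)).
  rewrite (big_ord_widen _ W nm) big_mkcond/=; apply: ler_sum => t _.
  by case: ifP => // _; exact: sqr_ge0.
pose y e t := convolution L b (fun s => x (e * L + s)%N) t ^+ 2.
have y0 e t : 0 <= y e t by exact: sqr_ge0.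
apply: (@le_trans _ _ (2 * \sum_(e < m) \sum_(t < L.*2) y e t)); last first.
  rewrite -!mulrA (_ : 4 = 2 * 2); last by ring.
  rewrite -mulrA ler_wpM2l// !mulr_sumr; apply: ler_sum => e _.
  by apply: le_trans (convolution_le r _ _ _) _; rewrite -mulrA (mulrC (\sum_(_ < _) _)).
rewrite sum_ord_mul.
have split2 e : \sum_(t < L.*2) y e t = \sum_(p < L) y e p + \sum_(p < L) y e (L + p)%N.
  by rewrite -addnn big_split_ord.
case: m nm => [|m] nm; first by rewrite !big_ord0 mulr0.
(* A stronger claim for the induction: the last block is charged only for the first half of its
   convolution, because the second half spills into outputs not yet counted. *)
suff : \sum_(e < m.+1) \sum_(p < L) W (e * L + p)%N <=
    2 * \sum_(e < m) \sum_(t < L.*2) y e t + 2 * \sum_(p < L) y m p.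
  move=> h; apply: le_trans h _; rewrite [in leRHS]big_ord_recr/= split2.
  rewrite mulrDr lerD2l ler_wpM2l// lerDl sumr_ge0//.
elim: m {nm} => [|m IH].
  rewrite big_ord_recl !big_ord0 mulr0 addr0 add0r mulr_sumr; apply: ler_sum => p _.
  rewrite mul0n add0n /W convolution_block0 /y.
  rewrite (_ : (fun s => _) = x); first by rewrite ler_peMl ?sqr_ge0// ler1n.
  by apply/funext => s; rewrite mul0n.
rewrite big_ord_recr/=; apply: le_trans (lerD IH (lexx _)) _.
rewrite [in leRHS]big_ord_recr/= split2 !mulrDr -!addrA lerD2l lerD2l.
rewrite -mulrDr -big_split mulr_sumr; apply: ler_sum => p _ /=.
rewrite /W convolution_blocks /y.
set u := convolution _ _ _ _; set v := convolution _ _ _ _.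
by have := sqr_ge0 (u - v); nra.
Qed.

End fourier.

(** * Measurability and real-valued expectations *)

Section measurable_comparison_sets.
Context d (T : measurableType d) (R : realType).
Implicit Types f g : T -> R.

Lemma measurable_ltr_set f g : measurable_fun setT f -> measurable_fun setT g ->
  measurable [set x | f x < g x].
Proof.
move=> mf mg; have : measurable [set true] by [].
move=> /(measurable_fun_ltr mf mg measurableT).
by rewrite setTI; congr measurable; apply/seteqP; split => x.
Qed.

Lemma measurable_ler_set f g : measurable_fun setT f -> measurable_fun setT g ->
  measurable [set x | f x <= g x].
Proof.
move=> mf mg; have : measurable [set true] by [].
move=> /(measurable_fun_ler mf mg measurableT).
by rewrite setTI; congr measurable; apply/seteqP; split => x.
Qed.

Lemma measurable_eqr_set f g : measurable_fun setT f -> measurable_fun setT g ->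
  measurable [set x | f x = g x].
Proof.
move=> mf mg; have : measurable [set true] by [].
move=> /(measurable_fun_eqr mf mg measurableT).
by rewrite setTI; congr measurable; apply/seteqP; split => x /eqP.
Qed.

Lemma measurable_sum_in (I : eqType) (s : seq I) (h : I -> T -> R) :
  (forall i, i \in s -> measurable_fun setT (h i)) ->
  measurable_fun setT (fun x => \sum_(i <- s) h i x).
Proof.
elim: s => [|i s IH] mh.
  by under eq_fun do rewrite big_nil; exact: measurable_cst.
under eq_fun do rewrite big_cons; apply: measurable_funD.
  by apply: mh; rewrite inE eqxx.
by apply: IH => j js; apply: mh; rewrite inE js orbT.
Qed.

End measurable_comparison_sets.

Section expectation.
Context d (T : measurableType d) (R : realType) (P : probability T R).
Implicit Types f g : T -> R.

Definition rintegrable (f : T -> R) := P.-integrable setT (EFin \o f).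
Definition Ex (f : T -> R) : R := Rintegral P setT f.

Lemma rintegrable_measurable f : rintegrable f -> measurable_fun setT f.
Proof. by move=> /measurable_int /measurable_EFinP. Qed.

Lemma rintegrable_cst c : rintegrable (cst c).
Proof. exact: finite_measure_integrable_cst. Qed.

Lemma rintegrableD f g : rintegrable f -> rintegrable g ->
  rintegrable (fun w => f w + g w).
Proof. by move=> fi gi; exact: (integrableD measurableT fi gi). Qed.

Lemma rintegrableB f g : rintegrable f -> rintegrable g ->
  rintegrable (fun w => f w - g w).
Proof. by move=> fi gi; exact: (integrableB measurableT fi gi). Qed.

Lemma rintegrableZ c f : rintegrable f -> rintegrable (fun w => c * f w).
Proof. by move=> fi; exact: (integrableZl measurableT c fi). Qed.

Lemma rintegrable_norm f : rintegrable f -> rintegrable (fun w => `|f w|).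
Proof. by move=> fi; exact: (integrable_abse fi). Qed.

Lemma rintegrable_le f g : measurable_fun setT g ->
  (forall w, `|g w| <= f w) -> rintegrable f -> rintegrable g.
Proof.
move=> mg gf fi; apply: (le_integrable measurableT _ _ fi).
  exact/measurable_EFinP.
by move=> w _ /=; rewrite lee_fin (le_trans (gf w))// ler_norm.
Qed.

Lemma rintegrable_mask f (A : set T) : measurable A -> rintegrable f ->
  rintegrable (fun w => f w * \1_A w).
Proof.
move=> mA fi; apply: rintegrable_le (rintegrable_norm fi).
  by apply: measurable_funM; [exact: rintegrable_measurable|exact: measurable_indic].
by move=> w; rewrite normrM ler_piMr// ger0_norm.
Qed.

Lemma rintegrable_sum (I : Type) (r : seq I) (f : I -> T -> R) :
  (forall i, rintegrable (f i)) -> rintegrable (fun w => \sum_(i <- r) f i w).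
Proof.
move=> fi; elim: r => [|i r IH].
  by under eq_fun do rewrite big_nil; exact: rintegrable_cst.
by under eq_fun do rewrite big_cons; exact: rintegrableD.
Qed.

Lemma Ex_cst c : Ex (cst c) = c.
Proof. by rewrite /Ex Rintegral_cst//; change (c * fine (P setT) = c); rewrite probability_setT mulr1. Qed.

Lemma ExD f g : rintegrable f -> rintegrable g ->
  Ex (fun w => f w + g w) = Ex f + Ex g.
Proof. exact: RintegralD. Qed.

Lemma ExB f g : rintegrable f -> rintegrable g ->
  Ex (fun w => f w - g w) = Ex f - Ex g.
Proof. exact: RintegralB. Qed.

Lemma ExZ c f : rintegrable f -> Ex (fun w => c * f w) = c * Ex f.
Proof. by move=> fi; exact: RintegralZl. Qed.

Lemma ler_Ex f g : rintegrable f -> rintegrable g -> (forall w, f w <= g w) ->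
  Ex f <= Ex g.
Proof. by move=> fi gi fg; apply: le_Rintegral. Qed.

Lemma Ex_ge0 f : (forall w, 0 <= f w) -> 0 <= Ex f.
Proof. by move=> f0; apply: Rintegral_ge0. Qed.

Lemma Ex_sum (I : Type) (r : seq I) (f : I -> T -> R) :
  (forall i, rintegrable (f i)) ->
  Ex (fun w => \sum_(i <- r) f i w) = \sum_(i <- r) Ex (f i).
Proof.
move=> fi; elim: r => [|i r IH].
  by under eq_fun do rewrite big_nil; rewrite Ex_cst big_nil.
by under eq_fun do rewrite big_cons; rewrite ExD ?IH ?big_cons//; exact: rintegrable_sum.
Qed.

Lemma EFin_Ex f : rintegrable f -> (Ex f)%:E = (\int[P]_w (f w)%:E)%E.
Proof. by move=> fi; rewrite /Ex /Rintegral fineK//; exact: integrable_fin_num. Qed.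

Lemma Ex_indic (A : set T) : measurable A -> (Ex (\1_A))%:E = P A.
Proof.
move=> mA; rewrite EFin_Ex; first by rewrite integral_indic// setIT.
exact: integrable_indic.
Qed.

Lemma ae_eq_Ex f g : measurable_fun setT f -> measurable_fun setT g ->
  {ae P, forall w, f w = g w} -> Ex f = Ex g.
Proof.
move=> mf mg fg; rewrite /Ex /Rintegral; congr fine.
apply: ae_eq_integral => //; [exact/measurable_EFinP|exact/measurable_EFinP|].
by apply: filterS fg => w -> _.
Qed.

Lemma ae_eq_rintegrable f g : measurable_fun setT g ->
  {ae P, forall w, f w = g w} -> rintegrable f -> rintegrable g.
Proof.
move=> mg fg fi; apply/integrableP; split; first exact/measurable_EFinP.
have /integrableP[mf lty] := fi; apply: le_lt_trans lty.
rewrite le_eqVlt; apply/orP; left; apply/eqP.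
apply: ae_eq_integral => //.
- by apply: measurableT_comp => //; exact/measurable_EFinP.
- by apply: measurableT_comp.
- by apply: filterS fg => w /= -> _.
Qed.

Lemma ge0_rintegrable f : measurable_fun setT f -> (forall w, 0 <= f w) ->
  (\int[P]_w (f w)%:E < +oo)%E -> rintegrable f.
Proof.
move=> mf f0 lty; apply/integrableP; split; first exact/measurable_EFinP.
by under eq_integral do rewrite /= ger0_norm//.
Qed.

End expectation.

Arguments Ex {d T R} P f.
Arguments rintegrable {d T R} P f.

(** * Maximal ergodic inequality and Birkhoff's theorem *)

Section ergodic_theory.
Context d (T : measurableType d) (R : realType) (Q : probability T R).
Variable tau : T -> T.
Hypothesis mtau : measurable_fun setT tau.
Hypothesis Qtau : forall A, measurable A -> Q (tau @^-1` A) = Q A.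
Implicit Types (f g : T -> R).

Let integral_tau (f : T -> \bar R) : measurable_fun [set: T] f ->
  (forall x, 0 <= f x)%E -> (\int[Q]_x f (tau x) = \int[Q]_x f x)%E.
Proof.
move=> mf f0.
have := @ge0_integral_pushforward _ _ _ _ R tau mtau Q setT f measurableT mf (fun y _ => f0 y).
rewrite preimage_setT /= => <-.
apply: eq_measure_integral => A mA _; exact: Qtau.
Qed.

Lemma rintegrable_tau f : rintegrable Q f -> rintegrable Q (f \o tau).
Proof.
move=> /integrableP[mf lty]; apply/integrableP; split.
  by apply: measurableT_comp mf mtau.
rewrite (integral_tau (f := fun x => `|(f x)%:E|%E))//.
exact: measurableT_comp.
Qed.

Lemma Ex_tau f : rintegrable Q f -> Ex Q (f \o tau) = Ex Q f.
Proof.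
move=> fi; rewrite /Ex /Rintegral; congr fine.
rewrite integralE [RHS]integralE; congr (_ - _)%E.
  rewrite -(integral_tau (f := ((EFin \o f)^\+)%E)).
  - by apply: eq_integral => x _; rewrite !funeposE.
  - exact: measurable_funepos (measurable_int Q fi).
  - by move=> x; exact: funepos_ge0.
rewrite -(integral_tau (f := ((EFin \o f)^\-)%E)).
- by apply: eq_integral => x _; rewrite !funenegE.
- exact: measurable_funeneg (measurable_int Q fi).
- by move=> x; exact: funeneg_ge0.
Qed.

Definition birkhoff_sum f n (x : T) : R := \sum_(i < n) f (iter i tau x).

Lemma birkhoff_sumS f n x :
  birkhoff_sum f n.+1 x = f x + birkhoff_sum f n (tau x).
Proof.
rewrite /birkhoff_sum big_ord_recl; congr (_ + _).
by apply: eq_bigr => i _; rewrite /= /bump/= -iterSr.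
Qed.

Lemma measurable_iter n : measurable_fun setT (iter n tau).
Proof. by elim: n => [|n IH] /=; [exact: measurable_id|exact: measurableT_comp]. Qed.

Lemma measurable_birkhoff_sum f n : measurable_fun setT f ->
  measurable_fun setT (birkhoff_sum f n).
Proof.
move=> mf; rewrite /birkhoff_sum; apply: measurable_sum => i.
exact: measurableT_comp mf (measurable_iter _).
Qed.

(** The maximum of 0 and the first n Birkhoff sums, written as a recursion along [tau] so that the
    comparison in the maximal ergodic theorem is one unfolding. *)
Fixpoint running_max f n : T -> R :=
  if n is n'.+1 then fun x => Num.max 0 (f x + running_max f n' (tau x)) else cst 0.

Lemma running_max_ge0 f n x : 0 <= running_max f n x.
Proof. by case: n => [|n] //=; rewrite le_max lexx. Qed.

Lemma running_max_leS f n x : running_max f n x <= running_max f n.+1 x.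
Proof.
elim: n x => [|n IH] x; first exact: running_max_ge0.
rewrite [leRHS]/= [leLHS]/= le_max2//= ?lerD2l//; exact: IH.
Qed.

Lemma birkhoff_sum_le_running_max f n x : birkhoff_sum f n x <= running_max f n x.
Proof.
elim: n x => [|n IH] x; first by rewrite /birkhoff_sum big_ord0.
by rewrite birkhoff_sumS /= le_max lerD2l IH orbT.
Qed.

Lemma birkhoff_sum_running_max f n k x : (k <= n)%N ->
  birkhoff_sum f k x <= running_max f n x.
Proof.
elim: n => [|n IH]; first by rewrite leqn0 => /eqP ->; exact: birkhoff_sum_le_running_max.
rewrite leq_eqVlt => /predU1P[->|kn]; first exact: birkhoff_sum_le_running_max.
exact: le_trans (IH kn) (running_max_leS _ _ _).
Qed.

Lemma running_max_rintegrable f n : rintegrable Q f -> rintegrable Q (running_max f n).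
Proof.
move=> fi; elim: n => [|n IH] /=; first exact: rintegrable_cst.
have h := rintegrableD fi (rintegrable_tau IH).
apply: rintegrable_le (rintegrable_norm h).
  apply: measurable_maxr; first exact: measurable_cst.
  exact: rintegrable_measurable h.
by move=> x /=; rewrite ger0_norm ?le_max ?lexx// ge_max normr_ge0 ler_norm.
Qed.

Lemma measurable_running_max_gt0 f n : rintegrable Q f ->
  measurable [set x | 0 < running_max f n x].
Proof.
move=> fi; apply: (measurable_ltr_set (f := fun=> 0)); first exact: measurable_cst.
exact: rintegrable_measurable (running_max_rintegrable n fi).
Qed.

(* Garsia's proof of the maximal ergodic theorem. *)
Lemma maximal_ergodic f n : rintegrable Q f ->
  0 <= Ex Q (fun x => f x * \1_[set x | 0 < running_max f n x] x).
Proof.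
move=> fi; have mi := running_max_rintegrable n fi.
have mti := rintegrable_tau mi.
apply: (@le_trans _ _ (Ex Q (fun x => running_max f n x - (running_max f n \o tau) x))).
  by rewrite ExB// Ex_tau// subrr.
apply: ler_Ex; [exact: rintegrableB| |move=> x /=].
  exact/rintegrable_mask/fi/measurable_running_max_gt0.
(* Where the maximum is positive it is at most the next one, which is then [f x] plus the maximum at
   [tau x]; elsewhere it is zero and the difference is nonpositive. *)
have [m0|m0] := ltP 0 (running_max f n x); rewrite indicE.
  rewrite mem_set//= mulr1 lerBlDr.
  have := running_max_leS f n x; rewrite /= le_max => /orP[|//].
  by rewrite leNgt m0.
rewrite memNset/=; last by rewrite ltNge m0.
by rewrite mulr0; have := running_max_ge0 f n (tau x); lra.
Qed.

(** The maximal ergodic theorem for [f - lam], with [f] nonnegative, bounds lam times the measure of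
    the set where the running maximum is positive by the mean of [f]. These sets increase with n to
    a set containing the event. *)
Lemma maximal_inequality f lam : rintegrable Q f -> (forall x, 0 <= f x) ->
  0 < lam -> measurable [set x | exists n, n%:R * lam < birkhoff_sum f n x] /\
  (Q [set x | exists n, n%:R * lam < birkhoff_sum f n x]%R <= (Ex Q f / lam)%:E)%E.
Proof.
move=> fi f0 l0; set B := [set x | _].
pose g x := f x - lam.
have gi : rintegrable Q g by apply: rintegrableB => //; exact: rintegrable_cst.
have Sg n x : birkhoff_sum g n x = birkhoff_sum f n x - n%:R * lam.
  by rewrite /birkhoff_sum /cst sumrB sumr_const card_ord mulr_natl.
pose A n := [set x | 0 < running_max g n x].
have mA n : measurable (A n) by exact: measurable_running_max_gt0.
have QA n : (Q (A n) <= (Ex Q f / lam)%:E)%E.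
  rewrite -Ex_indic// lee_fin ler_pdivlMr// -subr_ge0.
  have mfi := rintegrable_mask (mA n) fi.
  have ii : rintegrable Q (\1_(A n)) by apply: integrable_indic.
  apply: (@le_trans _ _ (Ex Q (fun x => f x * \1_(A n) x) - Ex Q \1_(A n) * lam)).
    rewrite mulrC -ExZ// -ExB//; last exact: rintegrableZ.
    rewrite (le_trans (maximal_ergodic n gi))// le_eqVlt; apply/orP; left.
    by apply/eqP; congr Ex; apply/funext => x; rewrite /g mulrBl.
  rewrite lerB// ler_Ex// => x; rewrite ler_piMr//.
have mB : measurable B.
  have -> : B = \bigcup_n [set x | n%:R * lam < birkhoff_sum f n x].
    by apply/seteqP; split => x; [case=> n h; exists n|case=> n _ h; exists n].
  apply: bigcupT_measurable => n; apply: (measurable_ltr_set (measurable_cst _)).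
  exact: measurable_birkhoff_sum (rintegrable_measurable fi).
split=> //.
have Asub : B `<=` \bigcup_n A n.
  move=> x [n h]; exists n => //=; apply: lt_le_trans (birkhoff_sum_le_running_max g n x).
  by rewrite Sg subr_gt0.
have mU : measurable (\bigcup_n A n) by exact: bigcupT_measurable.
apply: (@le_trans _ _ (Q (\bigcup_n A n))).
  by apply: le_measure => //; rewrite inE.
have ndA : nondecreasing_seq A.
  apply/nondecreasing_seqP => n; apply/subsetPset => x; rewrite /A/=.
  by move=> h; apply: lt_le_trans h (running_max_leS _ _ _).
have h := nondecreasing_cvg_mu (mu := Q) mA mU ndA.
rewrite -(cvg_lim (@ereal_hausdorff R) h); apply: lime_le.
  by apply/cvg_ex; exists (Q (\bigcup_n A n)).
exact: nearW.
Qed.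

Hypothesis ergodic_tau : forall A, measurable A -> tau @^-1` A = A ->
  Q A = 0%E \/ Q A = 1%E.

(** Unboundedness from above is a [tau]-invariant event. Were it of probability one, almost every
    point would eventually have a positive running maximum, and the maximal ergodic theorem would
    give [0 <= Ex Q f] in the limit. *)
Lemma birkhoff_sum_bounded f : rintegrable Q f -> Ex Q f < 0 ->
  {ae Q, forall x, exists K : nat, forall n, birkhoff_sum f n x <= K%:R}.
Proof.
move=> fi Ef0.
have mf := rintegrable_measurable fi.
pose A := [set x | forall K : nat, exists n, K%:R < birkhoff_sum f n x].
have mA : measurable A.
  have -> : A = \bigcap_(K : nat) \bigcup_n [set x | K%:R < birkhoff_sum f n x].
    apply/seteqP; split => x.
      by move=> h K _; have [n] := h K; exists n.
    by move=> h K; have [n _] := h K I; exists n.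
  apply: bigcapT_measurable => K; apply: bigcupT_measurable => n.
  apply: (measurable_ltr_set (measurable_cst _)).
  exact: measurable_birkhoff_sum.
have tA : tau @^-1` A = A.
  apply/seteqP; split => x /= h m.
    have [k hk] : exists k : nat, m%:R - f x <= k%:R.
      exists (Num.truncn (`|m%:R - f x|)).+1.
      by rewrite (le_trans (ler_norm _))// ltW// truncnS_gt.
    by have [n] := h k; exists n.+1; rewrite birkhoff_sumS; lra.
  have [k hk] : exists k : nat, m%:R + f x <= k%:R.
    exists (Num.truncn (`|m%:R + f x|)).+1.
    by rewrite (le_trans (ler_norm _))// ltW// truncnS_gt.
  have [[|n]] := h (maxn k m); last first.
    rewrite birkhoff_sumS => hn; exists n.
    have : k%:R <= (maxn k m)%:R :> R by rewrite ler_nat leq_maxl.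
    lra.
  by rewrite /birkhoff_sum big_ord0 ltNge ler0n.
have [QA0|QA1] := ergodic_tau mA tA.
  exists A; split=> // x /= nx m; apply: contrapT => nm; apply: nx; exists m => n.
  by rewrite leNgt; apply/negP => lt; apply: nm; exists n.
suff : (0 <= Ex Q f)%R by rewrite leNgt Ef0.
pose B n := [set x | 0 < running_max f n x].
have mB n : measurable (B n) by exact: measurable_running_max_gt0.
have iB n := rintegrable_mask (mB n) fi.
have [] := @dominated_convergence _ T R Q setT measurableT
  (fun n x => (f x * \1_(B n) x)%:E) (EFin \o f) (fun x => `|f x|%:E).
- by move=> n; exact: measurable_int (iB n).
- exact: measurable_int fi.
- exists (~` A); split; [exact: measurableC| |].
    by change (Q (~` A) = 0%E); rewrite probability_setC// QA1 subee.
  move=> x /= nx Ax; apply: nx => _.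
  have [n hn] := Ax 0; apply: cvg_near_cst; exists n => // k /= nk.
  rewrite indicE mem_set ?mulr1// /B/=.
  exact: lt_le_trans hn (birkhoff_sum_running_max f x nk).
- exact: rintegrable_norm.
- apply: aeW => x n _; rewrite /= lee_fin normrM ler_piMr// ger0_norm//.
move=> _ _; rewrite /comp/= => h; rewrite -lee_fin EFin_Ex//.
rewrite -(cvg_lim (@ereal_hausdorff R) h); apply: lime_ge.
  by apply/cvg_ex; exists (\int[Q]_x (f x)%:E)%E.
by apply: nearW => n; rewrite -EFin_Ex// lee_fin maximal_ergodic.
Qed.

(** [birkhoff_sum_bounded] is applied to [f - m] and to [m - f], each lowered by [k.+1%:R^-1] to
    make its mean negative; dividing the bounds by n and taking k large squeezes the averages. *)
Theorem birkhoff f : rintegrable Q f ->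
  {ae Q, forall x, birkhoff_sum f n x / n%:R @[n --> \oo] --> Ex Q f}.
Proof.
move=> fi; set m := Ex Q f.
have up (g : T -> R) k : rintegrable Q g -> Ex Q g = 0 ->
  {ae Q, forall x, exists K : nat, forall n,
     birkhoff_sum g n x <= K%:R + n%:R * k.+1%:R^-1}.
  move=> gi Eg; have ci := rintegrable_cst Q k.+1%:R^-1.
  have := birkhoff_sum_bounded (rintegrableB gi ci).
  rewrite ExB// Eg Ex_cst sub0r oppr_lt0 invr_gt0 ltr0n => /(_ isT).
  apply: filterS => x [K hK]; exists K => n; have := hK n.
  rewrite /birkhoff_sum /cst sumrB sumr_const card_ord -[_ *+ n]mulr_natl lerBlDr.
  by [].
have ci := rintegrable_cst Q m.
have h1 : {ae Q, forall x, forall k, exists K : nat, forall n,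
    birkhoff_sum (fun x => f x - m) n x <= K%:R + n%:R * k.+1%:R^-1}.
  by apply: ae_foralln => k; apply: up; [exact: rintegrableB|rewrite ExB// Ex_cst subrr].
have h2 : {ae Q, forall x, forall k, exists K : nat, forall n,
    birkhoff_sum (fun x => m - f x) n x <= K%:R + n%:R * k.+1%:R^-1}.
  by apply: ae_foralln => k; apply: up; [exact: rintegrableB|rewrite ExB// Ex_cst subrr].
apply: filterS2 h1 h2 => x h1 h2.
apply/cvgrPdist_le => e e0.
have [k hk] : exists k : nat, k.+1%:R^-1 <= e / 2.
  exists (Num.truncn (e / 2)^-1); rewrite invf_ple ?posrE ?divr_gt0 ?ltr0n//.
  by rewrite ltW// truncnS_gt.
have [K1 hK1] := h1 k; have [K2 hK2] := h2 k.
pose K := (K1 + K2)%N; near=> n.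
have n0 : (0 < n)%N by near: n; exists 1%N.
have nR : 0 < n%:R :> R by rewrite ltr0n.
have Kn : K%:R <= n%:R * (e / 2).
  rewrite -ler_pdivrMr ?divr_gt0// ltW//; apply: lt_le_trans (truncnS_gt _) _.
  rewrite ler_nat; near: n; exact: nbhs_infty_ge.
have nk : n%:R * k.+1%:R^-1 <= n%:R * (e / 2) by rewrite ler_wpM2l.
have := hK1 n; have := hK2 n; rewrite /birkhoff_sum !sumrB !sumr_const card_ord.
rewrite -[_ *+ n]mulr_natl -/(birkhoff_sum f n x) => b1 b2.
rewrite -(ler_pM2r nR) -{2}(gtr0_norm nR) -normrM mulrBl divfK ?gt_eqF//.
have K12 : K1%:R + K2%:R = K%:R :> R by rewrite natrD.
have K10 : 0 <= K1%:R :> R by []; have K20 : 0 <= K2%:R :> R by [].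
move: Kn nk b1 b2 K12 K10 K20; rewrite (mulrC m).
move: (n%:R / k.+1%:R) (K1%:R) (K2%:R) (K%:R) => c k1 k2 k3 Kn nk b1 b2 K12 k10 k20.
have ne : n%:R * e = n%:R * (e / 2) + n%:R * (e / 2) by rewrite -mulrDr -splitr.
by rewrite [leRHS]mulrC ne ler_norml; apply/andP; split; move: ne b1 b2 Kn nk;
  move: (n%:R * m) (birkhoff_sum f n x) (n%:R * (e / 2)) (n%:R * e) => *; lra.
Unshelve. all: by end_near. Qed.

End ergodic_theory.

(** * Path space and transfer to stationary processes *)

Section path_space.
Context {R : realType}.

(** The generators repeat those of [product_measurable], so that stationarity and ergodicity of the
    process are, by conversion, statements about the shift and the law on [path_space]. *)
Definition coordinate_sets (I : Type) : set (set (I -> R)) :=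
  [set A | exists i : I, exists2 B : set R, measurable B & A = [set x | B (x i)]].

Definition path_space (I : Type) := g_sigma_algebraType (@coordinate_sets I).

Lemma measurable_coordinate (I : Type) (i : I) :
  measurable_fun setT (fun x : path_space I => x i).
Proof.
move=> _ B mB; rewrite setTI; apply: sub_sigma_algebra.
by exists i, B.
Qed.

Lemma measurable_to_path_space d (T : measurableType d) (I : Type)
    (h : T -> path_space I) :
  (forall i, measurable_fun setT (fun w => h w i)) -> measurable_fun setT h.
Proof.
move=> mh; apply: (@measurability _ _ T (path_space I) setT h (@coordinate_sets I) erefl).
move=> _ [_ [i [B mB ->]] <-]; exact: mh.
Qed.

Lemma measurable_shift_by h :
  measurable_fun setT (shift_by h : path_space int -> path_space int).
Proof.
by apply: measurable_to_path_space => i; exact: measurable_coordinate.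
Qed.

Lemma iter_shift_by (h : int) n (x : path_space int) :
  iter n (shift_by h) x = shift_by (h *+ n) x.
Proof.
elim: n x => [|n IH] x /=; first by apply/funext => t; rewrite /shift_by mulr0n addr0.
by rewrite IH; apply/funext => t; rewrite /shift_by mulrS addrA.
Qed.

End path_space.

Section process_ergodic.
Context d (T : measurableType d) (R : realType) (P : probability T R).
Variable X : int -> {RV P >-> R}.

Definition path_of (w : T) : path_space int := sample_path X w.

Lemma measurable_path_of : measurable_fun setT path_of.
Proof. by apply: measurable_to_path_space => i; exact: measurable_funPT. Qed.

HB.instance Definition _ := isMeasurableFun.Build _ _ _ _ path_of measurable_path_of.

Let Q := distribution P path_of.

Lemma ae_distribution_path (A : path_space int -> Prop) :
  {ae Q, forall x, A x} -> {ae P, forall w, A (path_of w)}.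
Proof.
move=> [N [mN QN sN]]; exists (path_of @^-1` N); split.
- by rewrite -[X in measurable X]setTI; exact: measurable_path_of.
- exact: QN.
- by move=> w /= nA; apply: sN.
Qed.

Lemma rintegrable_distribution_path (f : path_space int -> R) :
  measurable_fun setT f -> rintegrable P (f \o path_of) -> rintegrable Q f.
Proof.
move=> mf /integrableP[_ lty]; apply/integrableP; split; first exact/measurable_EFinP.
rewrite ge0_integral_distribution//.
by apply: measurableT_comp => //; exact/measurable_EFinP.
Qed.

Lemma Ex_distribution_path (f : path_space int -> R) :
  measurable_fun setT f -> rintegrable P (f \o path_of) ->
  Ex Q f = Ex P (f \o path_of).
Proof.
move=> mf fi; rewrite /Ex /Rintegral; congr fine.
by rewrite integral_distribution//; exact/measurable_EFinP.
Qed.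

Hypothesis X_stat : strictly_stationary P X.

Lemma stationary_path (h : int) (A : set (path_space int)) : measurable A ->
  Q (shift_by h @^-1` A) = Q A.
Proof. by move=> mA; exact: X_stat. Qed.

Lemma stationary_marginal t (B : set R) : measurable B ->
  P (X t @^-1` B) = P (X 0 @^-1` B).
Proof.
move=> mB; have mA : product_measurable [set x : int -> R | B (x 0)].
  by apply: sub_sigma_algebra; exists 0, B.
have := X_stat t mA; rewrite (_ : (shift_by t \o sample_path (fun i => X i)) @^-1` _ = X t @^-1` B)//.
by apply/seteqP; split => w; rewrite /= /shift_by /sample_path/= add0r.
Qed.

(** Every shift preserves the law of a stationary path, so blocks of any length [h] are covered,
    including lengths whose shift is not ergodic. *)
Lemma process_maximal_inequality (h : int) (f : path_space int -> R) lam :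
  measurable_fun setT f -> (forall x, 0 <= f x) ->
  rintegrable P (f \o path_of) -> 0 < lam ->
  measurable [set w | exists n,
    n%:R * lam < \sum_(e < n) f (shift_by (h *+ e) (path_of w))] /\
  (P [set w | exists n,
    n%:R * lam < \sum_(e < n) f (shift_by (h *+ e) (path_of w))]%R
     <= (Ex P (f \o path_of) / lam)%:E)%E.
Proof.
move=> mf f0 fi l0.
have [] := maximal_inequality (measurable_shift_by h) (stationary_path h)
  (rintegrable_distribution_path mf fi) f0 l0.
set B := (X in measurable X) => mB.
have -> : [set w | exists n, n%:R * lam <
    \sum_(e < n) f (shift_by (h *+ e) (path_of w))] = path_of @^-1` B.
  have E n w : \sum_(e < n) f (shift_by (h *+ e) (path_of w)) =
      birkhoff_sum (shift_by h : path_space int -> path_space int) f n (path_of w).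
    by apply: eq_bigr => e _; rewrite iter_shift_by.
  by apply/seteqP; split => w [n hn]; exists n; rewrite ?E// -E.
rewrite Ex_distribution_path// => QB; split => //.
by rewrite -[X in measurable X]setTI; exact: measurable_path_of.
Qed.

Hypothesis X_erg : ergodic P X.

Theorem process_birkhoff (f : path_space int -> R) :
  measurable_fun setT f -> rintegrable P (f \o path_of) ->
  {ae P, forall w, (\sum_(i < n) f (shift_by i%:Z (path_of w))) / n%:R
    @[n --> \oo] --> Ex P (f \o path_of)}.
Proof.
move=> mf fi.
have erg (A : set (path_space int)) : measurable A -> shift_by 1 @^-1` A = A -> Q A = 0%E \/ Q A = 1%E.
  by move=> mA sA; exact: X_erg.
have := birkhoff (measurable_shift_by 1) (stationary_path 1) erg
  (rintegrable_distribution_path mf fi).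
move/ae_distribution_path; rewrite Ex_distribution_path//.
move=> B; apply: filterS B => w; apply: cvg_trans; apply: near_eq_cvg; apply: nearW.
move=> n /=; congr (_ / _); apply: eq_bigr => i _.
by rewrite iter_shift_by -[1 *+ i]/(i%:R) natz.
Qed.

End process_ergodic.

(** * Square-integrable variables and almost sure convergence *)

Section square_integrable.
Context d (T : measurableType d) (R : realType) (P : probability T R).
Implicit Types f g : T -> R.

Definition sqr_integrable f :=
  measurable_fun setT f /\ rintegrable P (fun w => f w ^+ 2).

Definition norm2 f : R := Num.sqrt (Ex P (fun w => f w ^+ 2)).

Lemma norm2_ge0 f : 0 <= norm2 f.
Proof. exact: sqrtr_ge0. Qed.

Lemma norm2_sqr f : norm2 f ^+ 2 = Ex P (fun w => f w ^+ 2).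
Proof. by rewrite sqr_sqrtr// Ex_ge0// => w; exact: sqr_ge0. Qed.

Lemma sqr_integrable_le f g : measurable_fun setT g ->
  (forall w, `|g w| <= `|f w|) -> sqr_integrable f -> sqr_integrable g.
Proof.
move=> mg gf [mf fi]; split => //; apply: rintegrable_le fi.
  exact: measurable_funX.
by move=> w; rewrite normrX -(real_normK (num_real (f w))) lerXn2r// nnegrE.
Qed.

Lemma sqr_integrable_cst c : sqr_integrable (cst c).
Proof. by split; [exact: measurable_cst|exact: (rintegrable_cst P (c ^+ 2))]. Qed.

Lemma sqr_integrableZ c f : sqr_integrable f -> sqr_integrable (fun w => c * f w).
Proof.
move=> [mf fi]; split; first exact: measurable_funM (measurable_cst c) mf.
by under eq_fun do rewrite exprMn; exact: rintegrableZ.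
Qed.

Lemma sqr_integrableD f g : sqr_integrable f -> sqr_integrable g ->
  sqr_integrable (fun w => f w + g w).
Proof.
move=> [mf fi] [mg gi]; have mfg := measurable_funD mf mg; split => //.
apply: (rintegrable_le (f := fun w => 2 * f w ^+ 2 + 2 * g w ^+ 2)).
- exact: measurable_funX.
- move=> w; rewrite ger0_norm ?sqr_ge0//.
  by have := sqr_ge0 (f w - g w); nra.
- by apply: rintegrableD; exact: rintegrableZ.
Qed.

Lemma sqr_integrableB f g : sqr_integrable f -> sqr_integrable g ->
  sqr_integrable (fun w => f w - g w).
Proof.
move=> fi gi; have := sqr_integrableD fi (sqr_integrableZ (-1) gi).
by under eq_fun do rewrite mulN1r.
Qed.

Lemma sqr_integrable_norm f : sqr_integrable f -> sqr_integrable (fun w => `|f w|).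
Proof.
move=> fi; apply: sqr_integrable_le (fi).
  by apply: measurableT_comp => //; case: fi.
by move=> w; rewrite normr_id.
Qed.

Lemma sqr_integrable_sum (I : Type) (r : seq I) (f : I -> T -> R) :
  (forall i, sqr_integrable (f i)) -> sqr_integrable (fun w => \sum_(i <- r) f i w).
Proof.
move=> fi; elim: r => [|i r IH].
  by under eq_fun do rewrite big_nil; exact: sqr_integrable_cst.
by under eq_fun do rewrite big_cons; exact: sqr_integrableD.
Qed.

Lemma sqr_integrableM f g : sqr_integrable f -> sqr_integrable g ->
  rintegrable P (fun w => f w * g w).
Proof.
move=> [mf fi] [mg gi]; apply: rintegrable_le (rintegrableD fi gi).
  exact: measurable_funM.
move=> w; rewrite normrM -(real_normK (num_real (f w))) -(real_normK (num_real (g w))).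
by have := sqr_ge0 (`|f w| - `|g w|); have := normr_ge0 (f w); have := normr_ge0 (g w); nra.
Qed.

Lemma sqr_integrable_rintegrable f : sqr_integrable f -> rintegrable P f.
Proof.
move=> /sqr_integrableM/(_ (sqr_integrable_cst 1)).
by under eq_fun do rewrite mulr1.
Qed.

Lemma Ex_cauchy_schwarz f g : sqr_integrable f -> sqr_integrable g ->
  Ex P (fun w => f w * g w) <= norm2 f * norm2 g.
Proof.
move=> fi gi; have fgi := sqr_integrableM fi gi.
have E c e : Ex P (fun w => (c * f w - e * g w) ^+ 2) =
    c ^+ 2 * norm2 f ^+ 2 - 2 * c * e * Ex P (fun w => f w * g w)
    + e ^+ 2 * norm2 g ^+ 2.
  rewrite !norm2_sqr; have [[_ f2] [_ g2]] := (fi, gi).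
  rewrite -!ExZ// -ExB; [|exact: rintegrableZ..].
  rewrite -ExD; [|by apply: rintegrableB; exact: rintegrableZ|exact: rintegrableZ].
  by congr Ex; apply/funext => w; ring.
have E0 c e : 0 <= Ex P (fun w => (c * f w - e * g w) ^+ 2).
  by apply: Ex_ge0 => w; exact: sqr_ge0.
set x := Ex P _ in E *.
move: (norm2_ge0 f) (norm2_ge0 g); move: (norm2 f) (norm2 g) E => F G E F0 G0.
have [F00|Fn0] := eqVneq F 0.
  rewrite F00 mul0r leNgt; apply/negP => x0.
  (* When [f] has norm zero, a positive [x] would give the quadratic form the value -2 (G^2 + 1) +
     G^2 < 0 here. The case of [g] is symmetric. *)
  have := E0 ((G ^+ 2 + 1) / x) 1; rewrite E F00 expr0n/= mulr0 expr1n mul1r add0r.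
  have -> : 2 * ((G ^+ 2 + 1) / x) * 1 * x = 2 * (G ^+ 2 + 1).
    by field; rewrite gt_eqF.
  by have := sqr_ge0 G; lra.
have [G00|Gn0] := eqVneq G 0.
  rewrite G00 mulr0 leNgt; apply/negP => x0.
  have := E0 1 ((F ^+ 2 + 1) / x); rewrite E G00 expr0n/= mulr0 expr1n mul1r addr0.
  have -> : 2 * 1 * ((F ^+ 2 + 1) / x) * x = 2 * (F ^+ 2 + 1).
    by field; rewrite gt_eqF.
  by have := sqr_ge0 F; lra.
have F1 : 0 < F by rewrite lt_neqAle eq_sym Fn0.
have G1 : 0 < G by rewrite lt_neqAle eq_sym Gn0.
have := E0 G F; rewrite E.
have -> : G ^+ 2 * F ^+ 2 - 2 * G * F * x + F ^+ 2 * G ^+ 2 = (2 * (F * G)) * (F * G - x) by ring.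
by rewrite pmulr_rge0 ?subr_ge0// !mulr_gt0.
Qed.

Lemma ler_norm2D f g : sqr_integrable f -> sqr_integrable g ->
  norm2 (fun w => f w + g w) <= norm2 f + norm2 g.
Proof.
move=> fi gi; rewrite -[leRHS]ger0_norm ?addr_ge0 ?norm2_ge0// -sqrtr_sqr.
apply: ler_wsqrtr; rewrite sqrrD !norm2_sqr.
have [[_ f2] [_ g2]] := (fi, gi); have fgi := sqr_integrableM fi gi.
rewrite (_ : (fun w => _) = (fun w => f w ^+ 2 + 2 * (f w * g w) + g w ^+ 2)); last first.
  by apply/funext => w; ring.
rewrite ExD//; last by apply: rintegrableD => //; exact: rintegrableZ.
rewrite ExD//; last exact: rintegrableZ.
rewrite ExZ//; have := Ex_cauchy_schwarz fi gi; lra.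
Qed.

Lemma ler_norm2 f g : sqr_integrable f -> sqr_integrable g ->
  (forall w, `|f w| <= `|g w|) -> norm2 f <= norm2 g.
Proof.
move=> [_ fi] [_ gi] fg; apply: ler_wsqrtr; apply: ler_Ex => // w.
by rewrite -(real_normK (num_real (f w))) -(real_normK (num_real (g w))) lerXn2r// nnegrE.
Qed.

Lemma ler_norm2_dist f g h : sqr_integrable f -> sqr_integrable g -> sqr_integrable h ->
  (forall w, `|f w - g w| <= `|h w|) -> `|norm2 f - norm2 g| <= norm2 h.
Proof.
have le1 f1 g1 : sqr_integrable f1 -> sqr_integrable g1 -> sqr_integrable h ->
    (forall w, `|f1 w - g1 w| <= `|h w|) -> norm2 f1 <= norm2 g1 + norm2 h.
  move=> fi gi hi fgh; have fgi := sqr_integrableB fi gi.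
  apply: (@le_trans _ _ (norm2 (fun w => g1 w + (f1 w - g1 w)))).
    by apply: ler_norm2 => //; [exact: sqr_integrableD|move=> w; rewrite addrC subrK].
  by apply: le_trans (ler_norm2D gi fgi) _; rewrite lerD2l; exact: ler_norm2.
move=> fi gi hi fgh; rewrite ler_distl; apply/andP; split; last exact: le1.
by rewrite lerBlDr; apply: le1 => // w; rewrite distrC.
Qed.

Lemma norm2Z c f : sqr_integrable f -> norm2 (fun w => c * f w) = `|c| * norm2 f.
Proof.
move=> [_ fi]; rewrite /norm2 (_ : (fun w => _) = (fun w => c ^+ 2 * f w ^+ 2)).
  by rewrite ExZ// sqrtrM ?sqr_ge0// sqrtr_sqr.
by apply/funext => w; rewrite exprMn.
Qed.

Lemma norm2_cst c : norm2 (cst c) = `|c|.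
Proof. by rewrite /norm2 (_ : (fun w => _) = cst (c ^+ 2))// Ex_cst sqrtr_sqr. Qed.

Lemma ler_norm2_sum (I : Type) (r : seq I) (f : I -> T -> R) :
  (forall i, sqr_integrable (f i)) ->
  norm2 (fun w => \sum_(i <- r) f i w) <= \sum_(i <- r) norm2 (f i).
Proof.
move=> fi; elim: r => [|i r IH].
  by under eq_fun do rewrite big_nil; rewrite (norm2_cst 0) normr0 big_nil.
under eq_fun do rewrite big_cons; rewrite big_cons.
apply: le_trans (ler_norm2D (fi i) (sqr_integrable_sum r fi)) _.
by rewrite lerD2l.
Qed.

Lemma norm2_eq0 f : sqr_integrable f -> norm2 f = 0 -> {ae P, forall w, f w = 0}.
Proof.
move=> [mf fi] f0; have := norm2_sqr f; rewrite f0 expr0n/= => /esym EE.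
have h := congr1 EFin EE; rewrite EFin_Ex// in h.
have /ae_eq_integral_abs : (\int[P]_w `|(f w ^+ 2)%:E| = 0)%E.
  by apply: etrans h; apply: eq_integral => w _; rewrite /= ger0_norm ?sqr_ge0.
move=> /(_ measurableT (measurable_int P fi)); apply: filterS => w /(_ I)/=.
by move=> [] /eqP; rewrite expf_eq0/= => /eqP.
Qed.

Lemma chebyshev2 f eps : sqr_integrable f -> 0 < eps ->
  (P [set w | eps <= `|f w|]%R <= ((norm2 f / eps) ^+ 2)%:E)%E.
Proof.
move=> [mf fi] e0.
have mA : measurable [set w | eps <= `|f w|].
  by apply: (measurable_ler_set (f := fun=> eps)); [exact: measurable_cst|exact: measurableT_comp].
rewrite -Ex_indic// lee_fin expr_div_n norm2_sqr mulrC -ExZ//.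
apply: ler_Ex; [exact: integrable_indic|exact: rintegrableZ|move=> w].
rewrite indicE mulrC ler_pdivlMr ?exprn_gt0//.
case: (boolP (w \in _)) => [/set_mem/= ew|_]; last by rewrite mul0r sqr_ge0.
by rewrite mul1r -(real_normK (num_real (f w))) lerXn2r// nnegrE// ltW.
Qed.

Lemma ae_eq_measure (A B : set T) : measurable A -> measurable B ->
  {ae P, forall w, A w <-> B w} -> P A = P B.
Proof.
move=> mA mB AB; rewrite -!Ex_indic//; congr EFin.
apply: ae_eq_Ex; [exact: measurable_indic|exact: measurable_indic|].
apply: filterS AB => w AB; rewrite !indicE; congr (nat_of_bool _)%:R.
by apply/idP/idP; rewrite !inE => /AB.
Qed.

Lemma borel_cantelli_geometric (F : nat -> set T) (C q : R) :
  (forall n, measurable (F n)) -> 0 <= q < 1 ->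
  (forall n, P (F n) <= (C * q ^+ n)%:E)%E ->
  {ae P, forall w, exists J, forall j, (J <= j)%N -> ~ F j w}.
Proof.
move=> mF /andP[q0 q1] PF.
have : (\sum_(n <oo) P (F n) < +oo)%E.
  have C0 : 0 <= C by have := le_trans (measure_ge0 P _) (PF 0%N); rewrite expr0 mulr1 lee_fin.
  apply: (@le_lt_trans _ _ (\sum_(n <oo) (C * q ^+ n)%:E)%E).
    by apply: lee_nneseries => n _ //; exact: PF.
  have : cvgn (series (geometric C q)).
    by apply: is_cvg_geometric_series; rewrite ger0_norm.
  move=> /cvg_ex[l hl].
  suff -> : (\sum_(n <oo) (C * q ^+ n)%:E)%E = l%:E by rewrite ltry.
  apply/cvg_lim => //; rewrite (_ : (fun n => _) = EFin \o series (geometric C q)).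
    by apply: cvg_EFin => //; exact: nearW.
  by apply/funext => n; rewrite /= sumEFin.
move=> /(lim_sup_set_cvg0 mF) h; exists (lim_sup_set F); split => //.
  by apply: bigcap_measurable => // k _; exact: bigcup_measurable.
move=> w /= nw n _; apply: contrapT => nF; apply: nw; exists n => j nj Fj.
by apply: nF; exists j.
Qed.

Lemma ae_cvg_subseq (S : nat -> T -> R) (Y : T -> R) :
  (forall n, sqr_integrable (S n)) -> sqr_integrable Y ->
  norm2 (fun w => S n w - Y w) @[n --> \oo] --> 0 ->
  exists phi : nat -> nat, {ae P, forall w, S (phi k) w @[k --> \oo] --> Y w}.
Proof.
move=> Si Yi /cvgrPdist_le SY.
(* Norms below 4^(-k) let Chebyshev's inequality at level 2^(-k) give the summable bound 4^(-k). *)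
have ex k : exists n, norm2 (fun w => S n w - Y w) <= 4^-1 ^+ k.
  have [|n _ hn] := SY (4^-1 ^+ k); first by rewrite exprn_gt0.
  by exists n; have := hn n (leqnn n); rewrite sub0r normrN ger0_norm ?norm2_ge0.
have [phi hphi] := choice ex; exists phi.
have half k : 0 < 2^-1 ^+ k :> R by rewrite exprn_gt0.
have Di k : sqr_integrable (fun w => S (phi k) w - Y w) by exact: sqr_integrableB.
have := @borel_cantelli_geometric
  (fun k => [set w | 2^-1 ^+ k <= `|S (phi k) w - Y w|]) 1 (4^-1).
case.
- move=> k; apply: (measurable_ler_set (f := fun=> 2^-1 ^+ k)); first exact: measurable_cst.
  by apply: measurableT_comp => //; case: (Di k).
- by apply/andP; split; lra.
- move=> k; apply: (le_trans (chebyshev2 (Di k) (half k))).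
  rewrite lee_fin mul1r.
  have -> : 4^-1 ^+ k = (2^-1 ^+ k) ^+ 2 :> R.
    by rewrite -exprM mulnC exprM; congr (_ ^+ _); rewrite expr2; field.
  rewrite ler_pXn2r ?nnegrE ?divr_ge0 ?norm2_ge0 ?(ltW (half k))//.
  rewrite ler_pdivrMr// -exprMn (_ : 2^-1 * 2^-1 = 4^-1 :> R)//; by field.
move=> N mN; exists N; case: mN => ? ? sN; split => // w /= nw; apply: sN => /= -[J hJ].
apply: nw; apply/cvgrPdist_le => e e0.
have /cvgrPdist_le/(_ e e0) : (2^-1 : R) ^+ n @[n --> \oo] --> 0.
  by apply: cvg_expr; rewrite ger0_norm//; lra.
move=> [J' _ hJ']; exists (maxn J J') => // k /= ; rewrite geq_max => /andP[Jk J'k].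
have := hJ k Jk; move/negP; rewrite -ltNge distrC => /ltW/le_trans; apply.
by have := hJ' k J'k; rewrite sub0r normrN ger0_norm// ltW.
Qed.

Lemma Lnorm2E f : measurable_fun setT f ->
  (Lnorm P 2%:E (EFin \o f) < +oo)%E ->
  sqr_integrable f /\ Lnorm P 2%:E (EFin \o f) = (norm2 f)%:E.
Proof.
move=> mf lty; set N := Lnorm _ _ _ in lty *.
have N0 : (0 <= N)%E := Lnorm_ge0 _ _ _.
have Nfin : N \is a fin_num by rewrite ge0_fin_numE.
have E : (N ^+ 2 = \int[P]_w (f w ^+ 2)%:E)%E.
  have := @poweR_Lnorm _ _ _ P (EFin \o f) 2; rewrite -/N -(fineK Nfin) => /(_ _).
  rewrite poweR_EFin powR_mulrn ?fine_ge0// -EFin_expe => -> //.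
  apply: eq_integral => w _ /=.
  by rewrite powR_mulrn// real_normK// num_real.
have fi : sqr_integrable f.
  split => //; apply: ge0_rintegrable; first exact: measurable_funX.
    by move=> w; exact: sqr_ge0.
  by rewrite -E -(fineK Nfin) -EFin_expe ltry.
split => //; rewrite -(fineK Nfin); congr EFin.
have f0 : 0 <= fine N by exact: fine_ge0.
rewrite -[LHS]ger0_norm// -sqrtr_sqr; congr Num.sqrt.
by apply: EFin_inj; rewrite EFin_Ex ?EFin_expe ?fineK//; case: fi.
Qed.

(** Convergence to 0 makes the extended norms eventually finite; a single finite one already puts
    [Y] in L^2, as a difference of two square-integrable variables. *)
Lemma cvg_L2_norm2 (S : nat -> T -> R) (Y : T -> R) :
  (forall n, sqr_integrable (S n)) -> measurable_fun setT Y -> cvg_L2 P S Y ->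
  sqr_integrable Y /\ norm2 (fun w => S n w - Y w) @[n --> \oo] --> 0.
Proof.
move=> Si mY SY.
have fin : \forall n \near \oo, (Lnorm P 2%:E (fun w => (S n w - Y w)%:E) < +oo)%E.
  have [h _] := (fine_cvgP _ _).1 SY; near=> n.
  rewrite ltey_eq; apply/orP; left; near: n; exact: h.
have D n : (Lnorm P 2%:E (fun w => (S n w - Y w)%:E) < +oo)%E ->
    sqr_integrable (fun w => S n w - Y w) /\
    Lnorm P 2%:E (fun w => (S n w - Y w)%:E) = (norm2 (fun w => S n w - Y w))%:E.
  by apply: Lnorm2E; apply: measurable_funB => //; case: (Si n).
split.
  have [n _ hn] := fin; have [Di _] := D n (hn n (leqnn n)).
  have := sqr_integrableB (Si n) Di; under eq_fun do rewrite opprB addrC subrK.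
  by [].
have [_ h] := (fine_cvgP _ _).1 SY; apply: cvg_trans h; apply: near_eq_cvg.
by apply: filterS fin => n /D[_ /= ->].
Unshelve. all: by end_near. Qed.

End square_integrable.
Arguments sqr_integrable {d T R} P f.
Arguments norm2 {d T R} P f.

(** * Completed past of the noise *)

Section past.
Context d (T : measurableType d) (R : realType) (P : probability T R).
Variable xi : int -> {RV P >-> R}.

Definition past_cylinder (t : int) (C : set T) := exists (s : seq int) (B : int -> set R),
  [/\ uniq s, forall i, i \in s -> i < t, forall i, measurable (B i) &
      C = [set w | forall i, i \in s -> B i (xi i w)]].

(* The past of t is completed: its generators are the measurable sets almost
   equal to a cylinder, so null sets and almost sure modifications are free. *)
Definition past_generator (t : int) : set (set T) := [set A | measurable A /\
  exists2 C, past_cylinder t C & {ae P, forall w, A w <-> C w}].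

Definition past_space (t : int) := g_sigma_algebraType (past_generator t).

Lemma past_measurable_set t (A : set T) :
  measurable (A : set (past_space t)) -> measurable A.
Proof.
apply: smallest_sub => [|B []//]; split; first exact: measurable0.
  by move=> B mB; rewrite setTD; exact: measurableC.
by move=> F mF; exact: bigcupT_measurable.
Qed.

Lemma past_generator_setI t : setI_closed (past_generator t).
Proof.
move=> A1 A2 [mA1 [C1 [s1 [B1 [u1 l1 mB1 ->]]] E1]] [mA2 [C2 [s2 [B2 [u2 l2 mB2 ->]]] E2]].
split; first exact: measurableI.
pose B i := [set x | (i \in s1 -> B1 i x) /\ (i \in s2 -> B2 i x)].
exists [set w | forall i, i \in undup (s1 ++ s2) -> B i (xi i w)].
  exists (undup (s1 ++ s2)), B; split=> // [|i|i]; first exact: undup_uniq.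
    by rewrite mem_undup mem_cat => /orP[/l1|/l2].
  rewrite /B (_ : [set x | _] = (if i \in s1 then B1 i else setT) `&` (if i \in s2 then B2 i else setT)).
    by apply: measurableI; case: ifP.
  apply/seteqP; split => x /=; case: (i \in s1); case: (i \in s2) => -[p q]; by split=> //; first [exact: p|exact: q|move=> _; exact: p|move=> _; exact: q].
apply: filterS2 E1 E2 => w E1 E2; split => [[/E1 h1 /E2 h2] i _|h]; first by split; [exact: h1|exact: h2].
split; [apply/E1|apply/E2] => i si.
  by have [|h1 _] := h i; [rewrite mem_undup mem_cat si|exact: h1].
by have [|_ h1] := h i; [rewrite mem_undup mem_cat si orbT|exact: h1].
Qed.

Lemma past_monotone s t (A : set T) : s <= t ->
  measurable (A : set (past_space s)) -> measurable (A : set (past_space t)).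
Proof.
move=> st; apply: smallest_sub; first exact: smallest_sigma_algebra.
move=> B [mB [C [s' [B' [u l mB' ->]]] E]]; apply: sub_sigma_algebra; split => //.
exists [set w | forall i, i \in s' -> B' i (xi i w)] => //.
by exists s', B'; split => // i /l is'; exact: lt_le_trans is' st.
Qed.

Lemma past_null t (A : set T) : measurable A -> P A = 0%E ->
  measurable (A : set (past_space t)).
Proof.
move=> mA A0; apply: sub_sigma_algebra; split => //.
(* A null set is almost equal to the empty cylinder, written as the constraint [set0] on the
   coordinate [t - 1]. *)
exists [set w | forall i, i \in [:: t - 1] -> set0 (xi i w)].
  exists [:: t - 1], (fun=> set0); split=> // i; rewrite inE => /eqP ->; lia.
exists A; split => // w /= nw; apply: contrapT => nA; apply: nw; split => //.
by move=> /(_ (t - 1)); rewrite inE eqxx => /(_ isT).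
Qed.

Definition past_measurable t (Y : T -> R) :=
  measurable_fun (setT : set (past_space t)) (Y : past_space t -> R).

Lemma past_measurableW t Y : past_measurable t Y -> measurable_fun setT Y.
Proof. by move=> mY _ B mB; apply: past_measurable_set; exact: mY. Qed.

Lemma past_measurable_ae t (Y Z : T -> R) : past_measurable t Y ->
  measurable_fun setT Z -> {ae P, forall w, Y w = Z w} -> past_measurable t Z.
Proof.
move=> mY mZ YZ _ B mB; rewrite setTI.
have mY' := past_measurableW mY.
have mE : measurable [set w | Y w = Z w] := measurable_eqr_set mY' mZ.
have E0 : P (~` [set w | Y w = Z w]) = 0%E.
  by apply/negligibleP; [exact: measurableC|exact: YZ].
have pC := past_null (t := t) (measurableC mE) E0.
have pE : measurable ([set w | Y w = Z w] : set (past_space t)).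
  by rewrite -[X in measurable X]setCK; exact: measurableC.
rewrite (_ : Z @^-1` B = (Y @^-1` B `&` [set w | Y w = Z w]) `|`
    (Z @^-1` B `&` ~` [set w | Y w = Z w])).
  apply: measurableU; first by apply: measurableI pE; rewrite -[X in measurable X]setTI; exact: mY.
  apply: past_null; first by apply: measurableI (measurableC mE); rewrite -[X in measurable X]setTI; exact: mZ.
  apply/eqP; rewrite -measure_le0 -E0; apply: le_measure; rewrite ?inE.
  - by apply: measurableI (measurableC mE); rewrite -[X in measurable X]setTI; exact: mZ.
  - exact: measurableC.
  - exact: subIsetr.
apply/seteqP; split => w /=.
  by move=> Zw; have [YZw|nYZ] := pselect (Y w = Z w); [left; rewrite YZw|right].
by move=> [[Yw <-]|[]].
Qed.

Lemma past_measurable_noise s t : s < t -> past_measurable t (xi s).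
Proof.
move=> st _ B mB; rewrite setTI; apply: sub_sigma_algebra; split.
  by rewrite -[X in measurable X]setTI; exact: measurable_funPT.
exists [set w | forall i, i \in [:: s] -> B (xi i w)].
  by exists [:: s], (fun=> B); split => // i; rewrite inE => /eqP ->.
apply: aeW => w; split => [Bw i|h]; first by rewrite inE => /eqP ->.
by apply: (h s); rewrite inE.
Qed.

Lemma past_measurable_causal (X : int -> {RV P >-> R}) s t : causal P xi X ->
  s < t -> past_measurable t (X s).
Proof.
move=> /(_ s)[F mF XF] st.
have mp : measurable_fun (setT : set (past_space t))
    ((fun w j => xi (s - j%:Z) w) : past_space t -> path_space nat).
  apply: measurable_to_path_space => j; apply: past_measurable_noise; lia.
have mF' : measurable_fun setT (F : path_space nat -> R).
  by move=> _ B mB; rewrite setTI; exact: mF.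
apply: (past_measurable_ae (Y := fun w => F (fun j => xi (s - j%:Z) w))).
- exact: (measurableT_comp mF' mp).
- exact: measurable_funPT.
- by apply: filterS XF => w ->.
Qed.

(** A subsequence converges almost everywhere. Cutting by the complement of the null set, which lies
    in the completed past, makes it converge everywhere, to an almost sure modification of [Y]. *)
Lemma past_measurable_cvg_L2 t (S : nat -> T -> R) (Y : T -> R) :
  (forall n, past_measurable t (S n)) -> (forall n, sqr_integrable P (S n)) ->
  sqr_integrable P Y -> norm2 P (fun w => S n w - Y w) @[n --> \oo] --> 0 ->
  past_measurable t Y.
Proof.
move=> pS Si Yi SY; have [phi [N [mN N0 sN]]] := ae_cvg_subseq Si Yi SY.
have pN : measurable (~` N : set (past_space t)) by apply: measurableC; exact: past_null.
apply: (past_measurable_ae (Y := fun w => Y w * \1_(~` N) w)).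
- apply: (@measurable_fun_cvg _ (past_space t) R setT (fun k w => S (phi k) w * \1_(~` N) w)).
    by move=> k; apply: measurable_funM; [exact: pS|exact: measurable_indic].
  move=> w _; rewrite indicE; case: (boolP (w \in _)) => [/set_mem nN|_].
    rewrite mulr1; under eq_cvg do rewrite mulr1.
    by apply: contrapT => h; apply: nN; apply: sN.
  by rewrite mulr0; under eq_cvg do rewrite mulr0; exact: cvg_cst.
- by case: Yi.
- exists N; split => // w /= nw; apply: contrapT => nN; apply: nw.
  by rewrite indicE mem_set// mulr1.
Qed.

Hypothesis xi_indep : mutually_independent P xi.

Lemma independent_cylinder t (C : set T) (B : set R) : past_cylinder t C ->
  measurable B -> P (C `&` xi t @^-1` B) = (P C * P (xi t @^-1` B))%E.
Proof.
move=> [s [B' [us ls mB' ->]]] mB.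
pose B2 i := if i == t then B else B' i.
have ts : t \notin s by apply/negP => /ls; rewrite ltxx.
have eqB i : i \in s -> B2 i = B' i.
  by move=> si; rewrite /B2; case: eqP => // it; rewrite it (negPf ts) in si.
have -> : [set w | forall i, i \in s -> B' i (xi i w)] `&` xi t @^-1` B =
    [set w | forall i, i \in t :: s -> B2 i (xi i w)].
  apply/seteqP; split => w /=.
    move=> [h Bw] i; rewrite inE => /predU1P[->|si]; first by rewrite /B2 eqxx.
    by rewrite eqB//; exact: h.
  move=> h; split => [i si|]; first by rewrite -eqB//; apply: h; rewrite inE si orbT.
  by have := h t; rewrite inE eqxx /B2 eqxx; exact.
rewrite !xi_indep//=; last 2 first.
- by rewrite ts.
- by move=> i; rewrite /B2; case: ifP.
rewrite big_cons /B2 eqxx muleC; congr (_ * _)%E.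
by apply: eq_big_seq => i si; rewrite -/(B2 i) eqB.
Qed.

(** Both sides are finite measures in [A]. They agree on cylinders by independence, hence on the
    generators, which are almost cylinders; the generators are closed under intersection, so
    uniqueness of measures applies. *)
Lemma independent_past t (A : set T) (B : set R) : measurable (A : set (past_space t)) ->
  measurable B -> P (A `&` xi t @^-1` B) = (P A * P (xi t @^-1` B))%E.
Proof.
move=> + mB; have mxB : measurable (xi t @^-1` B).
  by rewrite -[X in measurable X]setTI; exact: measurable_funPT.
set D := xi t @^-1` B in mxB *.
pose r : {nonneg R} := NngNum (fine_ge0 (measure_ge0 P D)).
have rE : r%:num%:E = P D by rewrite fineK// fin_num_measure.
have -> : (P A * P D)%E = mscale r P A by rewrite /mscale/= rE muleC.
have -> : P (A `&` D) = mrestr P mxB A by [].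
apply: (g_sigma_algebra_measure_unique (past_generator t) _ (fun=> setT)) => //.
- by move=> A' [].
- move=> _; split; first exact: measurableT.
  exists [set w | forall i, i \in [::] -> setT (xi i w)]; last exact: aeW.
  by exists [::], (fun=> setT).
- by rewrite bigcup_const//; exists 0%N.
- exact: past_generator_setI.
- move=> A' [mA [C pC AC]]; rewrite /mrestr/= /mscale/= rE muleC.
  have mC : measurable C.
    case: pC => s [B' [_ _ mB' ->]].
    rewrite (_ : [set w | _] = \bigcap_(i in [set` s]) (xi i @^-1` B' i)); last first.
      by apply/seteqP; split => w /= h i; apply: h.
    apply: fin_bigcap_measurable => // i _.
    by rewrite -[X in measurable X]setTI; exact: measurable_funPT.
  rewrite (ae_eq_measure mA mC AC) -(independent_cylinder pC mB).
  apply: ae_eq_measure; [exact: measurableI|exact: measurableI|].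
  by apply: filterS AC => w AC; split => -[/AC].
- move=> _; change (P (setT `&` D) < +oo)%E; rewrite setTI; apply: le_lt_trans (ltry 1).
  exact: probability_le1.
Qed.

End past.

(** * Noise against its past: Tonelli, reflection, absence of atoms *)

Section noise.
Context d (T : measurableType d) (R : realType) (P : probability T R).
Variable xi : int -> {RV P >-> R}.
Hypothesis xi_indep : mutually_independent P xi.

Local Notation past_space := (past_space xi).
Local Notation past_measurable := (past_measurable xi).

(** The identity read as a random element of the past sigma-algebra: its law is [P] restricted to
    the past, which lets independence be expressed as a product law. *)
Definition past_id (t : int) (w : T) : past_space t := w.

Lemma measurable_past_id t : measurable_fun setT (@past_id t).
Proof. by move=> _ B mB; rewrite setTI; exact: past_measurable_set mB. Qed.

HB.instance Definition _ t :=
  isMeasurableFun.Build _ _ _ _ (@past_id t) (@measurable_past_id t).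

Definition noise_past (t : int) (w : T) : R * past_space t := (xi t w, past_id t w).

Lemma measurable_noise_past t : measurable_fun setT (@noise_past t).
Proof.
by apply: measurable_fun_pair; [exact: measurable_funPT|exact: measurable_past_id].
Qed.

HB.instance Definition _ t :=
  isMeasurableFun.Build _ _ _ _ (@noise_past t) (@measurable_noise_past t).

(** Independence makes the law of [noise_past t] the product of its marginals. Integrating the noise
    first, with the past frozen, takes the place of a conditional expectation. *)
Lemma tonelli_noise_past t (f : R * past_space t -> \bar R) :
  measurable_fun setT f -> (forall x, 0 <= f x)%E ->
  (\int[P]_w f (xi t w, w) = \int[P]_w \int[P]_v f (xi t v, w))%E.
Proof.
move=> mf f0.
pose mu := distribution P (xi t); pose Pt := distribution P (@past_id t).
have -> : (\int[P]_w f (xi t w, w) = \int[distribution P (@noise_past t)]_z f z)%E.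
  by rewrite ge0_integral_distribution.
rewrite (@eq_measure_integral _ _ _ _ (mu \x Pt)%E); last first.
  move=> A mA _; apply/esym/product_measure_unique => // B1 B2 mB1 mB2.
  rewrite muleC; rewrite /distribution /pushforward /=.
  rewrite -(independent_past xi_indep mB2 mB1); congr (P _).
  by apply/seteqP; split => w [].
rewrite (fubini_tonelli2 (m1 := mu) (m2 := Pt) f mf f0) /Pt ge0_integral_distribution.
- apply: eq_integral => w _ /=; rewrite /fubini_G ge0_integral_distribution//.
  exact: measurableT_comp mf (measurable_pair2 _).
- exact: measurable_fun_fubini_tonelli_G.
- by move=> y; apply: integral_ge0.
Qed.

Hypothesis xi_ident : identically_distributed P xi.
Hypothesis xi_sym : symmetric_distribution P (xi 0).

Lemma integral_noise_opp t (f : R -> \bar R) : measurable_fun setT f ->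
  (forall x, 0 <= f x)%E -> (\int[P]_w f (- xi t w)%R = \int[P]_w f (xi t w))%E.
Proof.
move=> mf f0.
have mxi : measurable_fun setT (xi t) by exact: measurable_funPT.
have mN : measurable_fun setT (fun w => - xi t w) by exact: measurable_funN.
have := @ge0_integral_pushforward _ _ _ _ R _ mN P setT f measurableT mf (fun y _ => f0 y).
have := @ge0_integral_pushforward _ _ _ _ R _ mxi P setT f measurableT mf (fun y _ => f0 y).
rewrite !preimage_setT /= => <- <-.
apply: eq_measure_integral => A mA _; rewrite /pushforward /=.
have mA' : measurable (-%R @^-1` A : set R).
  by rewrite -[X in measurable X]setTI; exact: (@oppr_measurable R setT measurableT A mA).
have E1 : P ((fun w => - xi t w) @^-1` A) = P ((fun w => - xi 0 w) @^-1` A) :=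
  xi_ident t 0 mA'.
exact: etrans E1 (etrans (esym (xi_sym mA)) (esym (xi_ident t 0 mA))).
Qed.

Lemma integral_noise_past_opp t (f : R * past_space t -> \bar R) :
  measurable_fun setT f -> (forall x, 0 <= f x)%E ->
  (\int[P]_w f ((- xi t w)%R, w) = \int[P]_w f (xi t w, w))%E.
Proof.
move=> mf f0; rewrite (tonelli_noise_past mf f0).
have mf' : measurable_fun setT (fun z : R * past_space t => f (- z.1, z.2)).
  apply: (measurableT_comp mf); apply: measurable_fun_pair; last exact: measurable_snd.
  by apply: measurableT_comp => //; exact: measurable_fst.
rewrite (tonelli_noise_past mf') /=; last by move=> x; exact: f0.
apply: eq_integral => w _; apply: (integral_noise_opp t (f := fun x => f (x, w))) => //.
exact: measurableT_comp mf (measurable_pair2 _).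
Qed.

Lemma Ex_noise_past_opp t (g : R * past_space t -> R) : measurable_fun setT g ->
  Ex P (fun w => g (- xi t w, w)) = Ex P (fun w => g (xi t w, w)).
Proof.
move=> mg; have mg' : measurable_fun setT (EFin \o g) by exact/measurable_EFinP.
rewrite /Ex /Rintegral; congr fine; rewrite integralE [RHS]integralE; congr (_ - _)%E.
  have h := integral_noise_past_opp (measurable_funepos mg') (funepos_ge0 _).
  by apply: etrans (etrans h _); apply: eq_integral => w _; rewrite !funeposE.
have h := integral_noise_past_opp (measurable_funeneg mg') (funeneg_ge0 _).
by apply: etrans (etrans h _); apply: eq_integral => w _; rewrite !funenegE.
Qed.

Hypothesis xi_cont : continuous (cdf (xi 0)).

(** An atom at [c] would be a jump of the distribution function: its values at c - 1/(n+1) stay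
    below the value at [c] by the mass of the atom, yet converge to it. *)
Lemma noise_atomless t c : P [set w | xi t w = c] = 0%E.
Proof.
have -> : P [set w | xi t w = c] = P (xi 0 @^-1` [set c]) by apply: (xi_ident t 0 (B := [set c])).
have mc : measurable (xi 0 @^-1` [set c]).
  by rewrite -[X in measurable X]setTI; exact: measurable_funPT.
pose y (n : nat) : R := c - n.+1%:R^-1.
have yc n : y n < c by rewrite /y ltrBlDr ltrDl invr_gt0 ltr0n.
have cy : cdf (xi 0) (y n) @[n --> \oo] --> cdf (xi 0) c.
  apply: (cvg_comp y (cdf (xi 0))); last exact: xi_cont.
  have : y n @[n --> \oo] --> c - 0.
    by apply: cvgB; [exact: cvg_cst|exact: cvg_harmonic].
  by rewrite subr0.
have fc : P (xi 0 @^-1` [set c]) \is a fin_num by rewrite fin_num_measure.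
have le n : (cdf (xi 0) (y n) <= cdf (xi 0) c - P (xi 0 @^-1` [set c]))%E.
  rewrite leeBrDr// /cdf/= /distribution/pushforward/=.
  have mi r : measurable (xi 0 @^-1` [set` `]-oo, r]]).
    by rewrite -[X in measurable X]setTI; exact: measurable_funPT.
  rewrite -measureU//.
    apply: le_measure; rewrite ?inE//; first exact: measurableU.
    move=> w []; rewrite /= ?in_itv/=; last by move=> ->; exact: lexx.
    by move=> h; apply: le_trans h _; exact: ltW.
  apply/seteqP; split => w //= [+ xc]; rewrite in_itv/= xc leNgt.
  by rewrite yc.
have : (limn (cdf (xi 0%R) \o y) <= cdf (xi 0%R) c - P (xi 0%R @^-1` [set c]))%E.
  by apply: lime_le; [apply/cvg_ex; exists (cdf (xi 0) c); exact: cy|exact: nearW].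
rewrite (cvg_lim _ cy)//.
have : cdf (xi 0) c \is a fin_num by rewrite /cdf fin_num_measure.
have : (0 <= P (xi 0%R @^-1` [set c]))%E by [].
move: fc; case: (P (xi 0 @^-1` [set c])) => // p; case: (cdf _ _) => // q; rewrite !lee_fin => _ p0 _ qp.
by congr EFin; lra.
Qed.

(** With the past frozen and [U] nonzero, cancellation fixes the noise at -V/U, an event of
    probability zero; Tonelli integrates this over the past. *)
Lemma noise_past_atomless t (U V : T -> R) : past_measurable t U -> past_measurable t V ->
  {ae P, forall w, U w != 0 -> xi t w * U w + V w != 0}.
Proof.
move=> mU mV.
pose A := [set z : R * past_space t | z.1 * U z.2 + V z.2 = 0 /\ U z.2 <> 0].
have mU2 : measurable_fun setT (fun z : R * past_space t => U z.2) := measurableT_comp mU measurable_snd.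
have mV2 : measurable_fun setT (fun z : R * past_space t => V z.2) := measurableT_comp mV measurable_snd.
have mA : measurable A.
  apply: measurableI.
    apply: (measurable_eqr_set (g := fun=> 0)); last exact: measurable_cst.
    by apply: measurable_funD => //; apply: measurable_funM => //; exact: measurable_fst.
  apply: measurableC; apply: (measurable_eqr_set (g := fun=> 0)) => //; exact: measurable_cst.
have mI : measurable_fun setT (fun z : R * past_space t => (\1_A z : R)%:E).
  by apply/measurable_EFinP; exact: measurable_indic.
have I0 z : (0 <= (\1_A z : R)%:E)%E by rewrite lee_fin.
have := tonelli_noise_past mI I0.
rewrite [RHS]integral0_eq; last first.
  move=> w _; have [Uw|Uw] := eqVneq (U w) 0.
    by apply: integral0_eq => v _; rewrite indicE memNset// => -[_]; rewrite Uw.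
  rewrite (eq_integral (fun v => (\1_[set v | xi t v = - V w / U w] v)%:E)); last first.
    move=> v _; rewrite !indicE; congr (nat_of_bool _)%:R%:E; apply/idP/idP; rewrite !inE /A/=.
      move=> [/eqP]; rewrite addr_eq0 => /eqP E _; by rewrite -E mulfK.
    by move=> ->; split; [rewrite divfK// addNr|exact/eqP].
  rewrite integral_indic// ?setIT; first exact: noise_atomless.
  by apply: (measurable_eqr_set (g := fun=> - V w / U w)); [exact: measurable_funPT|exact: measurable_cst].
have mB : measurable (@noise_past t @^-1` A).
  by rewrite -[X in measurable X]setTI; exact: measurable_noise_past.
rewrite (_ : (fun w => _) = (fun w => (\1_(@noise_past t @^-1` A) w)%:E))//.
rewrite integral_indic// setIT => PA0; exists (@noise_past t @^-1` A); split => //.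
move=> w /= nw; apply: contrapT => nA; apply: nw => Uw; apply/eqP => E; apply: nA.
by split => //; exact/eqP.
Qed.

End noise.

(** * Type 2 inequality for symmetric martingale differences *)

Section measurable_pnorm.
Context d (T : measurableType d) (R : realType) (I : finType).

Lemma measurable_pnorm r (x : I -> T -> R) :
  (forall i, measurable_fun setT (x i)) ->
  measurable_fun setT (fun w => pnorm r (fun i => x i w)).
Proof.
elim: r x => [|r IH] x mx /=.
  by apply: measurable_sum => i; exact: measurableT_comp.
have msqrt : measurable_fun setT (@Num.sqrt R).
  by apply: continuous_measurable_fun; exact: sqrt_continuous.
apply: (measurableT_comp msqrt).
by apply: (IH (fun i w => x i w ^+ 2)) => i; exact: measurable_funX.
Qed.

Lemma pnorm_le_sum r (x : I -> R) : pnorm r x <= \sum_i `|x i|.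
Proof.
elim: r x => [|r IH] x //=.
have S0 : 0 <= \sum_i `|x i| by apply: sumr_ge0.
rewrite -[leRHS]ger0_norm// -sqrtr_sqr; apply: ler_wsqrtr.
apply: le_trans (IH _) _; rewrite expr2 mulr_suml; apply: ler_sum => i _.
rewrite normrX expr2; apply: ler_wpM2l => //.
by rewrite (bigD1 i)//= lerDl sumr_ge0.
Qed.

Lemma sqr_integrable_pnorm (P : probability T R) r (x : I -> T -> R) :
  (forall i, sqr_integrable P (x i)) ->
  sqr_integrable P (fun w => pnorm r (fun i => x i w)).
Proof.
move=> xi; apply: (@sqr_integrable_le _ _ _ _ (fun w => \sum_i `|x i w|)).
- by apply: measurable_pnorm => i; case: (xi i).
- by move=> w; rewrite !ger0_norm ?pnorm_ge0 ?sumr_ge0//; exact: pnorm_le_sum.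
- by apply: sqr_integrable_sum => i; exact: sqr_integrable_norm.
Qed.

End measurable_pnorm.

Section symmetric_martingale.
Context d (T : measurableType d) (R : realType) (P : probability T R).
Variable xi : int -> {RV P >-> R}.
Hypothesis xi_indep : mutually_independent P xi.
Hypothesis xi_ident : identically_distributed P xi.
Hypothesis xi_sym : symmetric_distribution P (xi 0).
Variables (X Y : int -> T -> R) (v : R).
Hypothesis XE : forall t, {ae P, forall w, X t w = xi t w * Y t w}.
Hypothesis Y_past : forall t, past_measurable xi t (Y t).
Hypothesis X_past : forall s t, s < t -> past_measurable xi t (X s).
Hypothesis X_sqr : forall t, sqr_integrable P (X t).
Hypothesis Ex_X_sqr : forall t, Ex P (fun w => X t w ^+ 2) = v.

Lemma measurable_noise_past_fun t (I : finType) r (S : I -> T -> R) (u : I -> R) :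
  (forall i, past_measurable xi t (S i)) ->
  measurable_fun setT (fun z : R * past_space xi t =>
    pnorm r (fun i => S i z.2 + (z.1 * Y t z.2) * u i) ^+ 2).
Proof.
have mY2 : measurable_fun setT (fun z : R * past_space xi t => Y t z.2) :=
  measurableT_comp (@Y_past t) measurable_snd.
move=> pS; apply: measurable_funX; apply: measurable_pnorm => i.
apply: measurable_funD; first exact: (measurableT_comp (pS i) measurable_snd).
apply: measurable_funM; last exact: measurable_cst.
apply: measurable_funM; first exact: measurable_fst.
exact: mY2.
Qed.

(* Type 2 inequality: flipping the sign of the last noise leaves the law
   unchanged, so the smoothness of the norm applies at each step. *)
Lemma Ex_pnorm_martingale_le (I : finType) r (u : nat -> I -> R) t0 n :
  Ex P (fun w => pnorm r.+1 (fun i => \sum_(s < n) X (t0 + s%:Z) w * u s i) ^+ 2)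
  <= (2 ^+ r.+1 - 1) * v * \sum_(s < n) pnorm r.+1 (u s) ^+ 2.
Proof.
set K := _ - 1.
elim: n => [|n IH].
  rewrite big_ord0 mulr0 (_ : (fun w => _) = cst 0) ?Ex_cst//.
  apply/funext => w; rewrite (@eq_pnorm _ _ _ _ (fun i => 0 * 0)).
    by rewrite pnormZ normr0 mul0r expr0n.
  by move=> i; rewrite big_ord0 mul0r.
pose t := t0 + n%:Z.
pose S i w := \sum_(s < n) X (t0 + s%:Z) w * u s i.
have pS i : past_measurable xi t (S i).
  apply: measurable_sum => s; apply: measurable_funM; last exact: measurable_cst.
  by apply: X_past; rewrite ltrD2l ltz_nat.
have Si i : sqr_integrable P (S i).
  apply: sqr_integrable_sum => s; have := sqr_integrableZ (u s i) (X_sqr (t0 + s%:Z)).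
  by under eq_fun do rewrite mulrC.
have Xui i : sqr_integrable P (fun w => X t w * u n i).
  by have := sqr_integrableZ (u n i) (X_sqr t); under eq_fun do rewrite mulrC.
pose Np w := pnorm r.+1 (fun i => S i w + X t w * u n i).
pose Nm w := pnorm r.+1 (fun i => S i w - X t w * u n i).
have Npi : sqr_integrable P Np.
  by apply: (sqr_integrable_pnorm _ (x := fun i w => S i w + X t w * u n i)) => i; exact: sqr_integrableD.
have Nmi : sqr_integrable P Nm.
  by apply: (sqr_integrable_pnorm _ (x := fun i w => S i w - X t w * u n i)) => i; exact: sqr_integrableB.
have NSi : sqr_integrable P (fun w => pnorm r.+1 (S^~ w)) by exact: sqr_integrable_pnorm.
have mg := measurable_noise_past_fun r.+1 (u n) pS.
set g := (X in measurable_fun _ X) in mg.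
have mgp : measurable_fun setT (fun w => g (xi t w, w)).
  exact: (measurableT_comp mg (@measurable_noise_past _ _ _ _ xi t)).
have mgm : measurable_fun setT (fun w => g (- xi t w, w)).
  apply: (measurableT_comp (f := fun z : R * past_space xi t => g (- z.1, z.2)) _ (@measurable_noise_past _ _ _ _ xi t)).
  apply: (measurableT_comp mg); apply: measurable_fun_pair; last exact: measurable_snd.
  by apply: measurableT_comp => //; exact: measurable_fst.
have Epm : Ex P (fun w => Np w ^+ 2) = Ex P (fun w => Nm w ^+ 2).
  transitivity (Ex P (fun w => g (xi t w, w))).
    apply: ae_eq_Ex => //; first by apply: measurable_funX; case: Npi.
    by apply: filterS (XE t) => w E; rewrite /g /Np /= E.
  rewrite -(Ex_noise_past_opp xi_indep xi_ident xi_sym mg).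
  apply: ae_eq_Ex => //; first by apply: measurable_funX; case: Nmi.
  apply: filterS (XE t) => w E; rewrite /g /Nm /= E; congr (_ ^+ 2).
  by apply: (@eq_pnorm _ _ r.+1) => i; rewrite !mulNr.
have -> : (fun w => pnorm r.+1 (fun i => \sum_(s < n.+1) X (t0 + s%:Z) w * u s i) ^+ 2) =
    (fun w => Np w ^+ 2).
  apply/funext => w; congr (_ ^+ 2); apply: (@eq_pnorm _ _ r.+1) => i.
  by rewrite big_ord_recr.
have -> : \sum_(s < n.+1) pnorm r.+1 (u s) ^+ 2 =
    \sum_(s < n) pnorm r.+1 (u s) ^+ 2 + pnorm r.+1 (u n) ^+ 2 by rewrite big_ord_recr.
rewrite mulrDr.
have NSi2 : rintegrable P (fun w => pnorm r.+1 (S^~ w) ^+ 2) by case: NSi.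
have Xi2 : rintegrable P (fun w => X t w ^+ 2) by case: (X_sqr t).
have : Ex P (fun w => Np w ^+ 2 + Nm w ^+ 2) <=
    Ex P (fun w => 2 * pnorm r.+1 (S^~ w) ^+ 2 + (2 * K * pnorm r.+1 (u n) ^+ 2) * X t w ^+ 2).
  apply: ler_Ex.
  - by apply: rintegrableD; [case: Npi|case: Nmi].
  - by apply: rintegrableD; exact: rintegrableZ.
  - move=> w; apply: le_trans (pnorm_smooth r _ _) _; rewrite lerD2l.
    rewrite pnormZ exprMn real_normK ?num_real//.
    by rewrite (mulrC (X t w ^+ 2)) mulrA.
rewrite ExD; [|by case: Npi|by case: Nmi].
rewrite -Epm ExD; [|exact: rintegrableZ|exact: rintegrableZ].
rewrite !ExZ// Ex_X_sqr.
move: IH; rewrite -/(S _ _) -[X in X <= _ -> _]/(Ex P (fun w => pnorm r.+1 (S^~ w) ^+ 2)).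
move: (Ex P (fun w => pnorm r.+1 (S^~ w) ^+ 2)) (Ex P _) => E1 E2.
by set A := \sum_(_ < _) _; nra.
Qed.

End symmetric_martingale.

(** * Empirical norm and deterministic tail bound *)

Section rms.
Context {R : realType}.
Implicit Types (y : nat -> R) (n : nat).

(** Built on the Euclidean norm [pnorm 1] to inherit its triangle inequality; for n = 0 the inverse
    is 0 and so is the value. *)
Definition rms n y : R := Num.sqrt n%:R^-1 * pnorm 1 (fun i : 'I_n => y i).

Lemma rms_ge0 n y : 0 <= rms n y.
Proof. by rewrite mulr_ge0 ?sqrtr_ge0 ?pnorm_ge0. Qed.

Lemma rms_sqr n y : rms n y ^+ 2 = n%:R^-1 * \sum_(t < n) y t ^+ 2.
Proof.
rewrite /rms exprMn sqr_sqrtr ?invr_ge0// pnorm_sqr; congr (_ * _).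
by apply: eq_bigr => i _; rewrite ger0_norm ?sqr_ge0.
Qed.

Lemma eq_rms n y1 y2 : (forall t, (t < n)%N -> y1 t = y2 t) -> rms n y1 = rms n y2.
Proof. by move=> h; congr (_ * _); apply: (@eq_pnorm _ _ 1) => i; rewrite h. Qed.

Lemma ler_rms n y1 y2 : (forall t, (t < n)%N -> `|y1 t| <= `|y2 t|) ->
  rms n y1 <= rms n y2.
Proof.
move=> h; apply: ler_wpM2l; first exact: sqrtr_ge0.
by apply: ler_pnorm => i; exact: h.
Qed.

Lemma ler_rmsD n y1 y2 : rms n (fun t => y1 t + y2 t) <= rms n y1 + rms n y2.
Proof. by rewrite -mulrDr; apply: ler_wpM2l; [exact: sqrtr_ge0|exact: ler_pnormD]. Qed.

Lemma rmsZ n c y : rms n (fun t => c * y t) = `|c| * rms n y.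
Proof. by rewrite /rms pnormZ mulrCA. Qed.

Lemma ler_rms_sum n (I : Type) (s : seq I) (y : I -> nat -> R) :
  rms n (fun t => \sum_(i <- s) y i t) <= \sum_(i <- s) rms n (y i).
Proof.
elim: s => [|i s IH].
  rewrite big_nil (@eq_rms _ _ (fun t => 0 * 0)) ?rmsZ ?normr0 ?mul0r// => t _.
  by rewrite big_nil.
rewrite big_cons (@eq_rms _ _ (fun t => y i t + \sum_(j <- s) y j t)); last first.
  by move=> t _; rewrite big_cons.
by apply: le_trans (ler_rmsD _ _ _) _; rewrite lerD2l.
Qed.

Lemma rms_cst_le n c : rms n (fun=> c) <= `|c|.
Proof.
rewrite -[leRHS]ger0_norm// -sqrtr_sqr -[leLHS]ger0_norm ?rms_ge0// -sqrtr_sqr.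
apply: ler_wsqrtr; rewrite rms_sqr real_normK ?num_real// sumr_const card_ord.
have [->|n0] := posnP n; first by rewrite mulr0n mulr0 sqr_ge0.
by rewrite -[c ^+ 2 *+ n]mulr_natl mulKf// pnatr_eq0 -lt0n.
Qed.

Lemma ler_rms_dist n y1 y2 y3 : (forall t, `|y1 t - y2 t| <= `|y3 t|) ->
  `|rms n y1 - rms n y2| <= rms n y3.
Proof.
have le1 z1 z2 : (forall t, `|z1 t - z2 t| <= `|y3 t|) -> rms n z1 <= rms n z2 + rms n y3.
  move=> h; apply: (@le_trans _ _ (rms n (fun t => z2 t + (z1 t - z2 t)))).
    by apply: ler_rms => t _; rewrite addrC subrK.
  by apply: le_trans (ler_rmsD _ _ _) _; rewrite lerD2l; apply: ler_rms => t _.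
move=> h; rewrite ler_distl; apply/andP; split; last exact: le1.
by rewrite lerBlDr; apply: le1 => t; rewrite distrC.
Qed.

Lemma ler_rms_shift n k y :
  rms n (fun t => if (k <= t)%N then y (t - k)%N else 0) <= rms n y.
Proof.
rewrite -(ler_pXn2r (n := 2))// ?nnegrE ?rms_ge0// !rms_sqr.
apply: ler_wpM2l; first by rewrite invr_ge0.
rewrite -(big_mkord xpredT (fun t => (if (k <= t)%N then y (t - k)%N else 0) ^+ 2)).
rewrite -(big_mkord xpredT (fun t => y t ^+ 2)).
have [nk|kn] := leqP n k.
  rewrite big_nat big1; first by apply: sumr_ge0 => t _; exact: sqr_ge0.
  by move=> t /andP[_ tn]; rewrite leqNgt (leq_trans tn nk)/= expr0n.
rewrite (big_cat_nat _ (ltnW kn))//= [X in X + _]big_nat [X in X + _]big1 ?add0r; last first.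
  by move=> t /andP[_ tk]; rewrite leqNgt tk/= expr0n.
rewrite -{1}[k]add0n big_addn [leRHS](big_cat_nat _ (leq_subr k n))//=.
rewrite (eq_bigr (fun t => y t ^+ 2)); last by move=> t _; rewrite leq_addl addnK.
by rewrite lerDl; apply: sumr_ge0 => t _; exact: sqr_ge0.
Qed.

End rms.

Section dyadic_tail.
Context {R : realType}.

Lemma iter_sqrt_expn r (x : R) : 0 <= x -> iter r Num.sqrt x ^+ (2 ^ r) = x.
Proof.
elim: r x => [|r IH] x x0; first by rewrite expr1.
by rewrite iterSr expnSr exprM IH ?sqrtr_ge0// sqr_sqrtr.
Qed.

Lemma iter_sqrt_gt1 r (x : R) : 1 < x -> 1 < iter r Num.sqrt x.
Proof.
elim: r x => [|r IH] x x1 //=; rewrite -[ltLHS]sqrtr1 ltr_sqrt ?IH//.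
by rewrite (lt_trans ltr01)// IH.
Qed.

Lemma sum_dyadic_blocks (F : nat -> R) J m t : (t.+1 <= 2 ^ (J + m))%N ->
  \sum_(2 ^ J <= k < t.+1) F k =
  \sum_(i < m) \sum_(2 ^ (J + i) <= k < 2 ^ (J + i).+1 | (k <= t)%N) F k.
Proof.
move=> tm; rewrite (big_nat_widen _ _ _ _ _ tm) /=.
elim: m {tm} => [|m IH]; first by rewrite addn0 big_geq// big_ord0.
rewrite big_ord_recr/= -IH addnS; apply: big_cat_nat.
  by rewrite leq_exp2l// leq_addr.
by rewrite leq_exp2l.
Qed.

(** A lag in [L, 2L) is L plus a lag below L. So the first L outputs vanish, and the other n - L
    form a convolution that [n %/ L] input blocks cover. Rounding down matters: the blocks have
    total length at most n, also when L exceeds n. *)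
Lemma dyadic_block_le r L n (b z : nat -> R) : (0 < L)%N ->
  \sum_(t < n) (\sum_(L <= k < L.*2 | (k <= t)%N) b k * z (t - k)%N) ^+ 2 <=
  4 * (\sum_(L <= k < L.*2) b k ^+ 2) *
    \sum_(e < n %/ L) block_norm r L (fun s => z (e * L + s)%N) ^+ 2.
Proof.
move=> L0.
have nL : (n - L <= (n %/ L) * L)%N.
  by rewrite leq_subLR {1}(divn_eq n L) addnC leq_add2r ltnW// ltn_pmod.
have EB : \sum_(L <= k < L.*2) b k ^+ 2 = \sum_(k < L) b (L + k)%N ^+ 2.
  by rewrite -{1}[L]add0n big_addn -addnn addnK big_mkord; apply: eq_bigr => i _; rewrite addnC.
rewrite EB; apply: le_trans (convolution_blocks_le r (fun k => b (L + k)%N) z nL).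
have [nL'|Ln] := leqP n L.
  rewrite big1; first by apply: sumr_ge0 => t _; exact: sqr_ge0.
  move=> t _; rewrite big_nat_cond big_pred0 ?expr0n// => k.
  by apply/negP => /andP[/andP[Lk _] kt]; have := ltn_ord t; lia.
have [m nm] : exists m, n = (L + m)%N by exists (n - L)%N; rewrite subnKC// ltnW.
rewrite nm addKn big_split_ord/=.
rewrite big1 ?add0r; last first.
  move=> t _; rewrite big_nat_cond big_pred0 ?expr0n// => k.
  by apply/negP => /andP[/andP[Lk _] kt]; have := ltn_ord t; lia.
apply: ler_sum => t _; rewrite le_eqVlt; apply/orP; left; apply/eqP; congr (_ ^+ 2).
rewrite -{1}[L]add0n big_addn -addnn addnK big_mkord; apply: eq_big => k.
  by rewrite addnC leq_add2l.
by move=> kt; rewrite addnC subnDl.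
Qed.

(** On the lags of the dyadic block j the convolution estimate gives an empirical norm at most
    [2 * B * kap ^ j], where kap^2 = q rho^2 < 1, and a geometric series sums the blocks from J on.
    The threshold on J involves neither [b] nor [n]. *)
Lemma dyadic_tail_le r rho q J0 (z : nat -> R) : 0 <= q -> 0 < rho -> q * rho ^+ 2 < 1 ->
  (forall j, (J0 <= j)%N -> forall m, \sum_(e < m)
     block_norm r (2 ^ j) (fun s => z (e * 2 ^ j + s)%N) ^+ 2
     <= m%:R * ((2 ^ j)%:R * rho ^+ (2 * j))) ->
  forall eps, 0 < eps -> exists J1, forall J, (J1 <= J)%N -> forall (b : nat -> R) B, 0 <= B ->
    (forall j, \sum_(2 ^ j <= k < 2 ^ j.+1) b k ^+ 2 <= B ^+ 2 * q ^+ j) ->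
    forall n, rms n (fun t => \sum_(2 ^ J <= k < t.+1) b k * z (t - k)%N) <= eps * B.
Proof.
move=> q0 rho0 qr1 hz eps eps0.
set kap := Num.sqrt (q * rho ^+ 2).
have qr0 : 0 <= q * rho ^+ 2 by rewrite mulr_ge0 ?sqr_ge0.
have kap0 : 0 <= kap by exact: sqrtr_ge0.
have kap1 : kap < 1 by rewrite /kap -[ltRHS]sqrtr1 ltr_sqrt.
have [J1 [J0J1 hJ1]] : exists J1, (J0 <= J1)%N /\ 2 * kap ^+ J1 / (1 - kap) <= eps.
  have /cvgrPdist_le/(_ (eps * (1 - kap) / 2)) : kap ^+ n @[n --> \oo] --> 0.
    by apply: cvg_expr; rewrite ger0_norm.
  case=> [|N _ hN]; first by rewrite divr_gt0// mulr_gt0// subr_gt0.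
  exists (maxn J0 N); split; first exact: leq_maxl.
  have := hN (maxn J0 N) (leq_maxr _ _); rewrite sub0r normrN ger0_norm ?exprn_ge0//.
  rewrite ler_pdivlMr// ler_pdivrMr ?subr_gt0//; lra.
exists J1 => J J1J b B B0 hb n.
have J0J := leq_trans J0J1 J1J.
have hJ : 2 * kap ^+ J / (1 - kap) <= eps.
  apply: le_trans hJ1; apply: ler_wpM2r; first by rewrite invr_ge0 subr_ge0 ltW.
  by rewrite ler_pM2l// ler_wiXn2l// ltW.
have block i : rms n (fun t => \sum_(2 ^ (J + i) <= k < 2 ^ (J + i).+1 | (k <= t)%N)
    b k * z (t - k)%N) <= 2 * B * kap ^+ (J + i).
  set j := (J + i)%N; set L := (2 ^ j)%N.
  have L0 : (0 < L)%N by rewrite expn_gt0.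
  have R0 : 0 <= 2 * B * kap ^+ j by rewrite !mulr_ge0 ?exprn_ge0.
  rewrite -(ler_pXn2r (n := 2))// ?nnegrE ?rms_ge0// rms_sqr.
  have [->|n0] := posnP n; first by rewrite big_ord0 mulr0 sqr_ge0.
  rewrite mulrC ler_pdivrMr ?ltr0n//.
  have -> : (2 ^ j.+1)%N = L.*2 by rewrite expnS mul2n.
  apply: le_trans (dyadic_block_le r n b z L0) _.
  have Vle := hz j (leq_trans J0J (leq_addr i J)) (n %/ L)%N.
  have V0 : 0 <= \sum_(e < n %/ L) block_norm r L (fun s => z (e * L + s)%N) ^+ 2.
    by apply: sumr_ge0 => e _; exact: sqr_ge0.
  have := hb j; rewrite expnS mul2n -/L => bj.
  apply: (@le_trans _ _ (4 * (B ^+ 2 * q ^+ j) * ((n %/ L)%:R * (L%:R * rho ^+ (2 * j))))).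
    apply: ler_pM => //.
      by rewrite mulr_ge0// sumr_ge0// => k _; exact: sqr_ge0.
    by rewrite ler_wpM2l.
  have nLn : (n %/ L)%:R * L%:R <= n%:R :> R by rewrite -natrM ler_nat leq_trunc_div.
  have -> : (2 * B * kap ^+ j) ^+ 2 = 4 * (B ^+ 2 * q ^+ j) * rho ^+ (2 * j).
    rewrite !exprMn -exprM mulnC exprM sqr_sqrtr// exprMn -exprM; ring.
  rewrite (mulrA (_ %/ _)%:R) (mulrC _ (rho ^+ _)) mulrA.
  by rewrite [leLHS]mulrA ler_wpM2l// !mulr_ge0 ?sqr_ge0 ?exprn_ge0// ltW.
(* Only lags below n occur, so n dyadic blocks after J are always enough. *)
have nJ : (n <= 2 ^ (J + n))%N.
  by rewrite (leq_trans (ltnW (ltn_expl n (ltnSn 1))))// leq_exp2l// leq_addl.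
rewrite (@eq_rms _ n _ (fun t => \sum_(i < n)
   \sum_(2 ^ (J + i) <= k < 2 ^ (J + i).+1 | (k <= t)%N) b k * z (t - k)%N)); last first.
  by move=> t tn; apply: sum_dyadic_blocks; exact: leq_trans tn nJ.
apply: le_trans (ler_rms_sum _ _ _) _.
apply: (@le_trans _ _ (\sum_(i < n) 2 * B * kap ^+ (J + i))).
  by apply: ler_sum => i _; exact: block.
under eq_bigr do rewrite exprD mulrA.
rewrite -mulr_sumr; have kap1' : 0 < 1 - kap by rewrite subr_gt0.
have geo : \sum_(i < n) kap ^+ i <= (1 - kap)^-1.
  rewrite -(ler_pM2l kap1') divff ?gt_eqF//.
  have -> : (1 - kap) * \sum_(i < n) kap ^+ i = 1 - kap ^+ n.
    by rewrite -[RHS]opprB subrX1 -mulNr opprB.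
  by rewrite gerBl exprn_ge0.
apply: (@le_trans _ _ (2 * B * kap ^+ J * (1 - kap)^-1)).
  by rewrite ler_wpM2l// !mulr_ge0 ?exprn_ge0.
have -> : 2 * B * kap ^+ J * (1 - kap)^-1 = (2 * kap ^+ J / (1 - kap)) * B by ring.
by rewrite ler_wpM2r.
Qed.

End dyadic_tail.

(** * Almost sure tail bound for the process *)

Section process_tail.
Context d (T : measurableType d) (R : realType) (P : probability T R).
Variable xi : int -> {RV P >-> R}.
Hypothesis xi_indep : mutually_independent P xi.
Hypothesis xi_ident : identically_distributed P xi.
Hypothesis xi_sym : symmetric_distribution P (xi 0).
Variables (X : int -> {RV P >-> R}) (Y : int -> T -> R) (v : R).
Hypothesis XE : forall t, {ae P, forall w, X t w = xi t w * Y t w}.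
Hypothesis Y_past : forall t, past_measurable xi t (Y t).
Hypothesis X_past : forall s t, s < t -> past_measurable xi t (X s).
Hypothesis X_sqr : forall t, sqr_integrable P (X t).
Hypothesis Ex_X_sqr : forall t, Ex P (fun w => X t w ^+ 2) = v.
Hypothesis X_stat : strictly_stationary P X.

(** A frequency vector has 4L = 2^(j+2) coordinates bounded by 1, so its squared norm is at most
    [rho ^ (j + 2)], and the type 2 inequality bounds the mean by a constant times
    [L * rho ^ (j + 2)]. Dividing by the level [L * rho ^ (2 * j)] leaves [rho^-1 ^ j], which the
    Borel-Cantelli lemma can sum. *)
Lemma block_norm_maximal r rho j : 0 < rho -> rho ^+ (2 ^ r) = 2 ->
  let A := [set w | exists m, m%:R * ((2 ^ j)%:R * rho ^+ (2 * j)) <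
    \sum_(e < m) block_norm r.+1 (2 ^ j) (fun s => X ((e * 2 ^ j + s)%:Z + 1) w) ^+ 2] in
  measurable A /\
  (P A <= ((2 ^+ r.+1 - 1) * v * rho ^+ 2 * rho^-1 ^+ j)%:E)%E.
Proof.
move=> rho0 rhor; set L := (2 ^ j)%N; set lam := _ * _.
have L0 : (0 < L)%N by rewrite expn_gt0.
have LR : 0 < L%:R :> R by rewrite ltr0n.
have lam0 : 0 < lam by rewrite mulr_gt0// exprn_gt0.
pose f (x : @path_space R int) := block_norm r.+1 L (fun s : nat => x (1 + s%:Z)) ^+ 2.
have mf : measurable_fun setT f.
  apply: measurable_funX; apply: measurable_pnorm => i; apply: measurable_sum => s.
  by apply: measurable_funM; [exact: measurable_coordinate|exact: measurable_cst].
have f0 x : 0 <= f x by exact: sqr_ge0.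
have fi : rintegrable P (f \o path_of X).
  have [] : sqr_integrable P (fun w => block_norm r.+1 L (fun s : nat => X (1 + s%:Z) w)); last by [].
  apply: (sqr_integrable_pnorm _ (x := fun i w => \sum_(s < L) X (1 + s%:Z) w * fourier_vector s i)) => i.
  apply: sqr_integrable_sum => s.
  have := sqr_integrableZ (fourier_vector s i) (X_sqr (1 + s%:Z)).
  by under eq_fun do rewrite mulrC.
have [] := process_maximal_inequality X_stat L%:Z mf f0 fi lam0.
have -> : [set w | exists n, n%:R * lam < \sum_(e < n) f (shift_by (L%:Z *+ e) (path_of X w))] =
  [set w | exists m, m%:R * lam <
    \sum_(e < m) block_norm r.+1 L (fun s => X ((e * L + s)%:Z + 1) w) ^+ 2].
  have E (w : T) n : \sum_(e < n) f (shift_by (L%:Z *+ e) (path_of X w)) =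
      \sum_(e < n) block_norm r.+1 L (fun s => X ((e * L + s)%:Z + 1) w) ^+ 2.
    apply: eq_bigr => e _; rewrite /f; congr (block_norm _ _ _ ^+ 2); apply/funext => s.
    rewrite /shift_by /path_of /sample_path; congr (X _ w).
    by rewrite PoszD PoszM -mulr_natr natz; lia.
  by apply/seteqP; split => w [n hn]; exists n; [rewrite -E|rewrite E].
move=> mA PA; split => //; apply: le_trans PA _; rewrite lee_fin ler_pdivrMr//.
apply: (le_trans (Ex_pnorm_martingale_le xi_indep xi_ident xi_sym XE Y_past X_past X_sqr
  Ex_X_sqr r (fun s => @fourier_vector R L.*2 s) 1 L)).
have v0 : 0 <= v by rewrite -(Ex_X_sqr 0); apply: Ex_ge0 => w; exact: sqr_ge0.
have K0 : 0 <= (2 ^+ r.+1 - 1 : R) by rewrite subr_ge0 exprn_ege1// ler1n.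
have u_le s : pnorm r.+1 (@fourier_vector R L.*2 s) ^+ 2 <= rho ^+ (j + 2).
  rewrite -(ler_pXn2r (n := 2 ^ r)) ?nnegrE ?sqr_ge0 ?exprn_ge0 ?expn_gt0 ?(ltW rho0)//.
  rewrite -!exprM -expnS mulnC exprM [rho ^+ _]rhor.
  apply: le_trans (pnorm_le_card _ _) _; first exact: fourier_vector_le1.
  rewrite card_prod card_ord card_bool -natrX ler_nat /L.
  by rewrite addn2 !expnS -mul2n; lia.
apply: (@le_trans _ _ ((2 ^+ r.+1 - 1) * v * (L%:R * rho ^+ (j + 2)))).
  apply: ler_wpM2l; first by rewrite mulr_ge0.
  apply: le_trans (ler_sum _ (fun (s : 'I_L) _ => u_le s)) _.
  by rewrite sumr_const card_ord mulr_natl.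
rewrite /lam exprVn mul2n -addnn !exprD le_eqVlt; apply/orP; left; apply/eqP.
by field; rewrite gt_eqF// exprn_gt0.
Qed.

Theorem process_tail q : 0 <= q < 1 -> {ae P, forall w,
  forall eps, 0 < eps -> exists J0, forall J, (J0 <= J)%N -> forall (b : nat -> R) B, 0 <= B ->
    (forall j, \sum_(2 ^ j <= k < 2 ^ j.+1) b k ^+ 2 <= B ^+ 2 * q ^+ j) ->
    forall n, rms n (fun t => \sum_(2 ^ J <= k < t.+1) b k * X ((t - k)%:Z + 1) w)
      <= eps * B}.
Proof.
move=> /andP[q0 q1].
(* This [r] makes [q * rho ^ 2 < 1]: since rho^(2^r) = 2, the power 2^r of q rho^2 is 4 q^(2^r). *)
have [r hr] : exists r, q ^+ (2 ^ r) < 4^-1.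
  have /cvgrPdist_lt/(_ 4^-1) : q ^+ n @[n --> \oo] --> 0.
    by apply: cvg_expr; rewrite ger0_norm.
  case=> [|N _ hN]; first by rewrite invr_gt0.
  exists N; have := hN (2 ^ N)%N (ltnW (ltn_expl N (ltnSn 1))).
  by rewrite sub0r normrN ger0_norm ?exprn_ge0.
set rho : R := iter r Num.sqrt 2.
have rho1 : 1 < rho by apply: iter_sqrt_gt1; rewrite ltr1n.
have rho0 : 0 < rho by apply: lt_trans rho1.
have rhor : rho ^+ (2 ^ r) = 2 by exact: iter_sqrt_expn.
have qr : q * rho ^+ 2 < 1.
  rewrite ltNge; apply/negP => h; have := exprn_ege1 (2 ^ r) h.
  rewrite exprMn -exprM mulnC exprM rhor; move: hr; lra.
have BC := borel_cantelli_geometric (fun j => (block_norm_maximal j rho0 rhor).1) _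
  (fun j => (block_norm_maximal j rho0 rhor).2).
have : 0 <= rho^-1 < 1 by rewrite invr_ge0 ltW//= invf_lt1.
move=> /BC; apply: filterS => w [J0 hJ0].
apply: (dyadic_tail_le (r := r.+1) q0 rho0 qr (J0 := J0)
  (z := fun n => X (n%:Z + 1) w)) => j Jj m.
by rewrite leNgt; apply/negP => lt; apply: (hJ0 j Jj); exists m.
Qed.

End process_tail.

(** * Linear processes and identifiability *)

Section linear_process.
Context d (T : measurableType d) (R : realType) (P : probability T R).
Variable xi : int -> {RV P >-> R}.
Hypothesis xi_indep : mutually_independent P xi.
Hypothesis xi_ident : identically_distributed P xi.
Hypothesis xi_sym : symmetric_distribution P (xi 0).
Hypothesis xi_cont : continuous (cdf (xi 0)).
Variables (X : int -> {RV P >-> R}) (Y : int -> T -> R).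
Hypothesis XE : forall t, {ae P, forall w, X t w = xi t w * Y t w}.
Hypothesis Y_past : forall t, past_measurable xi t (Y t).
Hypothesis X_past : forall s t, s < t -> past_measurable xi t (X s).
Hypothesis X_sqr : forall t, sqr_integrable P (X t).

Definition partial_linear (c : nat -> R) (n : nat) (t : int) (w : T) : R :=
  c 0%N + \sum_(1 <= k < n.+1) c k * X (t - k%:Z) w.

Definition linear_process (c : nat -> R) (t : int) (Z : T -> R) : Prop :=
  sqr_integrable P Z /\
  norm2 P (fun w => partial_linear c n t w - Z w) @[n --> \oo] --> 0.

Implicit Types (c : nat -> R) (Z : T -> R).

Lemma partial_linear_sqr c n t : sqr_integrable P (partial_linear c n t).
Proof.
apply: sqr_integrableD; first exact: sqr_integrable_cst.
by apply: sqr_integrable_sum => k; exact: sqr_integrableZ.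
Qed.

Lemma linear_processD (e : R) c1 c2 t Z1 Z2 : linear_process c1 t Z1 ->
  linear_process c2 t Z2 ->
  linear_process (fun k => c1 k + e * c2 k) t (fun w => Z1 w + e * Z2 w).
Proof.
move=> [Z1i h1] [Z2i h2]; split; first by apply: sqr_integrableD => //; exact: sqr_integrableZ.
have h : norm2 P (fun w => partial_linear c1 n t w - Z1 w) +
    `|e| * norm2 P (fun w => partial_linear c2 n t w - Z2 w) @[n --> \oo] --> 0 + `|e| * 0.
  by apply: cvgD => //; apply: cvgM => //; exact: cvg_cst.
rewrite mulr0 addr0 in h.
apply: (squeeze_cvgr _ (cvg_cst 0) h); apply: nearW => n; rewrite norm2_ge0/=.
have D1 := sqr_integrableB (partial_linear_sqr c1 n t) Z1i.
have D2 := sqr_integrableB (partial_linear_sqr c2 n t) Z2i.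
have -> : `|e| * norm2 P (fun w => partial_linear c2 n t w - Z2 w) =
    norm2 P (fun w => e * (partial_linear c2 n t w - Z2 w)).
  rewrite /norm2 (_ : (fun w => (e * _) ^+ 2) = (fun w => e ^+ 2 * (partial_linear c2 n t w - Z2 w) ^+ 2)).
    rewrite ExZ; last by case: D2.
    by rewrite sqrtrM ?sqr_ge0// sqrtr_sqr.
  by apply/funext => w; rewrite exprMn.
apply: le_trans (ler_norm2D D1 (sqr_integrableZ e D2)).
rewrite le_eqVlt; apply/orP; left; apply/eqP; congr (norm2 P); apply/funext => w.
rewrite /partial_linear; under eq_bigr do rewrite mulrDl -mulrA.
by rewrite big_split/= -mulr_sumr; ring.
Qed.

Lemma linear_process_cst c t Z : (forall k, (0 < k)%N -> c k = 0) ->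
  linear_process c t Z -> {ae P, forall w, Z w = c 0%N}.
Proof.
move=> c0 [Zi h].
have E n w : partial_linear c n t w = c 0%N.
  rewrite /partial_linear big_nat big1 ?addr0// => k /andP[k0 _].
  by rewrite c0 ?mul0r.
have Di := sqr_integrableB (sqr_integrable_cst P (c 0%N)) Zi.
have : norm2 P (fun w => cst (c 0%N) w - Z w) = 0.
  have hc : norm2 P (fun w => partial_linear c n t w - Z w) @[n --> \oo] -->
      norm2 P (fun w => cst (c 0%N) w - Z w).
    apply: cvg_near_cst; apply: nearW => n; congr (norm2 P).
    by apply/funext => w; rewrite E.
  exact: (cvg_unique (@Rhausdorff R) hc h).
move=> /(norm2_eq0 Di); apply: filterS => w /eqP; rewrite subr_eq0 => /eqP <-.
by [].
Qed.

Lemma linear_process_past c t Z : linear_process c t Z -> past_measurable xi t Z.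
Proof.
move=> [Zi h]; apply: (past_measurable_cvg_L2 (S := fun n => partial_linear c n t)) => // n.
  apply: measurable_funD; first exact: measurable_cst.
  apply: measurable_sum_in => k; rewrite mem_index_iota => /andP[k1 _].
  apply: measurable_funM; first exact: measurable_cst.
  by apply: X_past; lia.
exact: partial_linear_sqr.
Qed.

(** Setting coefficient [k] to zero leaves the constant and lags beyond [k], all measurable in the
    past of [t - k], and the completed past is stable under L^2 limits. *)
Lemma linear_process_first c t Z k : (0 < k)%N ->
  (forall i, (0 < i < k)%N -> c i = 0) -> linear_process c t Z ->
  past_measurable xi (t - k%:Z) (fun w => Z w - c k * X (t - k%:Z) w).
Proof.
move=> k0 ck [Zi h]; pose c' i := if i == k then 0 else c i.
have E n w : (k <= n)%N ->
    partial_linear c' n t w = partial_linear c n t w - c k * X (t - k%:Z) w.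
  move=> kn; rewrite /partial_linear {1}/c' eq_sym gtn_eqF// -addrA; congr (_ + _).
  rewrite (bigD1_seq k)/= ?mem_index_iota ?k0 ?ltnS ?kn ?iota_uniq//.
  rewrite [in RHS](bigD1_seq k)/= ?mem_index_iota ?k0 ?ltnS ?kn ?iota_uniq//.
  rewrite {1}/c' eqxx mul0r add0r addrAC subrr add0r.
  by apply: eq_bigr => i /negPf ik; rewrite /c' ik.
apply: (past_measurable_cvg_L2 (S := fun n => partial_linear c' n t)) => [n|n||].
- apply: measurable_funD; first exact: measurable_cst.
  apply: measurable_sum_in => i; rewrite mem_index_iota => /andP[i1 _].
  rewrite /c'; case: eqP => ik.
    by under eq_fun do rewrite mul0r; exact: measurable_cst.
  have [ltik|ki] := ltnP i k.
    by rewrite ck ?i1//; under eq_fun do rewrite mul0r; exact: measurable_cst.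
  apply: measurable_funM; first exact: measurable_cst.
  by apply: X_past; lia.
- exact: partial_linear_sqr.
- by apply: sqr_integrableB => //; exact: sqr_integrableZ.
- apply: cvg_trans h; apply: near_eq_cvg; exists k => // n /= kn.
  by congr (norm2 P); apply/funext => w; rewrite E//; ring.
Qed.

(** [Z] is the noise at time [t - k] times [c k * Y (t - k)], plus a variable from the past of that
    noise; a noise without atoms rules out cancellation where [Y] is nonzero. *)
Lemma linear_process_neq0_first c t Z k : (0 < k)%N -> c k != 0 ->
  (forall i, (0 < i < k)%N -> c i = 0) -> linear_process c t Z ->
  {ae P, forall w, Y (t - k%:Z) w != 0 -> Z w != 0}.
Proof.
move=> k0 ck ci Zl; have mW := linear_process_first k0 ci Zl.
have mU : past_measurable xi (t - k%:Z) (fun w => c k * Y (t - k%:Z) w).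
  by apply: measurable_funM; [exact: measurable_cst|exact: (@Y_past (t - k%:Z))].
have := noise_past_atomless xi_indep xi_ident xi_cont mU mW.
apply: filterS2 (XE (t - k%:Z)) => w -> + Yw.
rewrite mulf_neq0// => /(_ isT).
by rewrite mulrCA addrCA subrr addr0.
Qed.

Lemma exists_first_neq0 c : (exists2 k, (0 < k)%N & c k != 0) ->
  exists k, [/\ (0 < k)%N, c k != 0 & forall i, (0 < i < k)%N -> c i = 0].
Proof.
move=> [k k0 ck]; have ex : exists k, (0 < k)%N && (c k != 0) by exists k; rewrite k0.
case: (ex_minnP ex) => m /andP[m0 cm] hm; exists m; split => // i /andP[i0 im].
apply/eqP; apply: contraTT im => ci; rewrite -leqNgt; apply: hm.
by rewrite i0.
Qed.

Variable c0 : nat -> R.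
Hypothesis c00 : 0 < c0 0%N.
Hypothesis Y_linear : forall t, linear_process c0 t (Y t).
Hypothesis X_stat : strictly_stationary P X.

Let mY t : measurable_fun setT (Y t). Proof. exact: past_measurableW (@Y_past t). Qed.

Let B t := [set w | Y t w = 0].

Let B_past t : measurable (B t : set (past_space xi t)).
Proof.
by apply: (measurable_eqr_set (T := past_space xi t) (g := fun=> 0)); [exact: (@Y_past t)|exact: measurable_cst].
Qed.

Let mB t : measurable (B t). Proof. exact: past_measurable_set (@B_past t). Qed.

(** Stationarity is given for [X], not for [Y]; as the noise is almost surely nonzero, [B t] is
    almost the event that [X t] vanishes. *)
Let B_stat t : P (B t) = P (B 0).
Proof.
have E s : P (B s) = P (X s @^-1` [set 0]).
  apply: ae_eq_measure => //.
  have xi0 : {ae P, forall w, xi s w != 0}.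
    exists [set w | xi s w = 0]; split.
    - by apply: (measurable_eqr_set (g := fun=> 0)); [exact: measurable_funPT|exact: measurable_cst].
    - exact: noise_atomless.
    - by move=> w /= /negP; rewrite negbK => /eqP.
  apply: filterS2 xi0 (XE s) => w x0 /= ->; rewrite /B/=; split => [->|/eqP]; first by rewrite mulr0.
  by rewrite mulf_eq0 (negPf x0)/= => /eqP.
by rewrite !E; exact: stationary_marginal.
Qed.

(** Reflecting the noise changes the sign of [X s] on an event of its past, so the mean equals its
    opposite. *)
Let Ex_X_past s (A : set T) : measurable (A : set (past_space xi s)) ->
  Ex P (fun w => X s w * \1_A w) = 0.
Proof.
move=> mA.
have mA' := past_measurable_set mA.
have Xi : rintegrable P (fun w => X s w * \1_A w).
  by apply: rintegrable_mask => //; exact: sqr_integrable_rintegrable.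
pose g (z : R * past_space xi s) := z.1 * (Y s z.2 * \1_A z.2).
have mg : measurable_fun setT g.
  apply: measurable_funM; first exact: measurable_fst.
  apply: (measurableT_comp (f := fun w : past_space xi s => Y s w * \1_A w)); last exact: measurable_snd.
  by apply: measurable_funM; [exact: (@Y_past s)|exact: measurable_indic].
have mX : measurable_fun setT (fun w => X s w * \1_A w) := rintegrable_measurable Xi.
have E1 : Ex P (fun w => X s w * \1_A w) = Ex P (fun w => g (xi s w, w)).
  apply: ae_eq_Ex => //.
    exact: (measurableT_comp mg (@measurable_noise_past _ _ _ _ xi s)).
  by apply: filterS (XE s) => w ->; rewrite /g/= mulrA.
have := Ex_noise_past_opp xi_indep xi_ident xi_sym mg; rewrite -E1.
rewrite (_ : (fun w => g (- xi s w, w)) = (fun w => (-1) * g (xi s w, w))); last first.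
  by apply/funext => w; rewrite /g/=; ring.
rewrite ExZ; last first.
  apply: ae_eq_rintegrable Xi.
    exact: (measurableT_comp mg (@measurable_noise_past _ _ _ _ xi s)).
  by apply: filterS (XE s) => w ->; rewrite /g/= mulrA.
rewrite -E1; lra.
Qed.

(* If the volatility vanished on B, then B would belong to the remote past, so
   every X_(t-i) would have mean zero on B and the volatility mean c0 0 * P(B). *)
Lemma volatility_neq0 t : {ae P, forall w, Y t w != 0}.
Proof.
have [all0|] := pselect (forall k, (0 < k)%N -> c0 k = 0).
  by apply: filterS (linear_process_cst all0 (@Y_linear t)) => w ->; rewrite gt_eqF.
move=> /existsNP[k' /not_implyP[k'0 /eqP ck']].
have [k [k0 ck ci]] : exists k, [/\ (0 < k)%N, c0 k != 0 & forall i, (0 < i < k)%N -> c0 i = 0].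
  by apply: exists_first_neq0; exists k'.
(* [B s] is almost contained in [B (s - k)] by [linear_process_neq0_first]; equal probabilities make
   the two almost equal. *)
have step s : {ae P, forall w, B s w <-> B (s - k%:Z) w}.
  have sub := linear_process_neq0_first k0 ck ci (@Y_linear s).
  pose D := B (s - k%:Z) `\` B s.
  have mD : measurable D by exact: measurableD.
  have PI : P (B (s - k%:Z) `&` B s) = P (B s).
    apply: ae_eq_measure => //; first exact: measurableI.
    apply: filterS sub => w h; rewrite /B/=; split => [[]//|Ys]; split => //.
    by apply/eqP; apply: contraTT isT => /h; rewrite Ys eqxx.
  have PD : P D = 0%E.
    rewrite /D measureD//; last by apply: le_lt_trans (ltry 1); exact: probability_le1.
    by change (P (B (s - k%:Z)) - P (B (s - k%:Z) `&` B s) = 0)%E; rewrite PI !B_stat subee// fin_num_measure.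
  have nD : {ae P, forall w, ~ D w} by exists D; split => // w /= /contrapT.
  apply: filterS2 sub nD => w h nd; rewrite /B/=; split => [Ys|Ysk].
    by apply/eqP; apply: contraTT isT => /h; rewrite Ys eqxx.
  by apply: contrapT => Ys; apply: nd.
have steps j : {ae P, forall w, B t w <-> B (t - (j * k)%N%:Z) w}.
  elim: j => [|j IH]; first by apply: aeW => w; rewrite mul0n subr0.
  apply: filterS2 IH (step (t - (j * k)%N%:Z)) => w -> ->.
  by rewrite mulSn PoszD opprD addrA addrAC.
(* As [k] is at least 1, [B (t - i * k)] belongs to the past of [t - i], and it may stand in for
   [B t]. *)
have EX i : (0 < i)%N -> Ex P (fun w => X (t - i%:Z) w * \1_(B t) w) = 0.
  move=> i0; pose j := i; rewrite -[RHS](@Ex_X_past (t - i%:Z) (B (t - (i * k)%N%:Z))); last first.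
    by apply: past_monotone (@B_past _); rewrite lerD2l lerN2 lez_nat leq_pmulr.
  apply: ae_eq_Ex.
  - by apply: measurable_funM; [exact: measurable_funPT|exact: measurable_indic].
  - by apply: measurable_funM; [exact: measurable_funPT|exact: measurable_indic].
  apply: filterS (steps i) => w h; congr (_ * _); rewrite !indicE; congr (nat_of_bool _)%:R.
  by apply/idP/idP; rewrite !inE => /h.
have mi : rintegrable P (\1_(B t)) by exact: integrable_indic.
have si : sqr_integrable P (\1_(B t) : T -> R).
  apply: (sqr_integrable_le _ _ (sqr_integrable_cst P 1)); first exact: measurable_indic.
  by move=> w; rewrite normr1 ger0_norm.
have EL n : Ex P (fun w => partial_linear c0 n t w * \1_(B t) w) = c0 0%N * Ex P \1_(B t).
  rewrite (_ : (fun w => _) = (fun w => c0 0%N * \1_(B t) w +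
     \sum_(1 <= i < n.+1) c0 i * (X (t - i%:Z) w * \1_(B t) w))); last first.
    by apply/funext => w; rewrite mulrDl mulr_suml; under [in RHS]eq_bigr do rewrite mulrA.
  have Xi i : rintegrable P (fun w => c0 i * (X (t - i%:Z) w * \1_(B t) w)).
    by apply: rintegrableZ; apply: rintegrable_mask => //; exact: sqr_integrable_rintegrable.
  rewrite ExD; [|exact: rintegrableZ|exact: rintegrable_sum].
  rewrite ExZ// Ex_sum// big_nat big1 ?addr0// => i /andP[i0 _].
  rewrite ExZ ?EX ?mulr0//; apply: rintegrable_mask => //; exact: sqr_integrable_rintegrable.
have YB w : Y t w * \1_(B t) w = 0.
  by rewrite indicE; case: (boolP (w \in _)) => [/set_mem ->|_]; rewrite ?mul0r ?mulr0.
have [Yi hY] := @Y_linear t.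
(* [Y t] vanishes on [B t], so this quantity is also the mean over [B t] of the truncation error,
   which tends to zero by Cauchy-Schwarz. *)
have le n : c0 0%N * Ex P \1_(B t) <=
    norm2 P (fun w => partial_linear c0 n t w - Y t w) * norm2 P \1_(B t).
  have Di := sqr_integrableB (partial_linear_sqr c0 n t) Yi.
  rewrite -(EL n); apply: le_trans (Ex_cauchy_schwarz Di si).
  rewrite le_eqVlt; apply/orP; left; apply/eqP; congr Ex; apply/funext => w.
  by rewrite mulrBl YB subr0.
have : c0 0%N * Ex P \1_(B t) <= 0 * norm2 P \1_(B t).
  have lim : norm2 P (fun w => partial_linear c0 n t w - Y t w) * norm2 P \1_(B t)
      @[n --> \oo] --> 0 * norm2 P \1_(B t) by apply: cvgM => //; exact: cvg_cst.
  by rewrite -(cvg_lim (@Rhausdorff R) lim); apply: limr_ge; [apply/cvg_ex; eexists; exact: lim|exact: nearW].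
rewrite mul0r pmulr_rle0// => E0.
have PB : P (B t) = 0%E.
  rewrite -Ex_indic//; congr EFin; by apply/eqP; rewrite eq_le E0 Ex_ge0.
by exists (B t); split => // w /= /negP; rewrite negbK => /eqP.
Qed.

Lemma linear_process_neq0 c t Z : linear_process c t Z ->
  (exists2 k, (0 < k)%N & c k != 0) -> {ae P, forall w, Z w != 0}.
Proof.
move=> Zl /exists_first_neq0[k [k0 ck ci]].
apply: filterS2 (linear_process_neq0_first k0 ck ci Zl) (volatility_neq0 (t - k%:Z)).
by move=> w h /h.
Qed.

Lemma ae_false : ~ {ae P, forall w : T, False}.
Proof.
move=> [N [mN N0 sN]]; have : P setT = 0%E.
  by rewrite -[RHS]N0; congr (P _); apply/seteqP; split => // w _; apply: sN.
by rewrite probability_setT => /eqP; rewrite onee_eq0.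
Qed.

(** The product of Z1 - Z2 and Z1 + Z2 vanishes. The sum has a positive constant term, so it is
    almost surely nonzero whether or not it has lags; hence Z1 = Z2. The difference, being zero, can
    have no nonzero lag coefficient, and then no constant term. *)
Lemma linear_process_abs_inj c1 c2 t Z1 Z2 : linear_process c1 t Z1 ->
  linear_process c2 t Z2 -> 0 < c1 0%N -> 0 < c2 0%N ->
  {ae P, forall w, `|Z1 w| = `|Z2 w|} -> c1 =1 c2.
Proof.
move=> h1 h2 p1 p2 E.
have hD := linear_processD (-1) h1 h2; have hS := linear_processD 1 h1 h2.
have EDS : {ae P, forall w, (Z1 w + -1 * Z2 w) * (Z1 w + 1 * Z2 w) = 0}.
  apply: filterS E => w E.
  have : Z1 w ^+ 2 = Z2 w ^+ 2 by rewrite -(real_normK (num_real (Z1 w))) E real_normK ?num_real.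
  by move=> E2; transitivity (Z1 w ^+ 2 - Z2 w ^+ 2); [ring|rewrite E2 subrr].
have S0 : {ae P, forall w, Z1 w + 1 * Z2 w != 0}.
  have [all0|] := pselect (forall k, (0 < k)%N -> c1 k + 1 * c2 k = 0).
    apply: filterS (linear_process_cst all0 hS) => w ->.
    by rewrite gt_eqF// mul1r addr_gt0.
  move=> /existsNP[k /not_implyP[k0 /eqP ck]].
  by apply: (linear_process_neq0 hS); exists k.
have D0 : {ae P, forall w, Z1 w + -1 * Z2 w = 0}.
  by apply: filterS2 EDS S0 => w /eqP; rewrite mulf_eq0 => /orP[/eqP//|->].
have Dall k : (0 < k)%N -> c1 k + -1 * c2 k = 0.
  move=> k0; apply: contrapT => /eqP ck; apply: ae_false.
  have := linear_process_neq0 hD (ex_intro2 _ _ k k0 ck).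
  by apply: filterS2 D0 => w ->; rewrite eqxx.
have c1c2 : c1 0%N + -1 * c2 0%N = 0.
  apply: contrapT => n0; apply: ae_false.
  by apply: filterS2 D0 (linear_process_cst Dall hD) => w -> /esym.
by move=> [|k]; [move: c1c2|have := Dall k.+1 isT]; lra.
Qed.

End linear_process.

(** * Excess of the limit contrast over its minimum *)

Section same_law.
Context d (T : measurableType d) (R : realType) (P : probability T R).

Lemma integral_same_law (U V : {RV P >-> R}) (f : R -> \bar R) :
  (forall B, measurable B -> P (U @^-1` B) = P (V @^-1` B)) ->
  measurable_fun setT f -> (forall x, 0 <= f x)%E ->
  (\int[P]_w f (U w) = \int[P]_w f (V w))%E.
Proof.
move=> UV mf f0; have := ge0_integral_distribution U mf f0.
rewrite /comp => <-; have := ge0_integral_distribution V mf f0; rewrite /comp => <-.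
by apply: eq_measure_integral => B mB _; exact: UV.
Qed.

End same_law.

Section contrast_gap.
Context d (T : measurableType d) (R : realType) (P : probability T R).
Variable xi : int -> {RV P >-> R}.
Hypothesis xi_indep : mutually_independent P xi.
Hypothesis xi_ident : identically_distributed P xi.
Hypothesis xi_abs : ('E_P[fun w => `|xi 0%R w|%R] = 1)%E.
Hypothesis xi_sq : ('E_P[fun w => (xi 0%R w ^+ 2)%R] < +oo)%E.

Lemma noise_sqr_integrable t : sqr_integrable P (xi t).
Proof.
split; first exact: measurable_funPT.
apply: ge0_rintegrable => [|w|]; [exact: measurable_funX|exact: sqr_ge0|].
move: xi_sq; rewrite unlock; apply: le_lt_trans; rewrite le_eqVlt; apply/orP; left; apply/eqP.
apply: (integral_same_law (U := xi t) (V := xi 0) (f := fun x => (x ^+ 2)%:E)).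
- by move=> B; exact: xi_ident.
- by apply/measurable_EFinP; exact: exprn_measurable.
- by move=> x; rewrite lee_fin sqr_ge0.
Qed.

Lemma Ex_noise_norm t : Ex P (fun w => `|xi t w|) = 1.
Proof.
rewrite /Ex /Rintegral (_ : (\int[P]_w _)%E = 1%E)//.
rewrite -[RHS]xi_abs unlock.
apply: (integral_same_law (U := xi t) (V := xi 0) (f := fun x => `|x|%:E)).
- by move=> B; exact: xi_ident.
- by apply/measurable_EFinP; exact: normr_measurable.
- by move=> x; rewrite lee_fin.
Qed.

Lemma Ex_noise_sqr t : Ex P (fun w => xi t w ^+ 2) = Ex P (fun w => xi 0 w ^+ 2).
Proof.
rewrite /Ex /Rintegral; congr fine.
apply: (integral_same_law (U := xi t) (V := xi 0) (f := fun x => (x ^+ 2)%:E)).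
- by move=> B; exact: xi_ident.
- by apply/measurable_EFinP; exact: exprn_measurable.
- by move=> x; rewrite lee_fin sqr_ge0.
Qed.

(* Conditionally on the past, |xi| has mean 1, so the cross term vanishes. *)
Lemma norm2_noise_mul_sub t (U V : T -> R) : past_measurable xi t U -> past_measurable xi t V ->
  sqr_integrable P (fun w => xi t w * U w) -> sqr_integrable P U -> sqr_integrable P V ->
  norm2 P (fun w => `|xi t w * U w| - `|V w|) ^+ 2 =
  (Ex P (fun w => xi 0 w ^+ 2) - 1) * norm2 P U ^+ 2 +
  norm2 P (fun w => `|U w| - `|V w|) ^+ 2.
Proof.
move=> mU mV xUi Ui Vi; set s := Ex P _.
have UVi : sqr_integrable P (fun w => `|U w| - `|V w|).
  by apply: sqr_integrableB; exact: sqr_integrable_norm.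
have LHSi : sqr_integrable P (fun w => `|xi t w * U w| - `|V w|).
  by apply: sqr_integrableB; exact: sqr_integrable_norm.
rewrite !norm2_sqr -ExZ; last by case: Ui.
rewrite -ExD; [|by apply: rintegrableZ; case: Ui|by case: UVi].
apply: EFin_inj; rewrite !EFin_Ex; last first.
- by case: LHSi.
- by apply: rintegrableD; [apply: rintegrableZ; case: Ui|case: UVi].
pose f (z : R * past_space xi t) := ((`|z.1 * U z.2| - `|V z.2|) ^+ 2)%:E.
have mU2 : measurable_fun setT (fun z : R * past_space xi t => U z.2) := measurableT_comp mU measurable_snd.
have mV2 : measurable_fun setT (fun z : R * past_space xi t => V z.2) := measurableT_comp mV measurable_snd.
have mf : measurable_fun setT f.
  apply/measurable_EFinP; apply: measurable_funX; apply: measurable_funB.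
    by apply: measurableT_comp => //; apply: measurable_funM => //; exact: measurable_fst.
  by apply: measurableT_comp.
have f0 z : (0 <= f z)%E by rewrite lee_fin sqr_ge0.
rewrite (tonelli_noise_past xi_indep mf f0); apply: eq_integral => w _.
have x2 := noise_sqr_integrable t.
have x2i : rintegrable P (fun v => xi t v ^+ 2) by case: x2.
have xi1 : rintegrable P (fun v => `|xi t v|) := rintegrable_norm (sqr_integrable_rintegrable x2).
rewrite /f /= -EFin_Ex; last first.
  have [] : sqr_integrable P (fun v => `|xi t v * U w| - `|V w|); last by [].
  apply: sqr_integrableB; last exact: sqr_integrable_cst.
  apply: sqr_integrable_norm; have := sqr_integrableZ (U w) x2.
  by under eq_fun do rewrite mulrC.
congr EFin.
rewrite (_ : (fun v => _) = (fun v => (U w ^+ 2 * xi t v ^+ 2 - (2 * `|U w| * `|V w|) * `|xi t v|) + `|V w| ^+ 2)); last first.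
  apply/funext => v; rewrite normrM -[in RHS](real_normK (num_real (U w))).
  by rewrite -[in RHS](real_normK (num_real (xi t v))); ring.
rewrite ExD; [|by apply: rintegrableB; exact: rintegrableZ|exact: (rintegrable_cst P (`|V w| ^+ 2))].
rewrite ExB; [|exact: rintegrableZ..].
rewrite (ExZ (U w ^+ 2) x2i) (ExZ (2 * `|U w| * `|V w|) xi1) Ex_noise_sqr Ex_noise_norm -/s.
rewrite (_ : Ex P (fun=> `|V w| ^+ 2) = `|V w| ^+ 2); last exact: Ex_cst.
by rewrite -(real_normK (num_real (U w))); ring.
Qed.

End contrast_gap.

(** * Locally uniform convergence of the empirical fit *)

Section empirical_contrast.
Context d (T : measurableType d) (R : realType) (P : probability T R).
Variable X : int -> {RV P >-> R}.
Hypothesis X_sqr : forall t, sqr_integrable P (X t).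
Hypothesis X_stat : strictly_stationary P X.
Hypothesis X_erg : ergodic P X.

(* Time is shifted by one: [observed_linear c t] predicts X (t + 1) from
   X 1, ..., X t. *)
Definition observed_linear (c : nat -> R) (t : nat) (w : T) : R :=
  c 0%N + \sum_(1 <= k < t.+1) c k * X ((t - k)%:Z + 1) w.

Definition empirical_fit (n : nat) (c : nat -> R) (w : T) : R :=
  rms n (fun t => `|X (t%:Z + 1) w| - `|observed_linear c t w|).

Definition fit (c : nat -> R) (K : nat) : R :=
  norm2 P (fun w => `|X 1 w| - `|partial_linear X c K 1 w|).

Lemma cvg_sqrt (u : nat -> R) (a : R) : (forall n, 0 <= u n) -> 0 <= a ->
  u n ^+ 2 @[n --> \oo] --> a ^+ 2 -> u n @[n --> \oo] --> a.
Proof.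
move=> u0 a0 h.
have := cvg_comp _ _ h (@sqrt_continuous R (a ^+ 2)).
rewrite sqrtr_sqr ger0_norm// => {}h; apply: cvg_trans h; apply: near_eq_cvg.
by apply: nearW => n; rewrite /= sqrtr_sqr ger0_norm.
Qed.

(** Birkhoff's theorem applies to the predictor that reads all [K] lags. The observed predictor
    drops the values before time 1 and differs from it only for [t < K]; this fixed error has
    empirical norm of order n^(-1/2). *)
Lemma empirical_fit_cvg (c : nat -> R) K : (forall k, (K < k)%N -> c k = 0) ->
  {ae P, forall w, empirical_fit n c w @[n --> \oo] --> fit c K}.
Proof.
move=> cK.
pose L (x : @path_space R int) := c 0%N + \sum_(1 <= k < K.+1) c k * x (1 - k%:Z).
pose f (x : @path_space R int) := (`|x 1| - `|L x|) ^+ 2.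
have mL : measurable_fun setT L.
  apply: measurable_funD; first exact: measurable_cst.
  apply: measurable_sum => k; apply: measurable_funM; first exact: measurable_cst.
  exact: measurable_coordinate.
have mf : measurable_fun setT f.
  apply: measurable_funX; apply: measurable_funB; last exact: measurableT_comp.
  by apply: measurableT_comp => //; exact: measurable_coordinate.
have Li : sqr_integrable P (partial_linear X c K 1) by exact: partial_linear_sqr.
have fi : rintegrable P (f \o path_of X).
  have [] : sqr_integrable P (fun w => `|X 1 w| - `|partial_linear X c K 1 w|); last by [].
  by apply: sqr_integrableB; exact: sqr_integrable_norm.
apply: filterS (process_birkhoff X_stat X_erg mf fi) => w hw.
pose full t := partial_linear X c K (t%:Z + 1) w.
have full_cvg : rms n (fun t => `|X (t%:Z + 1) w| - `|full t|) @[n --> \oo] --> fit c K.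
  apply: cvg_sqrt; [by move=> n; exact: rms_ge0|exact: norm2_ge0|].
  rewrite norm2_sqr; apply: cvg_trans hw; apply: near_eq_cvg; apply: nearW => n.
  rewrite [RHS]rms_sqr [RHS]mulrC; congr (_ * _); apply: eq_bigr => t _.
  rewrite /f /L /full /partial_linear /shift_by /path_of /sample_path/= (addrC 1).
  congr ((_ - `|_ + _|) ^+ 2); apply: eq_bigr => k _; congr (_ * X _ w); lia.
pose D t := if (t < K)%N then observed_linear c t w - full t else 0.
have obsE t : observed_linear c t w - full t = D t.
  rewrite /D; case: ltnP => // Kt; rewrite /observed_linear /full /partial_linear.
  rewrite opprD addrACA subrr add0r (big_cat_nat _ (n := K.+1))//=.
  rewrite [X in _ + X - _]big_nat [X in _ + X - _]big1 ?addr0; last first.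
    by move=> k /andP[Kk _]; rewrite cK ?mul0r.
  apply/eqP; rewrite subr_eq0; apply/eqP; rewrite !big_nat; apply: eq_bigr => k /andP[_ kK].
  by congr (_ * X _ w); lia.
have D_cvg : rms n D @[n --> \oo] --> 0.
  apply: cvg_sqrt; [by move=> n; exact: rms_ge0|by []|].
  pose S := \sum_(t < K) D t ^+ 2.
  have hS : n%:R^-1 * S @[n --> \oo] --> 0 * S.
    apply: cvgM; last exact: cvg_cst.
    by rewrite -cvg_shiftS; exact: cvg_harmonic.
  rewrite mul0r in hS; rewrite expr0n/=.
  apply: (squeeze_cvgr _ (cvg_cst 0) hS); apply: nearW => n; rewrite sqr_ge0/= rms_sqr.
  apply: ler_wpM2l; first by rewrite invr_ge0.
  rewrite /S -!(big_mkord xpredT (fun t => D t ^+ 2)).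
  have [nK|Kn] := leqP n K.
    by rewrite (big_cat_nat _ nK)//= lerDl sumr_ge0// => t _; exact: sqr_ge0.
  rewrite (big_cat_nat _ (ltnW Kn))//= [X in _ + X]big_nat [X in _ + X]big1 ?addr0//.
  by move=> t /andP[Kt _]; rewrite /D ltnNge Kt expr0n.
have close n : `|empirical_fit n c w - rms n (fun t => `|X (t%:Z + 1) w| - `|full t|)| <= rms n D.
  have dist t : `|(`|X (t%:Z + 1) w| - `|observed_linear c t w|) - (`|X (t%:Z + 1) w| - `|full t|)| <= `|D t|.
    rewrite -obsE [X in `|X| <= _](_ : _ = `|full t| - `|observed_linear c t w|); last ring.
    by rewrite distrC; exact: ler_dist_dist.
  exact: ler_rms_dist.
have h1 : rms n (fun t => `|X (t%:Z + 1) w| - `|full t|) - rms n D @[n --> \oo] --> fit c K - 0.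
  by apply: cvgB.
have h2 : rms n (fun t => `|X (t%:Z + 1) w| - `|full t|) + rms n D @[n --> \oo] --> fit c K + 0.
  by apply: cvgD.
rewrite subr0 in h1; rewrite addr0 in h2.
apply: (squeeze_cvgr _ h1 h2); apply: nearW => n.
by have := close n; rewrite ler_distl.
Qed.

Definition rational_seq (l : seq rat) (k : nat) : R := ratr (nth 0 l k).

Lemma ae_forall_countable (I : countType) (Q : I -> T -> Prop) :
  (forall i, {ae P, forall w, Q i w}) -> {ae P, forall w, forall i, Q i w}.
Proof.
move=> h; have : {ae P, forall w, forall n : nat, forall i : I, unpickle n = Some i -> Q i w}.
  apply: ae_foralln => n; case: (unpickle n) => [i|]; last exact: aeW.
  by apply: filterS (h i) => w Qw j [<-].
by apply: filterS => w hw i; apply: (hw (pickle i)); rewrite pickleK.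
Qed.

Lemma rational_fit_cvg : {ae P, forall w, forall l : seq rat,
  empirical_fit n (rational_seq l) w @[n --> \oo] --> fit (rational_seq l) (size l).-1}.
Proof.
apply: ae_forall_countable => l; apply: empirical_fit_cvg => k lk.
(* A list of size s holds the constant at index 0 and the lags 1 to s - 1; the default value 0 fills
   the rest. *)
have {}lk : (size l <= k)%N by move: lk; case: (size l).
by rewrite /rational_seq nth_default// raddf0.
Qed.

Lemma rational_approx (c : nat -> R) K del : 0 < del ->
  exists2 l : seq rat, size l = K & \sum_(k < K) `|rational_seq l k - c k| <= del.
Proof.
move=> del0; have e0 : 0 < del / K.+1%:R by rewrite divr_gt0.
have ex k : exists q : rat, `|ratr q - c k| <= del / K.+1%:R.
  have /rat_in_itvoo[q] : c k - del / K.+1%:R < c k by rewrite ltrBlDr ltrDl.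
  rewrite in_itv/= => /andP[q1 q2]; exists q; rewrite ler_distl (ltW q1)/=.
  by rewrite (le_trans (ltW q2))// lerDl ltW.
have [g hg] := choice ex; exists (mkseq g K); first by rewrite size_mkseq.
apply: (@le_trans _ _ (\sum_(k < K) del / K.+1%:R)).
  by apply: ler_sum => k _; rewrite /rational_seq nth_mkseq.
rewrite sumr_const card_ord -[_ *+ K]mulr_natl mulrCA; apply: ler_piMr; first exact: ltW.
by rewrite ler_pdivrMr// mul1r ler_nat.
Qed.

Lemma contrast_empirical_fit l (a : nat -> 'rV[R]_l -> R) n w th :
  contrast a X n w th = empirical_fit n (fun k => a k th) w ^+ 2.
Proof.
rewrite /contrast rms_sqr big_add1 big_mkord; congr (_ * _); apply: eq_bigr => t _.
have tE : t.+1%:Z = t%:Z + 1 by rewrite -addn1 PoszD.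
rewrite tE /observed_linear; congr ((_ - `|_ + _|) ^+ 2).
rewrite !big_nat; apply: eq_bigr => k /andP[_ kt]; congr (_ * X _ w).
by rewrite -subzn// addrAC.
Qed.

Lemma ler_empirical_fit n (c1 c2 : nat -> R) w :
  `|empirical_fit n c1 w - empirical_fit n c2 w| <=
  rms n (fun t => observed_linear c1 t w - observed_linear c2 t w).
Proof.
apply: ler_rms_dist => t; rewrite [X in `|X|](_ : _ = `|observed_linear c2 t w| - `|observed_linear c1 t w|).
  by rewrite distrC; exact: ler_dist_dist.
ring.
Qed.

(** Each lag below [K] contributes its coefficient gap times a shifted, zero-filled copy of [X],
    whose empirical norm does not exceed that of [X]; the term 1 pays for the constant coefficient.
    From [K] on only [c1] is left, a remainder of the kind that [process_tail] bounds. *)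
Lemma observed_linear_sub_le n K (c1 c2 : nat -> R) w : (0 < K)%N ->
  (forall k, (K <= k)%N -> c2 k = 0) ->
  rms n (fun t => observed_linear c1 t w - observed_linear c2 t w) <=
  (\sum_(k < K) `|c1 k - c2 k|) * (1 + rms n (fun t => X (t%:Z + 1) w)) +
  rms n (fun t => \sum_(K <= k < t.+1) c1 k * X ((t - k)%:Z + 1) w).
Proof.
move=> K0 c2K; set z := fun t : nat => X (t%:Z + 1) w.
pose y k t := (c1 k - c2 k) * (if k is 0 then 1 else if (k <= t)%N then z (t - k)%N else 0).
rewrite (@eq_rms _ n _ (fun t => \sum_(k < K) y k t + \sum_(K <= k < t.+1) c1 k * z (t - k)%N)); last first.
  move=> t _.
  have obsE c : observed_linear c t w = \sum_(0 <= k < t.+1) c k * (if k is 0 then 1 else z (t - k)%N).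
    rewrite big_ltn// mulr1; congr (_ + _); rewrite !big_nat; apply: eq_bigr => -[|k]//.
  rewrite !obsE -sumrB; under eq_bigr do rewrite -mulrBl.
  rewrite -(big_mkord xpredT (fun k => y k t)).
  have yE k : (k <= t)%N -> (c1 k - c2 k) * (if k is 0 then 1 else z (t - k)%N) = y k t.
    by case: k => // k kt; rewrite /y kt.
  have [tK|Kt] := leqP t.+1 K.
    rewrite [X in _ = _ + X]big_geq// addr0 [RHS](big_cat_nat _ tK)//=.
    rewrite [X in _ = _ + X]big_nat [X in _ = _ + X]big1 ?addr0.
      by rewrite !big_nat; apply: eq_bigr => k /andP[_ kt]; exact: yE.
    by case=> // k /andP[tk _]; rewrite /y leqNgt tk mulr0.
  rewrite (big_cat_nat _ (ltnW Kt))//=; congr (_ + _); rewrite !big_nat; apply: eq_bigr.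
    by move=> k /andP[_ kK]; apply: yE; rewrite -ltnS (ltn_trans kK).
  case=> [|k] /andP[Kk _]; first by move: Kk; rewrite leqNgt K0.
  by rewrite c2K// subr0.
apply: le_trans (ler_rmsD _ _ _) _; rewrite lerD2r.
apply: le_trans (ler_rms_sum _ _ _) _; rewrite mulr_suml; apply: ler_sum => k _.
rewrite /y rmsZ; apply: ler_wpM2l => //; case: (nat_of_ord k) => [|k'].
  by apply: le_trans (rms_cst_le _ _) _; rewrite normr1 lerDl rms_ge0.
by apply: le_trans (ler_rms_shift _ _ _) _; rewrite lerDr.
Qed.

Variable sigma : R.
Hypothesis norm2_X : forall t, norm2 P (X t) = sigma.

(** Counterpart in L^2 of the head estimate, with [sigma] in place of the empirical norm of [X]. *)
Lemma norm2_partial_linear_sub_le K (c1 c2 : nat -> R) : (0 < K)%N ->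
  norm2 P (fun w => partial_linear X c1 K.-1 1 w - partial_linear X c2 K.-1 1 w) <=
  (\sum_(k < K) `|c1 k - c2 k|) * (1 + sigma).
Proof.
case: K => // K _; have s0 : 0 <= sigma by rewrite -(norm2_X 0) norm2_ge0.
pose y k w := (c1 k - c2 k) * (if k is 0 then 1 else X (1 - k%:Z) w).
have yi k : sqr_integrable P (y k).
  by case: k => [|k]; apply: sqr_integrableZ; [exact: (sqr_integrable_cst P 1)|exact: X_sqr].
rewrite (_ : (fun w => _) = (fun w => \sum_(k <- index_iota 0 K.+1) y k w)); last first.
  apply/funext => w; rewrite big_ltn// /partial_linear opprD addrACA -sumrB /y mulr1.
  congr (_ + _); rewrite !big_nat; apply: eq_bigr => -[|k]// _; by rewrite mulrBl.
apply: le_trans (ler_norm2_sum _ yi) _; rewrite big_mkord mulr_suml; apply: ler_sum => k _.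
case: (nat_of_ord k) => [|k']; rewrite /y.
  rewrite (norm2Z _ (sqr_integrable_cst P 1)) norm2_cst normr1.
  by apply: ler_wpM2l => //; rewrite lerDl.
by rewrite norm2Z// norm2_X; apply: ler_wpM2l => //; rewrite lerDr.
Qed.

Variables (q B : R).
Hypothesis B_ge0 : 0 <= B.

Definition dyadic_bounded (c : nat -> R) :=
  forall j, \sum_(2 ^ j <= k < 2 ^ j.+1) c k ^+ 2 <= B ^+ 2 * q ^+ j.

(** A chain of comparisons: [c'] with a rational list on the first [K] coefficients, up to the tail
    of [c']; the empirical fit of the list with its limit; the list with [c] truncated; the
    truncation with [Z]. The conditions on n involve the list and [X] only, so they are uniform in
    [c']. *)
Lemma empirical_fit_equicvg w :
  (forall l : seq rat, empirical_fit n (rational_seq l) w @[n --> \oo] -->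
     fit (rational_seq l) (size l).-1) ->
  (forall eps, 0 < eps -> exists J1, forall J, (J1 <= J)%N ->
     forall (b : nat -> R) C, 0 <= C ->
    (forall j, \sum_(2 ^ j <= k < 2 ^ j.+1) b k ^+ 2 <= C ^+ 2 * q ^+ j) ->
    forall n, rms n (fun t => \sum_(2 ^ J <= k < t.+1) b k * X ((t - k)%:Z + 1) w)
      <= eps * C) ->
  forall (c : nat -> R) (Z : T -> R), linear_process X c 1 Z ->
  forall eps, 0 < eps -> exists del K, 0 < del /\
    \forall n \near \oo, forall c', dyadic_bounded c' ->
      \sum_(k < K) `|c' k - c k| <= del ->
      `|empirical_fit n c' w - norm2 P (fun w => `|X 1 w| - `|Z w|)| <= eps.
Proof.
move=> lln tail c Z [Zi hZ] eps eps0.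
have s0 : 0 <= sigma by rewrite -(norm2_X 0) norm2_ge0.
(* [B] may be zero, hence B + 1 in the divisor; the tail of [c'] then costs at most eps / 4. *)
have B1 : 0 < 4 * (B + 1) by rewrite mulr_gt0// ltr_wpDl.
have [J0 hJ0] := tail (eps / (4 * (B + 1))) (divr_gt0 eps0 B1).
have e4 : 0 < eps / 4 by rewrite divr_gt0.
have [M0 _ hM0] := (cvgrPdist_le _ _).1 hZ _ e4.
pose J := maxn J0 M0; pose K := (2 ^ J)%N.
have K0 : (0 < K)%N by rewrite expn_gt0.
have M0K : (M0 <= K.-1)%N.
  by rewrite -ltnS prednK// (leq_ltn_trans (leq_maxr J0 M0))// ltn_expl.
have W0 : 0 < 16 * (2 + sigma) by rewrite mulr_gt0// ltr_wpDr.
(* The head costs 2 del (2 + sigma) = eps / 8 empirically and del (2 + sigma) = eps / 16 in the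
   limit. With eps / 8 for the law of large numbers and eps / 4 for each of the two tails, the total
   is 13 eps / 16. *)
pose del := eps / (16 * (2 + sigma)).
have del0 : 0 < del by rewrite divr_gt0.
have [l sl hl] := rational_approx c K del0.
have lK k : (K <= k)%N -> rational_seq l k = 0.
  by move=> Kk; rewrite /rational_seq nth_default ?sl// raddf0.
(* The empty list predicts zero, so its convergence is that of the empirical norm of [X] itself. *)
have rms_X : rms n (fun t => X (t%:Z + 1) w) @[n --> \oo] --> sigma.
  have := lln [::]; rewrite (_ : fit _ _ = sigma).
    apply: cvg_trans; apply: near_eq_cvg; apply: nearW => n; rewrite /empirical_fit.
    have r0 : rational_seq [::] = fun=> 0.
      by apply/funext => k; rewrite /rational_seq nth_nil raddf0.
    have o0 t : observed_linear (rational_seq [::]) t w = 0.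
      by rewrite /observed_linear r0 big1 ?addr0// => k _; rewrite mul0r.
    apply/eqP; rewrite eq_le; apply/andP; split; apply: ler_rms => t _;
      by rewrite o0 normr0 subr0 normr_id.
  rewrite -(norm2_X 1) /fit /norm2; congr (Num.sqrt (Ex P _)); apply/funext => v.
  rewrite /partial_linear /= big_geq// addr0 /rational_seq nth_nil raddf0 normr0 subr0.
  by rewrite real_normK// num_real.
exists del, K; split=> //.
have e8 : 0 < eps / 8 by rewrite divr_gt0.
have sub1 : \forall n \near \oo, `|fit (rational_seq l) (size l).-1 - empirical_fit n (rational_seq l) w| <= eps / 8.
  exact: ((cvgrPdist_le _ _).1 (lln l) _ e8).
have sub2 : \forall n \near \oo, `|sigma - rms n (fun t => X (t%:Z + 1) w)| <= 1.
  exact: ((cvgrPdist_le _ _).1 rms_X _ ltr01).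
apply: filterS2 sub1 sub2 => n h1 h2 c' hc' c'c.
have T1 : `|empirical_fit n c' w - empirical_fit n (rational_seq l) w| <= eps / 8 + eps / 4.
  apply: le_trans (ler_empirical_fit _ _ _ _) _.
  apply: le_trans (observed_linear_sub_le n c' w K0 lK) _; apply: lerD.
    have S2 : \sum_(k < K) `|c' k - rational_seq l k| <= 2 * del.
      apply: (@le_trans _ _ (\sum_(k < K) (`|c' k - c k| + `|rational_seq l k - c k|))).
        by apply: ler_sum => k _; rewrite (distrC (rational_seq l k)); exact: ler_distD.
      by rewrite big_split/= mulr_natl mulr2n lerD.
    have r2 : 1 + rms n (fun t => X (t%:Z + 1) w) <= 2 + sigma.
      move: h2; rewrite ler_distl lerBlDr => /andP[h2 _].
      by rewrite (_ : 2 + sigma = 1 + (sigma + 1)) ?lerD2l//; ring.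
    apply: (@le_trans _ _ (2 * del * (2 + sigma))).
      by apply: ler_pM => //; [apply: sumr_ge0|rewrite addr_ge0 ?rms_ge0].
    rewrite le_eqVlt; apply/orP; left; apply/eqP; rewrite /del; field.
    by rewrite gt_eqF// ltr_wpDr.
  apply: le_trans (hJ0 J (leq_maxl _ _) c' B B_ge0 hc' n) _.
  rewrite invfM mulrA -mulrA; apply: ler_piMr; first exact: ltW.
  by rewrite mulrC ler_pdivrMr ?ltr_wpDl// mul1r lerDl.
have T3 : `|fit (rational_seq l) (size l).-1 - norm2 P (fun w => `|X 1 w| - `|Z w|)| <= eps / 16 + eps / 4.
  rewrite sl; have pi c1 := partial_linear_sqr X_sqr c1 K.-1 1.
  have hi : sqr_integrable P (fun v => partial_linear X (rational_seq l) K.-1 1 v - Z v).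
    exact: sqr_integrableB.
  apply: le_trans (ler_norm2_dist _ _ hi _) _.
  - by apply: sqr_integrableB; exact: sqr_integrable_norm.
  - by apply: sqr_integrableB; exact: sqr_integrable_norm.
  - move=> v; rewrite [X in `|X| <= _](_ : _ = `|Z v| - `|partial_linear X (rational_seq l) K.-1 1 v|); last ring.
    by rewrite distrC; exact: ler_dist_dist.
  have D1 := sqr_integrableB (pi (rational_seq l)) (pi c).
  have D2 := sqr_integrableB (pi c) Zi.
  apply: (@le_trans _ _ (norm2 P (fun v => (partial_linear X (rational_seq l) K.-1 1 v -
     partial_linear X c K.-1 1 v) + (partial_linear X c K.-1 1 v - Z v)))).
    by apply: ler_norm2 => //; [exact: sqr_integrableD|move=> v; rewrite addrA subrK].
  apply: le_trans (ler_norm2D D1 D2) _; apply: lerD; last first.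
    by have := hM0 _ M0K; rewrite sub0r normrN ger0_norm// norm2_ge0.
  apply: le_trans (norm2_partial_linear_sub_le _ _ K0) _.
  apply: (@le_trans _ _ (del * (2 + sigma))).
    by apply: ler_pM => //; [apply: sumr_ge0|rewrite addr_ge0|rewrite lerD2r ler1n].
  rewrite le_eqVlt; apply/orP; left; apply/eqP; rewrite /del; field.
  by rewrite gt_eqF// ltr_wpDr.
move: h1; rewrite distrC => h1.
have := ler_distD (empirical_fit n (rational_seq l) w) (empirical_fit n c' w) (norm2 P (fun w => `|X 1 w| - `|Z w|)).
have := ler_distD (fit (rational_seq l) (size l).-1) (empirical_fit n (rational_seq l) w) (norm2 P (fun w => `|X 1 w| - `|Z w|)).
move: h1 T1 T3.
move: (`|_ - _|) (`|_ - _|) (`|_ - _|) (`|_ - _|) (`|_ - _|) => a1 a2 a3 a4 a5; lra.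
Qed.

End empirical_contrast.

(** * Dyadic decay of the coefficients *)

Section coefficient_decay.
Context {R : realType}.

Lemma norm_partials0_ge l (f : 'rV[R]_l -> R) th : `|f th| <= norm_partials 0 f th.
Proof.
rewrite -sqrtr_sqr; apply: ler_wsqrtr.
rewrite (bigD1 [tuple])//= lerDl; apply: sumr_ge0 => s _; exact: sqr_ge0.
Qed.

Lemma assumption_C_decay l i (Theta : set 'rV[R]_l) (a : nat -> 'rV[R]_l -> R) :
  assumption_C i Theta a -> exists Ca dbar : R, [/\ 0 < Ca, dbar < 1 / 2 &
    forall k th, (0 < k)%N -> Theta th -> `|a k th| <= Ca * (k%:R `^ (dbar - 1))].
Proof.
move=> [b [ba _ [Ca [dbar [Ca0 d12 hb]]]]]; exists Ca, dbar; split => // k th k0 Tth.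
rewrite -ba//; apply: le_trans (norm_partials0_ge _ _) _.
rewrite -lee_fin; apply: le_trans (hb k k0).
apply: (@le_trans _ _ (\sum_(j < i.+1) norm_partials j (b k) th)%:E).
  rewrite lee_fin big_ord_recl/= lerDl; apply: sumr_ge0 => j _; exact: sqrtr_ge0.
by apply: ereal_sup_ubound; exists th.
Qed.

(** Block j has 2^j lags, each with square at most (Ca x^j)^2, which dictates q = 2 x^2 = 2^(2 dbar
    - 1); it is below 1 because dbar < 1/2. *)
Lemma powR_decay_dyadic (Ca dbar : R) : 0 < Ca -> dbar < 1 / 2 ->
  exists q, 0 <= q < 1 /\ forall c : nat -> R,
    (forall k, (0 < k)%N -> `|c k| <= Ca * (k%:R `^ (dbar - 1))) ->
    dyadic_bounded q Ca c.
Proof.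
move=> Ca0 d12; pose x : R := 2 `^ (dbar - 1); exists (2 * x ^+ 2).
have x0 : 0 < x by rewrite powR_gt0.
split.
  rewrite mulr_ge0 ?sqr_ge0//=.
  have -> : 2 * x ^+ 2 = 2 `^ (2 * dbar - 1).
    have {1}-> : 2 = 2 `^ 1 :> R by rewrite powRr1.
    rewrite -powR_mulrn ?powR_ge0// -powRrM -powRD; last by rewrite pnatr_eq0 implybT.
    by congr (_ `^ _); ring.
  have -> : 2 * dbar - 1 = - (1 - 2 * dbar) by ring.
  rewrite powRN invf_lt1 ?powR_gt0//.
  have e0 : 0 < 1 - 2 * dbar by lra.
  have : 1 `^ (1 - 2 * dbar) < 2 `^ (1 - 2 * dbar).
    by apply: gt0_ltr_powR; rewrite ?nnegrE// ltr1n.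
  by rewrite powR1.
move=> c hc j.
have pow k : (2 ^ j <= k)%N -> k%:R `^ (dbar - 1) <= x ^+ j.
  move=> jk; have k0 : (0 < k)%N by apply: leq_trans jk; rewrite expn_gt0.
  have -> : x ^+ j = ((2 ^ j)%:R) `^ (dbar - 1).
    by rewrite natrX -(powR_mulrn j (ltW x0)) -powRrM -(powR_mulrn j (ler0n R 2)) -powRrM mulrC.
  have -> : dbar - 1 = - (1 - dbar) by ring.
  rewrite !powRN lef_pV2 ?posrE ?powR_gt0 ?ltr0n ?expn_gt0//.
  by apply: ge0_ler_powR; rewrite ?nnegrE ?ler0n ?ler_nat//; lra.
apply: (@le_trans _ _ (\sum_(2 ^ j <= k < 2 ^ j.+1) (Ca * x ^+ j) ^+ 2)).
  rewrite !big_nat; apply: ler_sum => k /andP[jk _].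
  have k0 : (0 < k)%N by apply: leq_trans jk; rewrite expn_gt0.
  rewrite -(real_normK (num_real (c k))) ler_pXn2r ?nnegrE ?normr_ge0 ?mulr_ge0 ?exprn_ge0 ?(ltW x0) ?(ltW Ca0)//.
  by apply: le_trans (hc k k0) _; apply: ler_wpM2l; [exact: ltW|exact: pow].
rewrite sumr_const_nat expnS mul2n -addnn addnK -[_ *+ _]mulr_natl natrX.
by rewrite (exprMn _ Ca) (exprMn _ 2) -(exprM x j 2) -(exprM x 2 j) (mulnC j 2) mulrCA.
Qed.

End coefficient_decay.

Theorem proposition3p1
  (R : realType) (d : measure_display) (T : measurableType d)
  (P : probability T R)
  (l : nat) (hl : (1 <= l)%N)
  (xi : int -> {RV P >-> R})
  (xi_indep : mutually_independent P xi)
  (xi_ident : identically_distributed P xi)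
  (xi_sym : symmetric_distribution P (xi 0))
  (xi_centered : ('E_P[xi 0%R] = 0)%E)
  (xi_cont : continuous (cdf (xi 0 : {RV P >-> R})))
  (xi_abs : ('E_P[fun w => `|xi 0%R w|%R] = 1)%E)
  (xi_sq : ('E_P[fun w => (xi 0%R w ^+ 2)%R] < +oo)%E)
  (a : nat -> 'rV[R]_l -> R)
  (a_cont : forall j, continuous (a j))
  (a0_gt0 : forall th, 0 < a 0%N th)
  (Theta : set 'rV[R]_l)
  (Theta_compact : compact Theta)
  (Theta_sub : Theta `<=` Theta2 P a (xi 0))
  (thstar : 'rV[R]_l) (thstar_in : Theta thstar)
  (X : int -> {RV P >-> R})
  (X_sol : larch_solution P a xi X thstar)
  (X_stat : strictly_stationary P X)
  (X_erg : ergodic P X)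
  (X_causal : causal P xi X)
  (X_sq : ('E_P[fun w => (X 0%R w ^+ 2)%R] < +oo)%E)
  (M : 'rV[R]_l -> int -> {RV P >-> R})
  (M_def : forall th t, Theta th -> is_M P a X th t (M th t))
  (hC : assumption_C l Theta a)
  (hS : forall t : int, separable_process P Theta (fun th => M th t))
  (hId : assumption_Id Theta a)
  (thhat : nat -> T -> 'rV[R]_l)
  (thhat_min : forall (n : nat) (w : T), (1 <= n)%N ->
     minimizer_on Theta (contrast a X n w) (thhat n w)) :
  {ae P, forall w, thhat n w @[n --> \oo] --> thstar}.
Proof.
have X_past : forall s t, s < t -> past_measurable xi t (X s).
  by move=> s t; exact: past_measurable_causal.
have X_same (f : R -> \bar R) t : measurable_fun setT f -> (forall x, (0 <= f x)%E) ->
    (\int[P]_w f (X t w) = \int[P]_w f (X 0%R w))%E.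
  by apply: integral_same_law => A mA; exact: stationary_marginal.
have msq : measurable_fun setT (fun x : R => (x ^+ 2)%:E).
  by apply/measurable_EFinP; exact: exprn_measurable.
have sq0 (x : R) : (0 <= (x ^+ 2)%:E)%E by rewrite lee_fin sqr_ge0.
have X_sqr t : sqr_integrable P (X t).
  split; first exact: measurable_funPT.
  apply: ge0_rintegrable => [|w|]; [exact: measurable_funX|exact: sqr_ge0|].
  by move: X_sq; rewrite unlock (X_same _ t msq sq0).
have Ex_X_sqr t : Ex P (fun w => X t w ^+ 2) = Ex P (fun w => X 0 w ^+ 2).
  by rewrite /Ex /Rintegral (X_same _ t msq sq0).
have norm2_X t : norm2 P (X t) = norm2 P (X 0) by rewrite /norm2 Ex_X_sqr.
have is_M_linear th t (Z : {RV P >-> R}) : is_M P a X th t Z ->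
    linear_process X (fun k => a k th) t Z.
  move=> MZ; apply: (cvg_L2_norm2 _ _ MZ) => [n|]; last exact: measurable_funPT.
  exact: (partial_linear_sqr X_sqr (fun k => a k th) n t).
have exY t : exists Y : {RV P >-> R},
    is_M P a X thstar t Y /\ {ae P, forall w, X t w = xi t w * Y w}.
  by have [Y h1 h2] := X_sol t; exists Y.
have [Y hY] := choice exY.
pose c0 k := a k thstar.
have XE t : {ae P, forall w, X t w = xi t w * Y t w} by case: (hY t).
have Y_linear t : linear_process X c0 t (Y t) by apply: is_M_linear; case: (hY t).
have Y_past t : past_measurable xi t (Y t) by exact: linear_process_past (Y_linear t).
have [Ca [dbar [Ca0 d12 decay]]] := assumption_C_decay hC.
have [q [q01 dyadic]] := powR_decay_dyadic Ca0 d12.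
have bounded th : Theta th -> dyadic_bounded q Ca (fun k => a k th).
  by move=> Tth; apply: dyadic => k k0; exact: decay.
have gap th : Theta th -> th <> thstar ->
    norm2 P (fun w => `|X 1 w| - `|M thstar 1 w|) < norm2 P (fun w => `|X 1 w| - `|M th 1 w|).
  move=> Tth thn.
  have Ml t' : Theta t' -> linear_process X (fun k => a k t') 1 (M t' 1).
    by move=> Tt'; apply: is_M_linear; exact: M_def.
  have Mp t' : Theta t' -> past_measurable xi 1 (M t' 1).
    by move=> Tt'; exact: linear_process_past (Ml t' Tt').
  have [Yi _] := Y_linear 1.
  have mxY : measurable_fun setT (fun w => xi 1 w * Y 1 w).
    by apply: measurable_funM; exact: measurable_funPT.
  have xYi : sqr_integrable P (fun w => xi 1 w * Y 1 w).
    split => //; have [_] := X_sqr 1; apply: ae_eq_rintegrable; first exact: measurable_funX.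
    by apply: filterS (XE 1) => w ->.
  (* The noise contributes the same first term for every parameter, so only the distance between |Y|
     and |M| tells parameters apart. *)
  have NE t' : Theta t' -> norm2 P (fun w => `|X 1 w| - `|M t' 1 w|) ^+ 2 =
      (Ex P (fun w => xi 0 w ^+ 2) - 1) * norm2 P (Y 1) ^+ 2 +
      norm2 P (fun w => `|Y 1 w| - `|M t' 1 w|) ^+ 2.
    move=> Tt'; have [Mi _] := Ml t' Tt'.
    rewrite -(norm2_noise_mul_sub xi_indep xi_ident xi_abs xi_sq (Y_past 1) (Mp t' Tt') xYi Yi Mi).
    congr (_ ^+ 2); congr Num.sqrt; apply: ae_eq_Ex.
    - apply: measurable_funX; apply: measurable_funB; apply: measurableT_comp => //;
        exact: measurable_funPT.
    - apply: measurable_funX; apply: measurable_funB; apply: measurableT_comp => //.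
    - by apply: filterS (XE 1) => w ->.
  (* [Y 1] and [M thstar 1] are L^2 limits of the same series, so their difference is a linear
     process with zero coefficients. *)
  have M0 : norm2 P (fun w => `|Y 1 w| - `|M thstar 1 w|) = 0.
    have := linear_process_cst _ (linear_processD X_sqr (-1) (Y_linear 1) (Ml _ thstar_in)).
    have cc k : c0 k + -1 * a k thstar = 0 by rewrite /c0; ring.
    rewrite cc => /(_ (fun k _ => cc k)) h.
    rewrite /norm2 (@ae_eq_Ex _ _ _ _ _ (cst 0)) ?Ex_cst ?sqrtr0//.
      apply: measurable_funX; apply: measurable_funB; apply: measurableT_comp => //;
        exact: measurable_funPT.
    apply: filterS h => w /eqP; rewrite mulN1r subr_eq0 => /eqP ->.
    by rewrite subrr expr0n.
  rewrite ltNge; apply/negP => le; apply: thn; apply: hId => // k.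
  have [Mi _] := Ml th Tth.
  have Di : sqr_integrable P (fun w => `|Y 1 w| - `|M th 1 w|).
    by apply: sqr_integrableB; exact: sqr_integrable_norm.
  have D0 : norm2 P (fun w => `|Y 1 w| - `|M th 1 w|) = 0.
    apply/eqP; rewrite -sqrf_eq0 eq_le sqr_ge0 andbT.
    have : norm2 P (fun w => `|X 1 w| - `|M th 1 w|) ^+ 2 <=
        norm2 P (fun w => `|X 1 w| - `|M thstar 1 w|) ^+ 2.
      by rewrite ler_pXn2r// nnegrE norm2_ge0.
    by rewrite (NE th Tth) (NE thstar thstar_in) M0 expr0n addr0 gerDl.
  have E : {ae P, forall w, `|Y 1 w| = `|M th 1 w|}.
    by apply: filterS (norm2_eq0 Di D0) => w /eqP; rewrite subr_eq0 => /eqP.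
  have c00 : 0 < c0 0%N by exact: a0_gt0.
  have inj := linear_process_abs_inj xi_indep xi_ident xi_sym xi_cont XE Y_past X_past
    X_sqr c00 Y_linear X_stat (Y_linear 1) (Ml th Tth) c00 (a0_gt0 th) E.
  by rewrite -(inj k).
have tail := process_tail xi_indep xi_ident xi_sym XE Y_past X_past X_sqr Ex_X_sqr X_stat q01.
have lln := rational_fit_cvg X_sqr X_stat X_erg.
apply: filterS2 lln tail => w lln tail.
(* The neighbourhood is one of pairs (th', n), the form of local uniformity that compactness stated
   by near coverings consumes. *)
have loc th : Theta th -> forall eps, 0 < eps ->
    \forall th' \near th & n \near \oo, Theta th' ->
      `|empirical_fit X n (fun k => a k th') w -
        norm2 P (fun w => `|X 1 w| - `|M th 1 w|)| <= eps.
  move=> Tth eps eps0.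
  have [del [K [del0 hn]]] := empirical_fit_equicvg X_sqr norm2_X (ltW Ca0) lln tail
    (is_M_linear _ _ _ (M_def th 1 Tth)) eps0.
  have near1 k (e : R) : 0 < e -> \forall th' \near th, `|a k th' - a k th| <= e.
    move=> e0; have h : \forall th' \near th, `|a k th - a k th'| <= e.
      by have /cvgrPdist_le := a_cont k th; apply.
    by apply: filterS h => th'; rewrite distrC.
  have near_sum m (e : R) : 0 < e -> \forall th' \near th, \sum_(k < m) `|a k th' - a k th| <= e.
    elim: m e => [|m IH] e e0; first by apply: filterS (near1 0%N e e0) => th' _; rewrite big_ord0 ltW.
    have e2 : 0 < e / 2 by rewrite divr_gt0.
    apply: filterS2 (IH _ e2) (near1 m _ e2) => th' h1 h2.
    by rewrite big_ord_recr/= (splitr e) lerD.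
  exists ([set th' | \sum_(k < K) `|a k th' - a k th| <= del],
    [set n | forall c', dyadic_bounded q Ca c' -> \sum_(k < K) `|c' k - a k th| <= del ->
      `|empirical_fit X n c' w - norm2 P (fun w => `|X 1 w| - `|M th 1 w|)| <= eps]).
    by split => //=; exact: near_sum.
  by move=> [th' n] [/= hA hB] Tth'; apply: hB => //; exact: bounded.
move=> U; rewrite nbhsE => -[V [oV Vst] VU].
(* The estimator must enter [V]; the part of [Theta] outside [V] is compact, and each of its points
   is excluded together with a neighbourhood for all large n. *)
have cK : compact (Theta `&` ~` V) by apply: compact_closedI => //; exact: open_closedC.
have far : \forall n \near \oo, Theta `&` ~` V `<=` (fun th => thhat n w <> th).
  apply: (compact_near_coveringP _).1 cK _ _ _ _ _ => th [Tth nV].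
  have thn : th <> thstar by move=> E; apply: nV; rewrite E.
  have g0 := gap th Tth thn; rewrite -subr_gt0 in g0.
  (* A quarter of the gap: with both fits that close to their limits, a minimizer near [th] would
     force the gap to be at most half of itself. *)
  have e0 := divr_gt0 g0 (ltr0n R 4).
  have [[A1 B1] [/= hA1 hB1] sub1] := loc th Tth _ e0.
  have [[A2 B2] [/= hA2 hB2] sub2] := loc thstar thstar_in _ e0.
  exists (A1, B1 `&` B2 `&` [set n | (0 < n)%N]).
    by split => //=; apply: filterI; [exact: filterI|exists 1%N].
  move=> [th' n] [/= h1 [[h2 h3] n0]] E.
  have [Tn min] := thhat_min n w n0; rewrite E in Tn min.
  (* The contrast is the square of the nonnegative [empirical_fit], so minimality passes to the fits
     themselves. *)
  have := min thstar thstar_in; rewrite !contrast_empirical_fit.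
  rewrite ler_pXn2r ?nnegrE ?rms_ge0// => le.
  have := sub1 (th', n) (conj h1 h2) Tn.
  have := sub2 (thstar, n) (conj (nbhs_singleton hA2) h3) thstar_in.
  rewrite !ler_distl => /andP[_ b1] /andP[b2 _]; move: le b1 b2 g0.
  move: (empirical_fit _ _ _ _) (empirical_fit _ _ _ _) (norm2 _ _) (norm2 _ _) => x1 x2 x3 x4; lra.
have pos : \forall n \near \oo, (0 < n)%N by exists 1%N.
apply: filterS2 far pos => n hfar n0; apply: VU; apply: contrapT => nV.
have [Tn _] := thhat_min n w n0.
exact: (hfar (thhat n w) (conj Tn nV)).
Qed.
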